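(* Consider the $L_\infty$ approximation problem ${\rm APP}=\{{\rm APP}_{\infty,d}\}_{d\in\mathbb N}$, ${\rm APP}_{\infty,d}:H(K_{d,\mathbf a,\mathbf b})\to L_\infty([0,1]^d)$, $f\mapsto f$, in the worst case setting, where $\omega\in(0,1)$ and $0<a_1\le a_2\le\cdots$, $\inf_i b_i>0$. The following hold for $\Lambda^{\rm std}$ and for $\Lambda^{\rm all}$. 1. For ABS or NOR, ALG-SPT holds iff ALG-PT holds iff $\liminf_{j\to\infty}\frac{a_j}{\ln j}>\frac{1}{\ln\omega^{-1}}$. 2. For NOR, ALG-QPT holds iff $\sup_{d\in\mathbb N}\frac1{\ln_+d}\sum_{j=1}^d a_j\omega^{a_j}<\infty$. 3. For ABS or NOR, ALG-UWT holds iff $\liminf_{j\to\infty}\frac{a_j}{\ln j}\ge\frac1{\ln\omega^{-1}}$. 4. For ABS or NOR, ALG-$(s,t)$-WT with $s>0$, $t>1$ always holds. 5. For ABS or NOR, ALG-$(s,1)$-WT with $s>0$ holds iff ALG-WT holds iff $\lim_{j\to\infty}a_j=\infty$. 6. For ABS or NOR, ALG-$(s,t)$-WT with $s>0$ and $0<t<1$ holds iff $\lim_{j\to\infty}j^{1-t}a_j\omega^{a_j}=0$.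
   Context: $\ln_+x=\max(1,\ln x)$. $H(K_{d,\mathbf a,\mathbf b})$ is the reproducing kernel Hilbert space of complex-valued 1-periodic continuous functions on $[0,1]^d$ with kernel $K_{d,\mathbf a,\mathbf b}(\mathbf x,\mathbf y)=\sum_{\mathbf h\in\mathbb Z^d}\omega_{\mathbf h}e^{2\pi i\mathbf h\cdot(\mathbf x-\mathbf y)}$, $\omega_{\mathbf h}=\omega^{\sum_{k=1}^d a_k|h_k|^{b_k}}$, and norm $\|f\|^2=\sum_{\mathbf h}\omega_{\mathbf h}^{-1}|\hat f(\mathbf h)|^2$, $\hat f(\mathbf h)=\int_{[0,1]^d}f(\mathbf x)e^{-2\pi i\mathbf h\cdot\mathbf x}d\mathbf x$. $L_\infty$ carries the sup norm. $\Lambda^{\rm all}$: all continuous linear functionals; $\Lambda^{\rm std}$: point evaluations. $e(n,{\rm APP}_{\infty,d};\Lambda)$: infimum over algorithms $A(f)=\phi(L_1f,\dots,L_nf)$, $L_i\in\Lambda$, $\phi$ arbitrary, of $\sup_{\|f\|\le1}\|f-A(f)\|_\infty$; $e(0,{\rm APP}_{\infty,d})=\sup_{\|f\|\le1}\|f\|_\infty$. $n^\star(\varepsilon,d;\Lambda)=\inf\{n\ge0:e(n,{\rm APP}_{\infty,d};\Lambda)\le\varepsilon{\rm CRI}_d\}$ with ${\rm CRI}_d=1$ (ABS) or $e(0,{\rm APP}_{\infty,d})$ (NOR). With $n=n^\star(\varepsilon,d;\Lambda)$, $d\in\mathbb N$, $\varepsilon\in(0,1)$ and limits as $\varepsilon^{-1}+d\to\infty$: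 ALG-SPT: $\exists C,p$ with $n\le C\varepsilon^{-p}$; ALG-PT: $n\le Cd^q\varepsilon^{-p}$; ALG-QPT: $n\le C\exp(t(1+\ln d)(1+\ln\varepsilon^{-1}))$; ALG-UWT: $\ln n/(\varepsilon^{-\alpha}+d^\beta)\to0$ for all $\alpha,\beta>0$; ALG-WT: $\ln n/(\varepsilon^{-1}+d)\to0$; ALG-$(s,t)$-WT: $\ln n/(\varepsilon^{-s}+d^t)\to0$. *)

(* Defs.v *)
From HB Require Import structures.
From mathcomp Require Import all_boot all_order all_algebra.
From mathcomp Require Import all_classical all_reals.
From mathcomp Require Import ereal topology normedtype sequences esum exp trigo.
From mathcomp Require Import complex.

Set Implicit Arguments.
Unset Strict Implicit.
Unset Printing Implicit Defensive.

Import Order.TTheory GRing.Theory Num.Theory.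
Local Open Scope classical_set_scope.
Local Open Scope ring_scope.

Section APP.
Variable R : realType.

Definition freq (d : nat) := {ffun 'I_d -> int}.

Definition cabs (z : R[i]) : R := ComplexField.Normc.normc z.

(* sum over a (countable) index type of an absolutely summable real family:
   positive part minus negative part *)
Definition rsum (T : choiceType) (g : T -> R) : R :=
  fine (esum setT (fun t => (Num.max (g t) 0)%:E)) -
  fine (esum setT (fun t => (Num.max (- g t) 0)%:E)).

Definition csum (T : choiceType) (F : T -> R[i]) : R[i] :=
  Complex (rsum (fun t => complex.Re (F t))) (rsum (fun t => complex.Im (F t))).

(* weights omega_h = omega ^ (sum_k a_k |h_k|^{b_k}); sequences a, b are
   indexed from 1, coordinate k : 'I_d corresponds to index k+1 *)
Definition weight (om : R) (a b : nat -> R) (d : nat) (h : freq d) : R :=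
  om `^ (\sum_(k < d) a k.+1 * (`|h k|%:~R) `^ (b k.+1)).

Definition cexp_freq (d : nat) (h : freq d) (x : 'I_d -> R) : R[i] :=
  let t := 2 * pi * \sum_(k < d) (h k)%:~R * x k in Complex (cos t) (sin t).

(* An element f of H(K_{d,a,b}) is represented by its Fourier coefficients
   c = (hat f (h))_h; f(x) = sum_h c_h e_h(x). *)
Definition eval (d : nat) (c : freq d -> R[i]) (x : 'I_d -> R) : R[i] :=
  csum (fun h => c h * cexp_freq h x).

Definition sqnorm (om : R) (a b : nat -> R) (d : nat) (c : freq d -> R[i])
  : \bar R := esum setT (fun h => ((weight om a b h)^-1 * cabs (c h) ^+ 2)%:E).

Definition inH om a b (d : nat) (c : freq d -> R[i]) := (sqnorm om a b c < +oo)%E.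
Definition unit_ball om a b (d : nat) (c : freq d -> R[i]) :=
  (sqnorm om a b c <= 1)%E.

Definition cube (d : nat) (x : 'I_d -> R) := forall k, 0 <= x k <= 1.

Definition Lall om a b (d : nat) (L : (freq d -> R[i]) -> R[i]) : Prop :=
  (forall (al be : R[i]) c c', inH om a b c -> inH om a b c' ->
     L (fun h => al * c h + be * c' h) = al * L c + be * L c') /\
  exists M : R, forall c, inH om a b c ->
     ((cabs (L c))%:E <= M%:E * sqrte (sqnorm om a b c))%E.

Definition Lstd (d : nat) (L : (freq d -> R[i]) -> R[i]) : Prop :=
  exists x, cube x /\ forall c, L c = eval c x.

Inductive info_class := Std | All.

Definition admissible om a b (d : nat) (cl : info_class) (L : (freq d -> R[i]) -> R[i]) :=
  match cl with Std => Lstd L | All => Lall om a b L end.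

Definition wc_error om a b (d n : nat) (L : 'I_n -> (freq d -> R[i]) -> R[i])
  (phi : ('I_n -> R[i]) -> ('I_d -> R) -> R[i]) : \bar R :=
  ereal_sup [set ereal_sup [set (cabs (eval c x - phi (fun i => L i c) x))%:E
                           | x in @cube d] | c in @unit_ball om a b d].

Definition nth_error om a b (cl : info_class) (n d : nat) : \bar R :=
  ereal_inf [set wc_error om a b L phi | L in
     [set L : 'I_n -> (freq d -> R[i]) -> R[i] |
        forall i, admissible om a b cl (L i)] & phi in setT].

Definition init_error om a b (d : nat) : \bar R :=
  ereal_sup [set ereal_sup [set (cabs (eval c x))%:E | x in @cube d]
            | c in @unit_ball om a b d].

Inductive criterion := ABS | NOR.

Definition CRI om a b (cr : criterion) (d : nat) : \bar R :=
  match cr with ABS => 1%E | NOR => init_error om a b d end.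

(* information complexity n^*(eps, d; Lambda), as an extended real
   (+oo if no n works) *)
Definition nstar om a b cl cr (eps : R) (d : nat) : \bar R :=
  ereal_inf [set (n%:R)%:E | n in
    [set n : nat | (nth_error om a b cl n d <= eps%:E * CRI om a b cr d)%E]].

Definition lnE (x : \bar R) : \bar R :=
  match x with EFin r => (ln r)%:E | +oo%E => +oo%E | -oo%E => -oo%E end.

Definition ALG_SPT (n : R -> nat -> \bar R) : Prop :=
  exists C p : R, forall d eps, (0 < d)%N -> 0 < eps < 1 ->
    (n eps d <= (C * eps `^ (- p))%:E)%E.

Definition ALG_PT (n : R -> nat -> \bar R) : Prop :=
  exists C p q : R, forall d eps, (0 < d)%N -> 0 < eps < 1 ->
    (n eps d <= (C * d%:R `^ q * eps `^ (- p))%:E)%E.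

Definition ALG_QPT (n : R -> nat -> \bar R) : Prop :=
  exists C t : R, forall d eps, (0 < d)%N -> 0 < eps < 1 ->
    (n eps d <= (C * expR (t * (1 + ln d%:R) * (1 + ln eps^-1)))%:E)%E.

Definition ALG_stWT (s t : R) (n : R -> nat -> \bar R) : Prop :=
  forall eta : R, 0 < eta -> exists M : R, forall d eps,
    (0 < d)%N -> 0 < eps < 1 -> M <= eps^-1 + d%:R ->
    (`|lnE (n eps d)| <= (eta * (eps `^ (- s) + d%:R `^ t))%:E)%E.

Definition ALG_WT (n : R -> nat -> \bar R) : Prop := ALG_stWT 1 1 n.

Definition ALG_UWT (n : R -> nat -> \bar R) : Prop :=
  forall al be : R, 0 < al -> 0 < be -> ALG_stWT al be n.

Definition ln_plus (x : R) : R := Num.max 1 (ln x).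

End APP.

(* Main.v *)
(** Upper bounds.  Let [A] be the set of frequencies of weight at least [delta].
    A rank-1 lattice with about [4 |A|^3] points can be chosen so that no two
    frequencies of [A] alias; every other frequency then aliases to at most one
    element of [A], so the lattice interpolation of the frequencies in [A] has
    squared error of the order of the sum of the weights outside [A].  As
    [sum_(h \notin A) w_h <= delta^s sum_h w_h^(1-s)] and
    [|A| <= delta^-(1-s) sum_h w_h^(1-s)], and as [sum_h w_h^(1-s)] is a product
    over the coordinates, this bounds the information complexity; [s] is constant
    for the conditions on [liminf] and on the divergence of [a], and of the order
    of [1 / ln d] for quasi-polynomial tractability and [0 < t < 1].

    Lower bounds.  For [n] linear functionals, averaging the diagonal of the
    reproducing kernel of their common kernel over a lattice gives
    [e(n)^2 >= sum_h min(w_h, lam) - n lam] for every [lam >= 0].  Since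
    [min(w, lam) >= w - lam^-theta w^(1+theta)], this is again a statement on the
    products [sum_h w_h] and [sum_h w_h^(1+theta)].  For polynomial tractability
    it is applied to the frequencies with exactly [r] coordinates equal to 1. *)

Require Import Defs.
From HB Require Import structures.
From mathcomp Require Import all_boot all_order all_algebra.
From mathcomp Require Import all_classical all_reals.
From mathcomp Require Import ereal topology normedtype sequences esum exp trigo.
From mathcomp Require Import complex.
From mathcomp Require Import zify ring lra.
Import Order.TTheory GRing.Theory Num.Theory numFieldNormedType.Exports.
Local Open Scope classical_set_scope.
Local Open Scope ring_scope.

Set Implicit Arguments.
Unset Strict Implicit.
Unset Printing Implicit Defensive.

(** * Reconstructing lattices *)

(** One pair of bounds serves all settings. Lattice algorithms use function values, which belong to
    both information classes, and the lower bounds hold for all bounded functionals. As the initial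
    error [I] is at least 1, upper bounds for ABS carry over to NOR, and lower bounds for NOR to
    ABS. The factor [a_k] in the criteria arises from differentiating [om^(tau a_k)] in [tau]. For
    NOR, [I^2] is comparable to [sum_h w_h], so the error only involves the ratio of
    [sum_h w_h^(1-s)] to [sum_h w_h]. This ratio is at most [exp(c s sum_k a_k om^((1-s) a_k))], and
    its factor [s] cancels the [1/s] paid for accuracy. For [s = 1/(2 ln_+ d)], the power
    [om^((1-s) a_k)] is at most a constant times [om^(a_k)] plus [1/d], and these remainders sum to
    1 over the [d] coordinates. The lower bound with [theta = 1/ln_+ d] produces the same sum. Apart
    from polynomial tractability, the lower bounds use only the fixed accuracy 1/8. The exponents
    [b_k] affect the estimates only through one moment constant, uniform in [k]. *)

Section Lattice.

(** For [de > 0] and [c] reduced modulo [N], the value [de * z + c] lies in [[0, (de + 1) N)]. A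
    multiple of [N] there has one of [de + 1] quotients, and the quotient determines [z]. This count
    holds for every modulus, prime or not. *)
Lemma card_bad_residue (N M : nat) (de c : int) : (0 < N)%N -> de != 0 ->
  (`|de| <= M)%N -> (#|[set z : 'I_N | (N %| (de * (z : nat)%:Z + c)%R)%Z]%SET| <= M.+1)%N.
Proof.
move=> N0 de0 deM.
wlog dep : de c de0 deM / 0 < de.
  move=> H; have [/H->//|de0'] : 0 < de \/ 0 < - de by lia.
  apply: leq_trans (H (- de) (- c) _ _ de0'); rewrite ?abszN ?oppr_eq0//.
  by apply: subset_leq_card; apply/fintype.subsetP => z; rewrite !inE mulNr -opprD !dvdzE abszN.
set c' := (c %% N)%Z.
have c'0 : 0 <= c' by apply: modz_ge0; lia.
have c'N : c' < N by apply: ltz_pmod; lia.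
pose t (z : 'I_N) : 'I_M.+1 := inord (absz ((de * (z : nat)%:Z + c') %/ N)%Z).
have tE (z : 'I_N) : (N %| de * (z : nat)%:Z + c)%Z ->
    de * (z : nat)%:Z + c' = (t z : nat)%:Z * N%:Z.
  move=> h.
  have [q qE] : exists q, de * (z : nat)%:Z + c' = q * N%:Z.
    have /dvdzP[q qE] := h; exists (q - (c %/ N)%Z).
    have := divz_eq c N; rewrite -/c' mulrBl -qE => {1}->; lra.
  have zN := ltn_ord z.
  rewrite /t qE mulzK; last by lia.
  have q0 : 0 <= q by nia.
  have qde : q <= de by nia.
  rewrite inordK; last by lia.
  by rewrite gez0_abs.
rewrite -[M.+1]card_ord -(card_in_imset (f := t)); first exact: max_card.
move=> z z'; rewrite !inE => /tE hz /tE hz' tt.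
rewrite tt -hz' in hz.
have := addIr _ hz => /(mulfI de0) [].
exact: val_inj.
Qed.

(** The coordinates of [z] are chosen one at a time. A vector [de i] with nonzero last entry
    excludes at most [M + 1] residues for the last coordinate, so fewer than [N] are excluded in
    all; a vector with zero last entry keeps the property obtained for the earlier coordinates. *)
Lemma greedy_generator (I : finType) (N M : nat) (de : I -> nat -> int) (d : nat) :
  (#|I| * M.+1 < N)%N -> (forall i k, `|de i k| <= M)%N ->
  exists2 z : nat -> nat, (forall k, z k < N)%N &
    forall i, (exists2 k, (k < d)%N & de i k != 0) ->
      ~~ (N %| \sum_(k < d) de i k * (z k)%:Z)%Z.
Proof.
move=> IN deM; have N0 : (0 < N)%N by apply: leq_ltn_trans IN.
elim: d => [|d [z zN IH]]; first by exists (fun=> 0)%N => // i [].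
pose c i := \sum_(k < d) de i k * (z k)%:Z.
pose bad i : {set 'I_N} := if de i d == 0 then finset.set0
  else [set w : 'I_N | (N %| de i d * (w : nat)%:Z + c i)%Z]%SET.
have cardbad : (#|\bigcup_i bad i|%SET < N)%N.
  apply: leq_ltn_trans IN; rewrite -sum_nat_const.
  apply: (big_ind2 (fun (A : {set 'I_N}) n => #|A| <= n)%N).
  - by rewrite cards0.
  - move=> A1 n1 A2 n2 h1 h2; apply: leq_trans (leq_add h1 h2).
    by rewrite cardsU leq_subr.
  - move=> i _; rewrite /bad; case: eqP => [_|/eqP h]; first by rewrite cards0.
    exact: card_bad_residue.
have [w wbad] : exists w : 'I_N, w \notin (\bigcup_i bad i)%SET.
  apply/existsP; apply: contraT; rewrite negb_exists => /forallP h.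
  suff : (\bigcup_i bad i)%SET = [set: 'I_N]%SET.
    by move=> hE; move: cardbad; rewrite hE cardsT card_ord ltnn.
  by apply/finset.setP => w; rewrite inE; move: (h w); rewrite negbK.
exists (fun k => if k == d then nat_of_ord w else z k) => [k|i hi].
  by case: ifP.
rewrite big_ord_recr /= eqxx.
under eq_bigr => k _ do rewrite ltn_eqF//.
rewrite -/(c i) addrC.
have [d0|d0] := eqVneq (de i d) 0.
  rewrite d0 mul0r add0r; apply: IH; case: hi => k; rewrite ltnS leq_eqVlt.
  by case/orP => [/eqP->|kd ek]; [rewrite d0|exists k].
apply: contra wbad => h; apply/finset.bigcupP; exists i => //.
by rewrite /bad (negbTE d0) inE.
Qed.

(** The greedy choice is applied to the differences of all pairs from [A], whose entries are at most
    [2 M]. Diagonal pairs have difference zero and impose no condition. *)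
Lemma lattice_generator (d : nat) (A : seq (freq d)) (M N : nat) :
  {in A, forall (h : freq d) k, (`|h k| <= M)%N} ->
  (size A * size A * M.*2.+1 < N)%N ->
  exists z : 'I_d -> nat, {in A &, injective
    (fun h : freq d => ((\sum_(k < d) h k * (z k)%:Z)%R %% N)%Z)}.
Proof.
move=> AM AN.
pose ext (h : freq d) (k : nat) : int := if insub k is Some k' then h k' else 0.
have extE h (k : 'I_d) : ext h k = h k by rewrite /ext valK.
pose de (i : 'I_(size A) * 'I_(size A)) k :=
  ext (tnth (in_tuple A) i.1) k - ext (tnth (in_tuple A) i.2) k.
have [z zN hz] : exists2 z : nat -> nat, (forall k, z k < N)%N &
    forall i, (exists2 k, (k < d)%N & de i k != 0) ->
      ~~ (N %| \sum_(k < d) de i k * (z k)%:Z)%Z.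
  apply: (@greedy_generator _ N M.*2) => [|i k].
    by rewrite card_prod card_ord.
  rewrite /de /ext; case: insubP => [k' _ _|_]; last by [].
  have distM (u v : int) : (`|u| <= M -> `|v| <= M -> `|(u - v)%R| <= M.*2)%N by lia.
  by apply: distM; apply: AM; apply: mem_tnth.
exists (fun k => z k) => h h' hA hA' /eqP; rewrite eqz_mod_dvd -sumrB => hN.
apply/eqP; apply: contraT => hh.
have /tnthP[i hi] : h \in in_tuple A by [].
have /tnthP[i' hi'] : h' \in in_tuple A by [].
have : ~~ (N %| \sum_(k < d) de (i, i') k * (z k)%:Z)%Z.
  apply: hz; have [k hk] : exists k, h k != h' k.
    apply/existsP; apply: contraNT hh; rewrite negb_exists => /forallP e.
    by apply/eqP/ffunP => k; apply/eqP; rewrite -[_ == _]negbK e.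
  by exists k => //; rewrite /de /= -hi -hi' !extE subr_eq0.
rewrite (eq_bigr (fun k : 'I_d => h k * (z k)%:Z - h' k * (z k)%:Z)) ?hN//.
by move=> k _; rewrite /de /= -hi -hi' !extE mulrBl.
Qed.

End Lattice.

(** * Characters and their orthogonality on rank-1 lattices *)

Section Cis.
Variable R : realType.
Implicit Types (t : R) (z w : R[i]).

Definition cis t : R[i] := Complex (cos t) (sin t).

Lemma conj_conjc z : z^* = conjc z.
Proof. by []. Qed.
Lemma cabsE z : (cabs z)%:C%C = `|z|.
Proof. by case: z. Qed.

Lemma cisD t1 t2 : cis (t1 + t2) = cis t1 * cis t2.
Proof. by rewrite /cis cosD sinD; apply/eqP; rewrite eq_complex /= eqxx/= addrC (mulrC (cos t1)) (mulrC (sin t1)) eqxx. Qed.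

Lemma cis0 : cis 0 = 1.
Proof. by rewrite /cis cos0 sin0. Qed.

Lemma conj_cis t : (cis t)^* = cis (- t).
Proof. by rewrite /cis cosN sinN. Qed.

Lemma cis_natmul (n : nat) t : cis (n%:R * t) = cis t ^+ n.
Proof.
elim: n => [|n IH]; first by rewrite mul0r cis0 expr0.
by rewrite -addn1 natrD mulrDl mul1r cisD IH exprD expr1.
Qed.

Lemma cis_2pi_nat (n : nat) : cis (2 * pi * n%:R) = 1.
Proof.
rewrite mulrC cis_natmul; suff -> : cis (2 * pi) = 1 by rewrite expr1n.
by rewrite /cis mulr_natl cos2pi sin2pi.
Qed.

Lemma cis_2pi_int (n : int) : cis (2 * pi * n%:~R) = 1.
Proof.
case: n => n; first exact: cis_2pi_nat.
by rewrite NegzE mulrNz mulrN -conj_cis cis_2pi_nat conjC1.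
Qed.

Lemma cis_neq1 t : 0 < t < 1 -> cis (2 * pi * t) != 1.
Proof.
move=> /andP[t0 t1]; rewrite eq_complex /= negb_and; apply/orP; left.
rewrite (_ : 2 * pi * t = (pi * t) *+ 2); last by rewrite -mulrA mulr_natl.
rewrite cos_mulr2n cos2sin2.
have s0 : 0 < sin (pi * t).
  by apply: sin_gt0_pi; rewrite mulr_gt0 ?pi_gt0//= gtr_pMr ?pi_gt0.
apply/eqP; nra.
Qed.

Lemma normc_cis t : `|cis t| = 1.
Proof. by rewrite normc_def /= cos2Dsin2 sqrtr1. Qed.

Lemma cabs_cis t : cabs (cis t) = 1.
Proof. by apply: complexI; rewrite cabsE normc_cis. Qed.

Lemma sum_cis_int (N : nat) (r : int) : (0 < N)%N ->
  \sum_(j < N) cis (2 * pi * (r%:~R * j%:R / N%:R)) = if (N %| r)%Z then N%:R else 0.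
Proof.
move=> N0; have N0' : (N%:R : R) != 0 by rewrite pnatr_eq0 -lt0n.
pose w := cis (2 * pi * (r%:~R / N%:R)).
have wE j : cis (2 * pi * (r%:~R * j%:R / N%:R)) = w ^+ j.
  by rewrite -cis_natmul; congr cis; field.
under eq_bigr do rewrite wE.
case: ifPn => [/dvdzP[q rE]|Nr].
  have -> : w = 1.
    by rewrite /w rE !intrM -[(N : int)%:~R]/(N%:R : R) mulfK// cis_2pi_int.
  by under eq_bigr do rewrite expr1n; rewrite sumr_const card_ord.
have w1 : w != 1.
  (* Reducing [r] modulo [N] brings the angle into the open unit interval, where the root of unity
     differs from 1; the geometric sum then vanishes. *)
  have -> : w = cis (2 * pi * ((r %% N)%Z%:~R / N%:R)).
    have e : r%:~R / N%:R = (r %/ N)%Z%:~R + (r %% N)%Z%:~R / N%:R :> R.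
      by rewrite [in LHS](divz_eq r N) rmorphD rmorphM [LHS]mulrDl mulfK.
    by rewrite /w e mulrDr cisD cis_2pi_int mul1r.
  have r0 : 0 <= (r %% N)%Z by apply: modz_ge0; lia.
  have rN : (r %% N)%Z < N by apply: ltz_pmod; lia.
  apply: cis_neq1; apply/andP; split.
    rewrite divr_gt0 ?ltr0n// ltr0z lt_neqAle r0 andbT eq_sym.
    by apply: contra Nr => /eqP h; apply/dvdz_mod0P.
  by rewrite ltr_pdivrMr ?ltr0n// mul1r -[N%:R]/(N%:Z%:~R) ltr_int.
apply/eqP; have := subrX1 w N; rewrite -wE mulfK// cis_2pi_int subrr => /esym/eqP.
by rewrite mulf_eq0 subr_eq0 (negbTE w1).
Qed.

(** On the points [j z / N] modulo 1 a character is determined by [r h], the residue of [h . z]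
    modulo [N]. Orthogonality is needed for all [h] and [h'], since frequencies outside [A] alias
    too; injectivity of [r] is only available on [A]. *)
Lemma lattice_points (d : nat) (A : seq (freq d)) (M N : nat) :
  {in A, forall (h : freq d) k, (`|h k| <= M)%N} ->
  (size A * size A * M.*2.+1 < N)%N ->
  exists (x : 'I_N -> 'I_d -> R) (r : freq d -> int),
  [/\ forall j, cube (x j), {in A &, injective r} &
   forall h h', \sum_j cexp_freq h (x j) * (cexp_freq h' (x j))^* =
     if r h == r h' then N%:R else 0].
Proof.
move=> AM AN; have N0 : (0 < N)%N by apply: leq_ltn_trans AN.
have N0' : (N%:R : R) != 0 by rewrite pnatr_eq0 -lt0n.
have [z zinj] := lattice_generator AM AN.
pose dot (h : freq d) : int := \sum_(k < d) h k * (z k)%:Z.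
exists (fun j k => ((j * z k) %% N)%N%:R / N%:R), (fun h => (dot h %% N)%Z).
split=> // [j k|h h'].
  rewrite divr_ge0//= ler_pdivrMr ?ltr0n// mul1r ler_nat ltnW//.
  by rewrite ltn_mod.
have eE (g : freq d) (j : 'I_N) :
    cexp_freq g (fun k => ((j * z k) %% N)%N%:R / N%:R) =
    cis (2 * pi * ((dot g)%:~R * j%:R / N%:R)).
  rewrite /cexp_freq -/(cis _).
  (* Replacing [j z_k] by its residue modulo [N] changes the phase by an integer. *)
  rewrite (_ : (dot g)%:~R * j%:R / N%:R =
     \sum_(k < d) (g k)%:~R * (((j * z k) %% N)%N%:R / N%:R)
     + (\sum_(k < d) g k * ((j * z k) %/ N)%N%:Z)%:~R).
    by rewrite (mulrDr (2 * pi)) cisD cis_2pi_int mulr1.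
  rewrite /dot !rmorph_sum /= -big_split /= -mulrA mulr_suml; apply: eq_bigr => k _.
  rewrite !intrM -mulrDr -mulrA; congr (_ * _).
  have := congr1 (fun n => n%:R : R) (divn_eq (j * z k) N).
  rewrite natrD !natrM => e.
  have {}e : (z k)%:R * j%:R = ((j * z k) %/ N)%N%:R * N%:R + ((j * z k) %% N)%N%:R :> R.
    by rewrite -e mulrC.
  by rewrite mulrA -[(z k)%:Z%:~R]/((z k)%:R : R) e mulrDl mulfK// addrC.
under eq_bigr => j _ do rewrite !eE conj_cis -cisD.
rewrite eqz_mod_dvd -sum_cis_int//; apply: eq_bigr => j _; congr cis.
by rewrite intrB; ring.
Qed.
End Cis.

(** * Absolutely summable families *)

Section Sums.
Variables (R : realType) (T : choiceType).
Implicit Types (f g p q : T -> R) (F G : T -> R[i]).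
Local Open Scope ereal_scope.

Definition tsum p : \bar R := \esum_(t in [set: T]) (p t)%:E.

Lemma tsum_ge0 p : (forall t, 0 <= p t)%R -> 0 <= tsum p.
Proof. by move=> p0; apply: esum_ge0 => t _; rewrite lee_fin. Qed.

Lemma tsum_fin p : (forall t, 0 <= p t)%R -> tsum p < +oo -> tsum p = (fine (tsum p))%:E.
Proof. by move=> p0 h; rewrite fineK// ge0_fin_numE// tsum_ge0. Qed.

Lemma le_tsum p q : (forall t, p t <= q t)%R -> tsum p <= tsum q.
Proof. by move=> pq; apply: le_esum => t _; rewrite lee_fin. Qed.

Lemma tsumD p q : (forall t, 0 <= p t)%R -> (forall t, 0 <= q t)%R ->
  tsum (fun t => p t + q t)%R = tsum p + tsum q.
Proof.
move=> p0 q0; rewrite /tsum -esumD; last 2 first.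
- by move=> t _; rewrite lee_fin.
- by move=> t _; rewrite lee_fin.
by apply: eq_esum => t _; rewrite EFinD.
Qed.

Lemma tsum_le p (x : \bar R) :
  (forall s : seq T, uniq s -> (\sum_(t <- s) p t)%:E <= x) -> tsum p <= x.
Proof.
move=> h; apply: ge_ereal_sup => _ [A [finA _] <-].
rewrite fsbig_finite//= sumEFin; apply: h; exact: finmap.fset_uniq.
Qed.

Lemma tsum_ge p (s : seq T) : (forall t, 0 <= p t)%R -> uniq s ->
  (\sum_(t <- s) p t)%:E <= tsum p.
Proof.
move=> p0 us; apply: esum_ge; exists [set` s]; first by split => //; exact: finite_seq.
by rewrite -fsbig_seq// sumEFin.
Qed.

Lemma tsumZ p (c : R) : (0 <= c)%R -> (forall t, 0 <= p t)%R ->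
  tsum (fun t => c * p t)%R = c%:E * tsum p.
Proof.
move=> c0 p0.
have le k q : (0 <= k)%R -> (forall t, 0 <= q t)%R ->
    tsum (fun t => k * q t)%R <= k%:E * tsum q.
  move=> k0 q0; apply: tsum_le => s us; rewrite -mulr_sumr EFinM.
  by apply: lee_wpmul2l; [rewrite lee_fin | exact: tsum_ge].
apply/eqP; rewrite eq_le le//=.
have [->|cn0] := eqVneq c 0%R.
  by rewrite mul0e tsum_ge0// => t; rewrite mul0r.
have cp : (0 < c)%R by rewrite lt_neqAle eq_sym cn0.
rewrite muleC -lee_pdivlMr// muleC.
apply: le_trans (le c^-1%R (fun t => c * p t)%R _ _).
- by apply: le_tsum => t; rewrite mulrA mulVf// mul1r.
- by rewrite invr_ge0.
- by move=> t; rewrite mulr_ge0.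
Qed.

(** [rsum] is defined by the canonical positive and negative parts; its value is the same for every
    splitting into nonnegative summable families. Linearity reduces to this, since sums of positive
    parts are not positive parts of sums. *)
Lemma rsum_diff g p q : (forall t, 0 <= p t)%R -> (forall t, 0 <= q t)%R ->
  tsum p < +oo -> tsum q < +oo -> (forall t, g t = p t - q t)%R ->
  (rsum g = fine (tsum p) - fine (tsum q))%R.
Proof.
move=> p0 q0 ps qs gpq.
pose gp t := Num.max (g t) 0%R; pose gm t := Num.max (- g t)%R 0%R.
rewrite /rsum -/(tsum gp) -/(tsum gm).
have gp0 t : (0 <= gp t)%R by rewrite le_max lexx orbT.
have gm0 t : (0 <= gm t)%R by rewrite le_max lexx orbT.
have gps : tsum gp < +oo.
  apply: le_lt_trans ps; apply: le_tsum => t; rewrite ge_max gpq p0 andbT.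
  by rewrite gerBl.
have gms : tsum gm < +oo.
  apply: le_lt_trans qs; apply: le_tsum => t; rewrite ge_max gpq q0 andbT opprB.
  by rewrite gerBl.
(* Comparing the two splittings by cross-addition avoids subtraction of extended reals. *)
have : tsum gp + tsum q = tsum gm + tsum p.
  rewrite -!tsumD//; apply: eq_esum => t _; congr EFin.
  rewrite /gp /gm gpq; case: (lerP 0 (p t - q t)) => h.
    by rewrite max_r ?oppr_le0//; ring.
  by rewrite max_l ?oppr_ge0 ?(ltW h)//; ring.
rewrite (tsum_fin p0 ps) (tsum_fin q0 qs) (tsum_fin gp0 gps) (tsum_fin gm0 gms) /=.
by rewrite -!EFinD => -[]; lra.
Qed.

Definition abssum f := tsum (fun t => `|f t|)%R < +oo.

Lemma abssum_le f q : (forall t, `|f t| <= q t)%R -> tsum q < +oo -> abssum f.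
Proof. by move=> h; apply: le_lt_trans; apply: le_tsum. Qed.

Lemma abssumZ c f : abssum f -> abssum (fun t => c * f t)%R.
Proof.
move=> hf; apply: (@abssum_le _ (fun t => `|c| * `|f t|)%R) => [t|].
  by rewrite normrM.
rewrite tsumZ//; apply: lte_mul_pinfty => //; by rewrite ?lee_fin.
Qed.

Let pos f t := Num.max (f t) 0%R.
Let pos_ge0 f t : (0 <= pos f t)%R. Proof. by rewrite le_max lexx orbT. Qed.
Let pos_le f t : (pos f t <= `|f t|)%R.
Proof. by rewrite ge_max normr_ge0 ler_norm. Qed.
Let posB f t : (f t = pos f t - pos (fun t => - f t) t)%R.
Proof.
rewrite /pos; case: (lerP 0 (f t)) => h.
  by rewrite max_r ?oppr_le0//; ring.
by rewrite max_l ?oppr_ge0 ?(ltW h)//; ring.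
Qed.
Let pos_lty f : abssum f -> tsum (pos f) < +oo.
Proof. by apply: le_lt_trans; apply: le_tsum. Qed.
Let neg_lty f : abssum f -> tsum (pos (fun t => - f t)%R) < +oo.
Proof.
by apply: le_lt_trans; apply: le_tsum => t; rewrite (le_trans (pos_le _ _))// normrN.
Qed.

Let rsum_of g p q (P Q : R) : (forall t, 0 <= p t)%R -> (forall t, 0 <= q t)%R ->
  tsum p = P%:E -> tsum q = Q%:E -> (forall t, g t = p t - q t)%R -> rsum g = (P - Q)%R.
Proof.
by move=> p0 q0 pP qQ e; rewrite (rsum_diff p0 q0 _ _ e) ?pP ?qQ ?ltry.
Qed.

Let rsum_posneg f : abssum f -> exists P Q : R,
  [/\ tsum (pos f) = P%:E, tsum (pos (fun t => - f t)%R) = Q%:E & rsum f = (P - Q)%R].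
Proof.
move=> hf; exists (fine (tsum (pos f))), (fine (tsum (pos (fun t => - f t)%R))).
split; last by [].
- by apply: tsum_fin; [exact: pos_ge0 | exact: pos_lty].
- by apply: tsum_fin; [exact: pos_ge0 | exact: neg_lty].
Qed.

Lemma rsumD f g : abssum f -> abssum g ->
  (rsum (fun t => f t + g t) = rsum f + rsum g)%R.
Proof.
move=> /rsum_posneg[P [Q [hP hQ ->]]] /rsum_posneg[P' [Q' [hP' hQ' ->]]].
rewrite (@rsum_of _ (fun t => pos f t + pos g t)%R
   (fun t => pos (fun t => - f t) t + pos (fun t => - g t) t)%R (P + P') (Q + Q')).
- by ring.
- by move=> t; apply: addr_ge0; apply: pos_ge0.
- by move=> t; apply: addr_ge0; apply: pos_ge0.
- by rewrite tsumD ?hP ?hP' ?EFinD//; apply: pos_ge0.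
- by rewrite tsumD ?hQ ?hQ' ?EFinD//; apply: pos_ge0.
- by move=> t; rewrite [in LHS](posB f) [in LHS](posB g); ring.
Qed.

Lemma rsumN f : abssum f -> (rsum (fun t => - f t) = - rsum f)%R.
Proof.
move=> /rsum_posneg[P [Q [hP hQ ->]]].
rewrite (@rsum_of _ (pos (fun t => - f t)%R) (pos f) Q P) //.
- by ring.
- by move=> t; rewrite [in LHS](posB f); ring.
Qed.

Lemma rsumZ c f : abssum f -> (rsum (fun t => c * f t) = c * rsum f)%R.
Proof.
move=> hf.
wlog c0 : c / (0 <= c)%R.
  move=> h; case: (lerP 0 c) => [/h//|c0].
  have := h (- c)%R; rewrite oppr_ge0 (ltW c0) => /(_ isT) => e.
  rewrite -[RHS]opprK -mulNr -e -rsumN; last exact: abssumZ.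
  by congr rsum; apply/funext => t; rewrite mulNr opprK.
have [P [Q [hP hQ ->]]] := rsum_posneg hf.
rewrite (@rsum_of _ (fun t => c * pos f t)%R (fun t => c * pos (fun t => - f t) t)%R
  (c * P) (c * Q)).
- by ring.
- by move=> t; rewrite mulr_ge0.
- by move=> t; rewrite mulr_ge0.
- by rewrite tsumZ// hP.
- by rewrite tsumZ// hQ.
- by move=> t; rewrite [in LHS](posB f) mulrBr.
Qed.

Lemma rsum_norm f (x : R) : tsum (fun t => `|f t|)%R <= x%:E -> (`|rsum f| <= x)%R.
Proof.
move=> hx; have hf : abssum f by apply: le_lt_trans hx _; rewrite ltry.
have [hp hn] := (pos_lty hf, neg_lty hf).
have lep : (fine (tsum (pos f)) <= x)%R.
  rewrite -lee_fin -tsum_fin//; apply: le_trans hx; apply: le_tsum => t; exact: pos_le.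
have len : (fine (tsum (pos (fun t => - f t))) <= x)%R.
  rewrite -lee_fin -tsum_fin//; apply: le_trans hx; apply: le_tsum => t.
  by rewrite (le_trans (pos_le _ _))// normrN.
rewrite /rsum -!/(tsum _) ler_norml.
have p0 : (0 <= fine (tsum (pos f)))%R by rewrite fine_ge0// tsum_ge0.
have n0 : (0 <= fine (tsum (pos (fun t => - f t))))%R by rewrite fine_ge0// tsum_ge0.
by rewrite /pos in p0 n0 lep len *; apply/andP; split; lra.
Qed.

Lemma rsum_single (t0 : T) (c : R) : (rsum (fun t => if t == t0 then c else 0) = c)%R.
Proof.
have one (d : R) : (0 <= d)%R -> tsum (fun t => if t == t0 then d else 0)%R = d%:E.
  move=> d0; rewrite -(@esum_set1 _ _ t0 (fun=> d%:E))// /tsum esum_mkcond [RHS]esum_mkcond.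
  apply: eq_esum => t _; rewrite in_setT; have [->|/eqP h] := eqVneq t t0.
    by rewrite mem_set.
  by rewrite memNset.
pose cp : R := Num.max c 0%R; pose cn : R := Num.max (- c)%R 0%R.
have cp0 : (0 <= cp)%R by rewrite le_max lexx orbT.
have cn0 : (0 <= cn)%R by rewrite le_max lexx orbT.
have cE : (c = cp - cn)%R by have := posB (fun=> c) t0.
rewrite (@rsum_of _ (fun t => if t == t0 then cp else 0)%R
  (fun t => if t == t0 then cn else 0)%R cp cn) ?one//.
- by move=> t; case: ifP.
- by move=> t; case: ifP.
- by move=> t; case: ifP; rewrite ?subr0.
Qed.

End Sums.

Section CSums.
Variables (R : realType) (T : choiceType).
Implicit Types (F G : T -> R[i]).

Definition csummable F := (tsum (fun t => cabs (F t)) < +oo)%E.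

Lemma cabs_ge0 (z : R[i]) : (0 <= cabs z)%R.
Proof. by rewrite -lecR cabsE; exact: normr_ge0. Qed.

Lemma Re_le_cabs (z : R[i]) : (`|complex.Re z| <= cabs z)%R.
Proof. by rewrite -lecR cabsE; exact: normc_ge_Re. Qed.

Lemma Im_le_cabs (z : R[i]) : (`|complex.Im z| <= cabs z)%R.
Proof.
case: z => x y; rewrite /cabs /= -sqrtr_sqr ler_sqrt ?addr_ge0 ?sqr_ge0//.
by rewrite lerDr sqr_ge0.
Qed.

Lemma cabsM (z w : R[i]) : (cabs (z * w) = cabs z * cabs w)%R.
Proof. exact: ComplexField.Normc.normcM. Qed.

Lemma cabsD (z w : R[i]) : (cabs (z + w) <= cabs z + cabs w)%R.
Proof. exact: le_normcD. Qed.

Lemma cabs_ReIm (z : R[i]) : (cabs z <= `|complex.Re z| + `|complex.Im z|)%R.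
Proof.
case: z => x y; rewrite /cabs /= -(@ler_pXn2r _ 2)// ?nnegrE ?addr_ge0//.
rewrite sqr_sqrtr ?addr_ge0 ?sqr_ge0// sqrrD !real_normK ?num_real//.
by rewrite lerD2r lerDl mulrn_wge0// mulr_ge0.
Qed.

Let csumRe F : csummable F -> abssum (fun t => complex.Re (F t)).
Proof. by apply: abssum_le => t; exact: Re_le_cabs. Qed.
Let csumIm F : csummable F -> abssum (fun t => complex.Im (F t)).
Proof. by apply: abssum_le => t; exact: Im_le_cabs. Qed.

Lemma csumD F G : csummable F -> csummable G ->
  (csum (fun t => F t + G t) = csum F + csum G)%R.
Proof.
move=> hF hG; rewrite /csum.
have -> : (fun t => complex.Re (F t + G t)) = (fun t => complex.Re (F t) + complex.Re (G t))%R.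
  by apply/funext => t; case: (F t); case: (G t).
have -> : (fun t => complex.Im (F t + G t)) = (fun t => complex.Im (F t) + complex.Im (G t))%R.
  by apply/funext => t; case: (F t); case: (G t).
by rewrite !rsumD//; [exact: csumIm|exact: csumIm|exact: csumRe|exact: csumRe].
Qed.

Lemma csumZ (c : R[i]) F : csummable F -> (csum (fun t => c * F t) = c * csum F)%R.
Proof.
move=> hF; case: c => x y; rewrite /csum.
have [hR hI] := (csumRe hF, csumIm hF).
have -> : (fun t => complex.Re (Complex x y * F t)) =
    (fun t => x * complex.Re (F t) + (- y) * complex.Im (F t))%R.
  by apply/funext => t; case: (F t) => u v /=; rewrite mulNr.
have -> : (fun t => complex.Im (Complex x y * F t)) =
    (fun t => x * complex.Im (F t) + y * complex.Re (F t))%R.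
  by apply/funext => t; case: (F t) => u v /=.
rewrite !rsumD ?rsumZ//; try exact: abssumZ.
by apply/eqP; rewrite eq_complex /= mulNr !eqxx.
Qed.

Lemma csummableD F G : csummable F -> csummable G -> csummable (fun t => F t + G t)%R.
Proof.
move=> hF hG; apply: (@le_lt_trans _ _ (tsum (fun t => cabs (F t) + cabs (G t))%R)).
  by apply: le_tsum => t; exact: cabsD.
by rewrite tsumD ?lte_add_pinfty// => t; exact: cabs_ge0.
Qed.

Lemma csummableM (k : T -> R[i]) (x : R) F : (forall t, cabs (k t) <= x)%R ->
  csummable F -> csummable (fun t => k t * F t)%R.
Proof.
move=> kx hF; apply: (@le_lt_trans _ _ (tsum (fun t => Num.max x 0 * cabs (F t))%R)).
  apply: le_tsum => t; rewrite cabsM ler_wpM2r ?cabs_ge0//.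
  by rewrite le_max kx.
rewrite tsumZ ?le_max ?lexx ?orbT//; last by move=> t; exact: cabs_ge0.
by rewrite lte_mul_pinfty// lee_fin le_max lexx orbT.
Qed.

Lemma csummableZ (c : R[i]) F : csummable F -> csummable (fun t => c * F t)%R.
Proof. by apply: (@csummableM (fun=> c) (cabs c)). Qed.

Lemma csummable0 : csummable (fun _ : T => 0%R : R[i]).
Proof.
by rewrite /csummable /tsum esum1 ?ltry// => t _; rewrite /cabs ComplexField.Normc.normc0.
Qed.

Lemma csum0 : csum (fun _ : T => 0 : R[i]) = 0.
Proof.
rewrite -[RHS](mul0r (csum (fun _ : T => 0 : R[i]))) -(csumZ 0 csummable0).
by congr csum; apply/funext => t; rewrite mul0r.
Qed.

Lemma csummable_sum (I : Type) (s : seq I) (FF : I -> T -> R[i]) :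
  (forall i, csummable (FF i)) -> csummable (fun t => \sum_(i <- s) FF i t)%R.
Proof.
move=> h; elim: s => [|i s IH].
  by under [X in csummable X]funext => t do rewrite big_nil; exact: csummable0.
by under [X in csummable X]funext => t do rewrite big_cons; exact: csummableD.
Qed.

Lemma csum_sum (I : Type) (s : seq I) (FF : I -> T -> R[i]) :
  (forall i, csummable (FF i)) ->
  csum (fun t => \sum_(i <- s) FF i t)%R = (\sum_(i <- s) csum (FF i))%R.
Proof.
move=> h; elim: s => [|i s IH].
  by under [X in csum X]funext => t do rewrite big_nil; rewrite big_nil csum0.
under [X in csum X]funext => t do rewrite big_cons.
by rewrite csumD ?IH ?big_cons//; exact: csummable_sum.
Qed.

(** The factor 2 comes from bounding the real and the imaginary part separately. It only affects
    constants. *)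
Lemma cabs_csum F (x : R) : (tsum (fun t => cabs (F t)) <= x%:E)%E ->
  (cabs (csum F) <= 2 * x)%R.
Proof.
move=> hx; apply: (le_trans (cabs_ReIm _)); rewrite mulr_natl mulr2n.
apply: lerD; apply: rsum_norm; apply: le_trans hx; apply: le_tsum => t.
  exact: Re_le_cabs.
exact: Im_le_cabs.
Qed.

Lemma csum_single (t0 : T) (c : R[i]) : (csum (fun t => if t == t0 then c else 0) = c)%R.
Proof.
case: c => x y; rewrite /csum.
have -> : (fun t => complex.Re (if t == t0 then Complex x y else 0)) =
   (fun t => if t == t0 then x else 0)%R.
  by apply/funext => t; case: ifP.
have -> : (fun t => complex.Im (if t == t0 then Complex x y else 0)) =
   (fun t => if t == t0 then y else 0)%R.
  by apply/funext => t; case: ifP.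
by rewrite !rsum_single.
Qed.

Lemma csummable_single (t0 : T) (c : R[i]) : csummable (fun t => if t == t0 then c else 0)%R.
Proof.
rewrite /csummable.
have -> : (fun t => cabs (if t == t0 then c else 0)) = (fun t => if t == t0 then cabs c else 0).
  apply/funext => t; case: ifP => // _.
  by rewrite /cabs ComplexField.Normc.normc0.
apply: le_lt_trans (ltry (cabs c)); apply: tsum_le => s us; rewrite lee_fin.
have [t0s|t0s] := boolP (t0 \in s).
  rewrite (bigD1_seq t0)//= eqxx big1 ?addr0// => t /negbTE ->//.
rewrite big_seq big1 ?cabs_ge0// => t ts; case: eqP => // tt.
by move: ts; rewrite tt (negbTE t0s).
Qed.

Lemma csum_finite (s : seq T) F : uniq s -> (forall t, t \notin s -> F t = 0)%R ->
  csummable F /\ (csum F = \sum_(t <- s) F t)%R.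
Proof.
move=> us F0.
have FE : F = (fun t => \sum_(t' <- s) if t == t' then F t' else 0)%R.
  apply/funext => t; have [ts|ts] := boolP (t \in s).
    rewrite (bigD1_seq t)//= eqxx big1 ?addr0// => t'.
    by rewrite eq_sym => /negbTE ->.
  rewrite F0// big_seq big1// => t' ts'; case: eqP => // tt.
  by move: ts; rewrite tt ts'.
have sm (t' : T) : csummable (fun t => if t == t' then F t' else 0)%R.
  exact: csummable_single.
split; first by rewrite FE; exact: csummable_sum.
rewrite [in LHS]FE csum_sum//.
by apply: eq_bigr => t' _; rewrite csum_single.
Qed.

End CSums.

(** * Upper bound for the error of lattice algorithms *)

Section SumAux.
Variables (R : realType) (T : choiceType).

Lemma ler_sum_sub (p : T -> R) (s s' : seq T) : (forall t, 0 <= p t) ->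
  uniq s -> uniq s' -> {subset s' <= s} -> \sum_(t <- s') p t <= \sum_(t <- s) p t.
Proof.
move=> p0 us us' sub.
have -> : \sum_(t <- s') p t = \sum_(t <- s | t \in s') p t.
  rewrite -[RHS]big_filter; apply: perm_big; apply: uniq_perm => //.
    exact: filter_uniq.
  by move=> t; rewrite mem_filter; case: (boolP (t \in s')) => // /sub ->.
by rewrite [leRHS](bigID (fun t => t \in s'))/= lerDl sumr_ge0.
Qed.

Lemma tsum_finite (p : T -> R) (s : seq T) : (forall t, 0 <= p t) -> uniq s ->
  (forall t, t \notin s -> p t = 0) -> tsum p = (\sum_(t <- s) p t)%:E.
Proof.
move=> p0 us ps; apply/eqP; rewrite eq_le tsum_ge// andbT.
apply: tsum_le => s' us'; rewrite lee_fin.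
rewrite (bigID (fun t => t \in s))/= [X in _ + X]big1 ?addr0; last first.
  by move=> t /ps.
rewrite -big_filter; apply: ler_sum_sub => //; first exact: filter_uniq.
by move=> t; rewrite mem_filter => /andP[].
Qed.

(** The optimal parameter is [k = X / t]. In this form Cauchy-Schwarz follows from termwise bounds
    by the arithmetic-geometric mean inequality. *)
Lemma ler_sqrt_amgm (X t q : R) : 0 < t ->
  (forall k, 0 < k -> X <= (k * t + q / k) / 2) -> X <= Num.sqrt (t * q).
Proof.
move=> t0 h; have [X0|X0] := lerP X 0; first exact: le_trans (sqrtr_ge0 _).
have := h (X / t) (divr_gt0 X0 t0); rewrite divfK ?gt_eqF// => hX.
have hX2 : X ^+ 2 <= t * q.
  have e : q / (X / t) * X = t * q by field; rewrite !gt_eqF.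
  rewrite expr2; nra.
by rewrite -(ger0_norm (ltW X0)) -sqrtr_sqr ler_wsqrtr.
Qed.

End SumAux.

Section Algorithms.
Variables (R : realType) (om : R) (a b : nat -> R) (d : nat).
Local Notation eval := Defs.eval.
Hypothesis om0 : 0 < om.
Implicit Types (h : freq d) (c : freq d -> R[i]) (x : 'I_d -> R).

Lemma weight_gt0 h : 0 < weight om a b h.
Proof. exact: powR_gt0. Qed.

Lemma sqnormE c : sqnorm om a b c = tsum (fun h => (weight om a b h)^-1 * cabs (c h) ^+ 2).
Proof. by []. Qed.

Lemma sqnorm_term_ge0 c h : 0 <= (weight om a b h)^-1 * cabs (c h) ^+ 2.
Proof. by rewrite mulr_ge0 ?sqr_ge0// invr_ge0 ltW ?weight_gt0. Qed.

(** Cauchy-Schwarz with the weights: termwise, [|c_h| <= (k w_h + |c_h|^2 / (k w_h)) / 2] for every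
    [k > 0]. *)
Lemma coef_tail (D : pred (freq d)) (t q : R) c : 0 < t ->
  (forall s : seq (freq d), uniq s -> all D s -> \sum_(h <- s) weight om a b h <= t) ->
  (sqnorm om a b c <= q%:E)%E ->
  (tsum (fun h => if D h then cabs (c h) else 0)%R <= (Num.sqrt (t * q))%:E)%E.
Proof.
move=> t0 ht hq; apply: tsum_le => s us; rewrite lee_fin.
rewrite -big_mkcond -big_filter /=; set s' := [seq h <- s | D h].
have us' : uniq s' by rewrite filter_uniq.
have As' : all D s' by exact: filter_all.
apply: ler_sqrt_amgm => // k k0.
have h1 := ht _ us' As'.
have h2 : \sum_(h <- s') (weight om a b h)^-1 * cabs (c h) ^+ 2 <= q.
  by rewrite -lee_fin; apply: le_trans hq; apply: tsum_ge => // h; exact: sqnorm_term_ge0.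
apply: (@le_trans _ _ (\sum_(h <- s')
    (k * weight om a b h + (weight om a b h)^-1 * cabs (c h) ^+ 2 / k) / 2)).
  apply: ler_sum => h _; have w0 := weight_gt0 h.
  set w := weight om a b h in w0 *; set y := cabs (c h).
  have e : w^-1 * y ^+ 2 / k = (y / (k * w)) ^+ 2 * (k * w).
    by field; rewrite !gt_eqF.
  have e' : y = (y / (k * w)) * (k * w) by rewrite divfK// gt_eqF// mulr_gt0.
  rewrite e {1}e'; set v := y / (k * w).
  have kw0 : 0 < k * w by rewrite mulr_gt0.
  have := sqr_ge0 (v - 1); move: kw0; set z := k * w => z0 hv.
  suff : 0 <= z * (v - 1) ^+ 2 by rewrite sqrrB1; nra.
  by rewrite mulr_ge0// ltW.
rewrite -mulr_suml big_split/= -mulr_sumr -mulr_suml ler_pM2r// lerD//.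
  by rewrite ler_pM2l.
by rewrite ler_pM2r ?invr_gt0.
Qed.

Lemma cabs_cexp h x : cabs (cexp_freq h x) = 1.
Proof. exact: cabs_cis. Qed.

Variable P : R.
Hypothesis P0 : 0 < P.
Hypothesis sum_weight : forall s : seq (freq d), uniq s -> \sum_(h <- s) weight om a b h <= P.

Lemma tsum_cabs c (q : R) : (sqnorm om a b c <= q%:E)%E ->
  (tsum (fun h => cabs (c h)) <= (Num.sqrt (P * q))%:E)%E.
Proof.
move=> hq; apply: (@coef_tail predT) => // s us _; exact: sum_weight.
Qed.

Lemma inH_fin c : inH om a b c -> exists2 q : R, 0 <= q & sqnorm om a b c = q%:E.
Proof.
move=> hc; have h0 : (0 <= sqnorm om a b c)%E.
  by apply: tsum_ge0 => h; exact: sqnorm_term_ge0.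
exists (fine (sqnorm om a b c)); first exact: fine_ge0.
by rewrite fineK// ge0_fin_numE.
Qed.

Lemma inH_csummable c : inH om a b c -> csummable c.
Proof.
by move=> /inH_fin[q _ qE]; apply: le_lt_trans (tsum_cabs _) _; [rewrite qE|exact: ltry].
Qed.

Lemma eval_csummable c x : inH om a b c -> csummable (fun h => c h * cexp_freq h x).
Proof.
move=> /inH_csummable hc.
under [X in csummable X]funext => h do rewrite mulrC.
by apply: (@csummableM _ _ _ 1) => // h; rewrite cabs_cexp.
Qed.

Lemma eval_linear (al be : R[i]) c c' x : inH om a b c -> inH om a b c' ->
  eval (fun h => al * c h + be * c' h) x = al * eval c x + be * eval c' x.
Proof.
move=> hc hc'; rewrite /eval -!csumZ; try exact: eval_csummable.
rewrite -csumD; try by apply: csummableZ; exact: eval_csummable.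
by congr csum; apply/funext => h; rewrite mulrDl !mulrA.
Qed.

Lemma cabs_eval c x (q : R) : (sqnorm om a b c <= q%:E)%E ->
  cabs (eval c x) <= 2 * Num.sqrt (P * q).
Proof.
move=> hq; apply: cabs_csum; apply: le_trans (tsum_cabs hq); apply: le_tsum => h.
by rewrite cabsM cabs_cexp mulr1.
Qed.

(** Summability of the weights makes point evaluation bounded. This inclusion makes lattice
    algorithms admissible for all functionals and transfers lower bounds to function values. *)
Lemma Lstd_Lall (L : (freq d -> R[i]) -> R[i]) : Lstd L -> Lall om a b L.
Proof.
move=> [x [_ Lx]]; split.
  by move=> al be c c' hc hc'; rewrite !Lx eval_linear.
exists (2 * Num.sqrt P) => c /inH_fin[q q0 qE]; rewrite qE /= -EFinM lee_fin Lx.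
by rewrite -mulrA -sqrtrM ?(ltW P0)//; apply: cabs_eval; rewrite qE.
Qed.

Lemma init_error_le : (init_error om a b d <= (2 * Num.sqrt P)%:E)%E.
Proof.
apply: ge_ereal_sup => _ [c hc <-]; apply: ge_ereal_sup => _ [x _ <-].
by rewrite lee_fin -[P]mulr1; exact: cabs_eval.
Qed.

(** The algorithm multiplies the coefficient at [h] by [S h], which is [e_h'(y)] if [h] aliases to
    some [h'] in [A] and zero otherwise. The error multiplier [e_h(y) - S h] vanishes on [A] and has
    modulus at most 2 elsewhere; together with the factor 2 for complex sums this gives the constant
    4. *)
Lemma lattice_error (cl : info_class) (A : seq (freq d)) (M N : nat) (t : R) :
  uniq A -> {in A, forall h k, (`|h k| <= M)%N} ->
  (size A * size A * M.*2.+1 < N)%N -> 0 < t ->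
  (forall s : seq (freq d), uniq s -> all (fun h => h \notin A) s ->
     \sum_(h <- s) weight om a b h <= t) ->
  (nth_error om a b cl N d <= (4 * Num.sqrt t)%:E)%E.
Proof.
move=> uA AM AN t0 ht; have N0 : (0 < N)%N by apply: leq_ltn_trans AN.
have N0' : (N%:R : R[i]) != 0 by rewrite pnatr_eq0 -lt0n.
have [x [r [xcube rinj xsum]]] := lattice_points R AM AN.
pose L (i : 'I_N) c := eval c (x i).
(* [N^-1 sum_i f(x_i) conj(e_h'(x_i))] is the lattice quadrature for the Fourier coefficient at
   [h']. *)
pose k h' i y : R[i] := N%:R^-1 * (cexp_freq h' (x i))^* * cexp_freq h' y.
pose phi (v : 'I_N -> R[i]) y := \sum_(h' <- A) \sum_i k h' i y * v i.
have Lad i : admissible om a b cl (L i).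
  have Ls : Lstd (L i) by exists (x i).
  by case: cl => //; exact: Lstd_Lall.
apply: (@le_trans _ _ (wc_error om a b L phi)).
  by apply: ereal_inf_lbound; exists L => //; exists phi.
apply: ge_ereal_sup => _ [c hc <-]; apply: ge_ereal_sup => _ [y _ <-].
have cH : inH om a b c by apply: le_lt_trans hc _; exact: ltry.
pose S h := \sum_(h' <- A | r h == r h') cexp_freq h' y.
have phiE : phi (fun i => L i c) y = csum (fun h => S h * c h).
  rewrite /phi; under eq_bigr => h' _ do under eq_bigr => i _ do
    rewrite /L /eval -csumZ ?eval_csummable//.
  have sm h' i : csummable (fun h => k h' i y * (c h * cexp_freq h (x i))).
    by apply: csummableZ; exact: eval_csummable.
  under eq_bigr => h' _ do rewrite -csum_sum//.
  rewrite -csum_sum; last by move=> h'; exact: csummable_sum.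
  congr csum; apply/funext => h; rewrite /S mulr_suml [RHS]big_mkcond; apply: eq_bigr => h' _.
  have := xsum h h'; case: ifP => _ e.
    transitivity ((\sum_j cexp_freq h (x j) * (cexp_freq h' (x j))^*) / N%:R
        * cexp_freq h' y * c h); last by rewrite e divff// mul1r.
    by rewrite !mulr_suml; apply: eq_bigr => j _; rewrite /k; ring.
  transitivity ((\sum_j cexp_freq h (x j) * (cexp_freq h' (x j))^*) / N%:R
        * cexp_freq h' y * c h); last by rewrite e !mul0r.
  by rewrite !mulr_suml; apply: eq_bigr => j _; rewrite /k; ring.
have SA h : h \in A -> S h = cexp_freq h y.
  move=> hA; rewrite /S big_mkcond (bigD1_seq h)//= eqxx big_seq_cond big1 ?addr0//.
  move=> h' /andP[h'A hh']; case: eqP => // /(rinj _ _ hA h'A) e.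
  by rewrite e eqxx in hh'.
(* Injectivity of [r] on [A] leaves at most one nonzero term in [S h], also for [h] outside [A]. *)
have S1 h : cabs (S h) <= 1.
  have [/hasP[h' h'A /eqP e]|/hasPn hn] := boolP (has (fun h' => r h == r h') A).
    rewrite /S big_mkcond (bigD1_seq h')//= e eqxx big_seq_cond big1 ?addr0 ?cabs_cexp//.
    move=> h2 /andP[h2A hh]; case: eqP => // /(rinj _ _ h'A h2A) e2.
    by rewrite e2 eqxx in hh.
  rewrite /S big_seq_cond big1.
    by rewrite /cabs ComplexField.Normc.normc0.
  by move=> h' /andP[h'A]; rewrite (negbTE (hn _ h'A)).
rewrite phiE lee_fin /eval -[X in _ - X]mul1r -mulNr -csumZ; last first.
  by apply: (@csummableM _ _ _ 1) => //; exact: inH_csummable.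
rewrite -csumD; [|exact: eval_csummable|]; last first.
  apply: csummableZ; apply: (@csummableM _ _ _ 1) => //; exact: inH_csummable.
rewrite (_ : 4 = 2 * 2); last by rewrite -natrM.
rewrite -mulrA; apply: cabs_csum.
rewrite EFinM -[t]mulr1.
apply: le_trans (lee_wpmul2l _ (coef_tail (D := fun h => h \notin A) t0 ht hc)); last first.
  by rewrite lee_fin.
rewrite -tsumZ//; last by move=> h; case: ifP => // _; exact: cabs_ge0.
apply: le_tsum => h; rewrite (_ : _ + _ = (cexp_freq h y - S h) * c h); last by ring.
rewrite cabsM; case: (boolP (h \in A)) => /= hA.
  by rewrite SA// subrr /cabs ComplexField.Normc.normc0 mul0r mulr0.
rewrite ler_wpM2r ?cabs_ge0//; apply: le_trans (cabsD _ _) _.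
by rewrite cabs_cexp /cabs normcN -/(cabs _) (_ : 2 = 1 + 1)// lerD.
Qed.

Lemma init_error_ge (s : seq (freq d)) : uniq s ->
  ((Num.sqrt (\sum_(h <- s) weight om a b h))%:E <= init_error om a b d)%E.
Proof.
move=> us; set S := \sum_(h <- s) _.
have S0 : 0 <= S by apply: sumr_ge0 => h _; rewrite ltW// weight_gt0.
(* The extremal function is the kernel at 0, truncated to [s] and normalized; its value at 0 is the
   square root of the truncated sum. *)
pose c h : R[i] := (if h \in s then weight om a b h / Num.sqrt S else 0)%:C%C.
have cE h : cabs (c h) = if h \in s then weight om a b h / Num.sqrt S else 0.
  apply: complexI; rewrite cabsE /c normc_def /= expr0n addr0 sqrtr_sqr ger0_norm//.
  by case: ifP => // _; rewrite divr_ge0 ?sqrtr_ge0// ltW// weight_gt0.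
have cball : unit_ball om a b c.
  rewrite /unit_ball sqnormE (tsum_finite (s := s))//.
  - rewrite lee_fin big_seq (eq_bigr (fun h => weight om a b h / S)).
      rewrite -big_seq -mulr_suml -/S; have [->|Sn] := eqVneq S 0; first by rewrite mul0r.
      by rewrite divff.
    move=> h hs; rewrite cE hs expr_div_n sqr_sqrtr// expr2 !mulrA mulVf ?mul1r//.
    by rewrite gt_eqF// weight_gt0.
  - exact: sqnorm_term_ge0.
  - by move=> h /negbTE hs; rewrite cE hs expr0n mulr0.
have x0 : cube (fun _ : 'I_d => 0 : R) by move=> k; rewrite lexx ler01.
have hsupp h : h \notin s -> c h * cexp_freq h (fun=> 0) = 0.
  by move=> /negbTE hs; rewrite /c hs mul0r.
have eE : eval c (fun=> 0) = (Num.sqrt S)%:C%C.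
  rewrite /eval (csum_finite us hsupp).2.
  rewrite (_ : Num.sqrt S = \sum_(h <- s) weight om a b h / Num.sqrt S).
    rewrite rmorph_sum/= big_seq [RHS]big_seq; apply: eq_bigr => h hs.
    rewrite /c hs /cexp_freq big1 ?mulr0 ?cos0 ?sin0 ?mulr1//.
    by move=> k _; rewrite mulr0.
  rewrite -mulr_suml -/S; have [->|Sn] := eqVneq S 0; first by rewrite sqrtr0 mul0r.
  by rewrite -{2}[S]sqr_sqrtr// expr2 mulfK// sqrtr_eq0 -ltNge lt_neqAle eq_sym Sn.
apply: (@le_trans _ _ (cabs (eval c (fun=> 0)))%:E).
  by rewrite eE lee_fin /cabs /= expr0n addr0 sqrtr_sqr ler_norm.
apply: (@le_trans _ _ (ereal_sup [set (cabs (eval c x))%:E | x in @cube R d])).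
  by apply: ereal_sup_ubound; exists (fun=> 0).
by apply: ereal_sup_ubound; exists c.
Qed.

Lemma inH_finite c (s : seq (freq d)) : uniq s -> (forall h, h \notin s -> c h = 0) ->
  sqnorm om a b c = (\sum_(h <- s) (weight om a b h)^-1 * cabs (c h) ^+ 2)%:E.
Proof.
move=> us cs; rewrite sqnormE (tsum_finite (s := s))//; first exact: sqnorm_term_ge0.
by move=> h /cs ->; rewrite /cabs ComplexField.Normc.normc0 expr0n mulr0.
Qed.

End Algorithms.

(** * Lower bound by the trace of the kernel *)

Section KernelFrame.
Variables (C : numClosedFieldType) (m n : nat).
Local Open Scope sesquilinear_scope.

(** Gram-Schmidt is applied to a basis of the left kernel of [B], whose dimension is
    [m - rank B >= m - n]. *)
Lemma kernel_unitary (B : 'M[C]_(m, n)) : exists (k : nat) (U : 'M[C]_(k, m)),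
  [/\ (m <= n + k)%N, U *m U^t* = 1%:M & U *m B = 0].
Proof.
exists (\rank (kermx B)), (schmidt (row_base (kermx B))); split.
- by rewrite mxrank_ker; have := rank_leq_col B; have := rank_leq_row B; lia.
- by apply/unitarymxP; apply: schmidt_unitarymx; exact: rank_leq_col.
- apply/sub_kermxP; rewrite eqmx_schmidt_free ?row_base_free//.
  by rewrite eq_row_base.
Qed.

Lemma unitary_sqnorm k (U : 'M[C]_(k, m)) : U *m U^t* = 1%:M ->
  \sum_j \sum_l `|U l j| ^+ 2 = k%:R.
Proof.
move=> UU; rewrite exchange_big /= -[k in RHS]card_ord -sumr_const; apply: eq_bigr => l _.
have := congr1 (fun M : 'M_k => M l l) UU; rewrite !mxE eqxx mulr1n => <-.
by apply: eq_bigr => j _; rewrite !mxE normCK.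
Qed.

(** The matrix [Q = U^t* U] is an orthogonal projection, so [Q_jj = sum_i |Q_ij|^2 >= Q_jj^2]. *)
Lemma unitary_col_le1 k (U : 'M[C]_(k, m)) j : U *m U^t* = 1%:M ->
  \sum_l `|U l j| ^+ 2 <= 1.
Proof.
move=> UU; pose Q := U^t* *m U.
have QQ : Q *m Q = Q by rewrite /Q mulmxA -(mulmxA _ U) UU mulmx1.
have QE : Q j j = \sum_l `|U l j| ^+ 2.
  by rewrite mxE; apply: eq_bigr => l _; rewrite !mxE normCK mulrC.
have Qh i : Q i j = (Q j i)^*.
  rewrite !mxE rmorph_sum /=; apply: eq_bigr => l _; rewrite !mxE.
  by rewrite rmorphM /= conjCK mulrC.
have Q0 : 0 <= Q j j by rewrite QE sumr_ge0// => l _; rewrite exprn_ge0.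
have le : Q j j ^+ 2 <= Q j j.
  have : (Q *m Q) j j = Q j j by rewrite QQ.
  rewrite [LHS]mxE => e; rewrite -[leRHS]e (bigD1 j)//= expr2 lerDl.
  by rewrite sumr_ge0// => i _; rewrite Qh -normCK exprn_ge0.
rewrite -QE; have [->|Qn] := eqVneq (Q j j) 0; first exact: ler01.
by rewrite -(@ler_pM2r _ (Q j j)) ?mul1r -?expr2// lt_neqAle eq_sym Qn.
Qed.

End KernelFrame.

Section LowerBound.
Variables (R : realType) (om : R) (a b : nat -> R) (d : nat).
Local Notation eval := Defs.eval.
Hypothesis om0 : 0 < om.
Variable P : R.
Hypothesis P0 : 0 < P.
Hypothesis sum_weight : forall s : seq (freq d), uniq s -> \sum_(h <- s) weight om a b h <= P.
Implicit Types (h : freq d) (c : freq d -> R[i]) (x : 'I_d -> R).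

Lemma sqr_cabs (z : R[i]) : ((cabs z ^+ 2)%:C)%C = `|z| ^+ 2.
Proof. by rewrite -cabsE rmorphXn. Qed.

Lemma cabs_midpoint (z w : R[i]) (e : R) : cabs (z - w) <= e -> cabs (- z - w) <= e ->
  cabs z <= e.
Proof.
move=> e1 e2; have e2' : cabs (z + w) <= e by rewrite /cabs -normcN opprD.
have := cabsD (z - w) (z + w); have -> : z - w + (z + w) = 2%:R * z by ring.
rewrite cabsM [cabs 2%:R](_ : _ = 2%:R); first by lra.
by apply: complexI; rewrite cabsE normr_nat rmorph_nat.
Qed.

Variables (s : seq (freq d)) (n : nat).
Hypothesis us : uniq s.
Let m := size s.
Let f (j : 'I_m) : freq d := tnth (in_tuple s) j.
Let f_inj : injective f.
Proof. by apply/tuple_uniqP. Qed.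
Let f_mem j : f j \in s. Proof. exact: mem_tnth. Qed.
Let sw (j : 'I_m) : R := Num.sqrt (weight om a b (f j)).
Let sw_ge0 j : 0 <= sw j. Proof. exact: sqrtr_ge0. Qed.
Let sw2 j : sw j ^+ 2 = weight om a b (f j).
Proof. by rewrite sqr_sqrtr// ltW// weight_gt0. Qed.

Let big_s (V : nmodType) (F : freq d -> V) : \sum_(h <- s) F h = \sum_j F (f j).
Proof. by rewrite -(big_tuple _ _ (in_tuple s) xpredT F). Qed.

(** The functions [sqrt(w_h) e_h] are orthonormal in the space, so [vec v] has the Euclidean norm of
    the coordinate vector [v]. *)
Let vec (v : 'I_m -> R[i]) h : R[i] := \sum_j (if f j == h then v j * (sw j)%:C%C else 0).

Let vec_f v j : vec v (f j) = v j * (sw j)%:C%C.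
Proof.
rewrite /vec (bigD1 j)//= eqxx big1 ?addr0// => j' jj'.
by rewrite (inj_eq f_inj) (negbTE jj').
Qed.

Let vec_out v h : h \notin s -> vec v h = 0.
Proof.
by move=> hs; rewrite /vec big1// => j _; case: eqP => // e; move: hs; rewrite -e f_mem.
Qed.

Let vec_sqnorm v : sqnorm om a b (vec v) = (\sum_j cabs (v j) ^+ 2)%:E.
Proof.
rewrite (inH_finite a b om0 us (@vec_out v)) big_s; congr EFin; apply: eq_bigr => j _.
rewrite vec_f cabsM exprMn [cabs (_)%:C%C](_ : _ = sw j).
  by rewrite sw2 mulrC mulfK// gt_eqF// weight_gt0.
by rewrite /cabs /= expr0n addr0 sqrtr_sqr ger0_norm.
Qed.

Let vec_eval v x : eval (vec v) x = \sum_j v j * ((sw j)%:C%C * cexp_freq (f j) x).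
Proof.
have h0 h : h \notin s -> vec v h * cexp_freq h x = 0.
  by move=> /vec_out ->; rewrite mul0r.
rewrite /Defs.eval (csum_finite us h0).2 big_s; apply: eq_bigr => j _.
by rewrite vec_f mulrA.
Qed.

Let vec_inH v : inH om a b (vec v). Proof. by rewrite /inH vec_sqnorm ltry. Qed.

Let delta (j : 'I_m) := vec (fun j' => (j' == j)%:R).

(** [Lall] provides linearity for combinations of two elements of the space; the general expansion
    adds one coordinate at a time. *)
Let Lall_vec (L : (freq d -> R[i]) -> R[i]) v : Lall om a b L ->
  L (vec v) = \sum_j v j * L (delta j).
Proof.
move=> [Llin _].
have L0 : L (vec (fun=> 0)) = 0.
  have v0 : vec (fun=> 0) = (fun=> 0).
    by apply/funext => h; rewrite /vec big1// => j _; rewrite mul0r if_same.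
  have := Llin 0 0 _ _ (vec_inH (fun=> 0)) (vec_inH (fun=> 0)).
  rewrite mul0r addr0 v0 => e; rewrite -[RHS]e.
  by congr L; apply/funext => h; rewrite mul0r addr0.
have key (r : seq 'I_m) : uniq r ->
    L (vec (fun j => if j \in r then v j else 0)) = \sum_(j <- r) v j * L (delta j).
  elim: r => [_|j0 r IH /= /andP[j0r ur]]; first by rewrite big_nil.
  rewrite big_cons -IH// -[X in _ + X]mul1r -Llin; [|exact: vec_inH|exact: vec_inH].
  congr L; apply/funext => h; rewrite /delta /vec !mulr_sumr -big_split /=.
  apply: eq_bigr => j _; case: eqP => _; last by rewrite !mulr0 addr0.
  rewrite in_cons; case: eqP => [->|_] /=.
    by rewrite (negbTE j0r) !(mul0r, mulr0, addr0, mul1r).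
  by rewrite mul0r mulr0 add0r mul1r.
have := key _ (enum_uniq 'I_m); rewrite big_enum /= => <-.
by congr L; congr vec; apply/funext => j; rewrite mem_enum.
Qed.

Variables (L : 'I_n -> (freq d -> R[i]) -> R[i])
  (phi : ('I_n -> R[i]) -> ('I_d -> R) -> R[i]) (t : R).
Hypothesis L_all : forall i, Lall om a b (L i).
Hypothesis err : (wc_error om a b L phi <= t%:E)%E.

(** An element with zero information and its negative get the same approximation, so one of the two
    errors is at least the modulus of the value at [x]. *)
Let err_kernel v x : cube x -> (forall i, L i (vec v) = 0) ->
  \sum_j cabs (v j) ^+ 2 <= 1 -> cabs (eval (vec v) x) <= t.
Proof.
move=> hx Lv v1.
have errv v' : (forall i, L i (vec v') = 0) -> \sum_j cabs (v' j) ^+ 2 <= 1 ->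
    cabs (eval (vec v') x - phi (fun=> 0) x) <= t.
  move=> Lv' v1'; rewrite -lee_fin; apply: le_trans err.
  have -> : (fun=> 0) = (fun i => L i (vec v')) by apply/funext => i; rewrite Lv'.
  apply: (@le_trans _ _ (ereal_sup
     [set (cabs (eval (vec v') x - phi (fun i => L i (vec v')) x))%:E | x in @cube R d])).
    by apply: ereal_sup_ubound; exists x.
  apply: ereal_sup_ubound; exists (vec v') => //.
  by rewrite /unit_ball vec_sqnorm lee_fin.
have e1 := errv v Lv v1.
have e2 : cabs (- eval (vec v) x - phi (fun=> 0) x) <= t.
  have := errv (fun j => - v j); rewrite vec_eval.
  rewrite (_ : \sum_j - v j * _ = - eval (vec v) x); last first.
    by rewrite vec_eval -sumrN; apply: eq_bigr => j _; rewrite mulNr.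
  apply=> [i|]; last by under eq_bigr do rewrite /cabs normcN -/(cabs _).
  rewrite Lall_vec//; under eq_bigr do rewrite mulNr.
  by rewrite sumrN -Lall_vec// Lv oppr0.
exact: cabs_midpoint e1 e2.
Qed.

(** The rows of [U] form an orthonormal family of at least [m - n] elements annihilated by all
    [L i]. The diagonal [sum_l |u_l(x)|^2] of their kernel is at most [t^2] at every point. Its
    average over a lattice that separates [s] is [sum_j w_j Q_j], where [0 <= Q_j <= 1] and
    [sum_j Q_j >= m - n]; the minimum with [lam] bounds this from below. *)
Lemma trace_lower_bound (lam : R) : 0 <= t -> 0 <= lam ->
  \sum_(h <- s) Num.min (weight om a b h) lam - n%:R * lam <= t ^+ 2.
Proof.
move=> t0 lam0.
have [k [U [mnk UU UL]]] := kernel_unitary (\matrix_(j < m, i < n) L i (delta j)).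
pose Q j : R := \sum_(l < k) cabs (U l j) ^+ 2.
have QC j : (Q j)%:C%C = \sum_l `|U l j| ^+ 2.
  by rewrite /Q rmorph_sum /=; apply: eq_bigr => l _; rewrite sqr_cabs.
have Q1 j : Q j <= 1 by rewrite -lecR QC unitary_col_le1.
have Qk : \sum_j Q j = k%:R.
  by apply: complexI; rewrite rmorph_sum rmorph_nat/= -(unitary_sqnorm UU); apply: eq_bigr.
pose u x (l : 'I_k) := \sum_j U l j * ((sw j)%:C%C * cexp_freq (f j) x).
have ux x : cube x -> \sum_l cabs (u x l) ^+ 2 <= t ^+ 2.
  move=> hx; set S := \sum_l _.
  have S0 : 0 <= S by apply: sumr_ge0 => l _; rewrite sqr_ge0.
  have [->|Sn] := eqVneq S 0; first exact: sqr_ge0.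
  have sS : 0 < Num.sqrt S by rewrite sqrtr_gt0 lt_neqAle eq_sym Sn.
  (* The unit vector giving equality in Cauchy-Schwarz: the combination of the rows with these
     coefficients takes the value [sqrt S] at [x]. *)
  pose w l : R[i] := (u x l)^* * (Num.sqrt S)^-1%:C%C.
  pose v j := \sum_l w l * U l j.
  have Lv i : L i (vec v) = 0.
    rewrite Lall_vec// /v; under eq_bigr do rewrite mulr_suml.
    rewrite exchange_big big1//= => l _; under eq_bigr do rewrite -mulrA.
    rewrite -mulr_sumr; have := congr1 (fun M : 'M_(k, n) => M l i) UL.
    rewrite !mxE; under eq_bigr do rewrite mxE; by move=> ->; rewrite mulr0.
  have w1 : \sum_l `|w l| ^+ 2 = 1.
    under eq_bigr do rewrite normrM exprMn norm_conjC -sqr_cabs.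
    rewrite -mulr_suml -rmorph_sum -/S normc_def /= expr0n addr0 -rmorphXn -rmorphM /=.
    by rewrite sqrtr_sqr ger0_norm ?invr_ge0 ?sqrtr_ge0// exprVn sqr_sqrtr// divff.
  have v1 : \sum_j cabs (v j) ^+ 2 <= 1.
    suff -> : \sum_j cabs (v j) ^+ 2 = 1 by [].
    apply: complexI; rewrite rmorph_sum rmorph1 /= -w1.
    under eq_bigr do rewrite sqr_cabs normCK /v rmorph_sum /= mulr_suml.
    rewrite exchange_big /=; apply: eq_bigr => l _.
    under eq_bigr do rewrite mulr_sumr.
    rewrite exchange_big /= (bigD1 l)//= [X in _ + X]big1 ?addr0.
      rewrite (eq_bigr (fun j => `|w l| ^+ 2 * (U l j * (U l j)^*))).
        rewrite -mulr_sumr; have := congr1 (fun M : 'M_k => M l l) UU.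
        rewrite !mxE eqxx; under eq_bigr do rewrite !mxE.
        by move=> ->; rewrite mulr1.
      by move=> j _; rewrite rmorphM /= normCK; ring.
    move=> l' ll'; rewrite (eq_bigr (fun j => (w l * (w l')^*) * (U l j * (U l' j)^*))).
      rewrite -mulr_sumr; have := congr1 (fun M : 'M_k => M l l') UU.
      rewrite !mxE eq_sym (negbTE ll'); under eq_bigr do rewrite !mxE.
      by move=> ->; rewrite mulr0.
    by move=> j _; rewrite rmorphM /=; ring.
  have := err_kernel hx Lv v1.
  rewrite vec_eval (_ : \sum_j _ = (Num.sqrt S)%:C%C).
    rewrite {1}/cabs /= expr0n addr0 sqrtr_sqr (ger0_norm (sqrtr_ge0 _)) => h.
    by rewrite -[S]sqr_sqrtr// ler_sqr ?nnegrE ?sqrtr_ge0.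
  rewrite /v; under eq_bigr do rewrite mulr_suml.
  rewrite exchange_big /= (eq_bigr (fun l => `|u x l| ^+ 2 * (Num.sqrt S)^-1%:C%C)).
    rewrite -mulr_suml; under eq_bigr do rewrite -sqr_cabs.
    rewrite -rmorph_sum -rmorphM /= -/S; congr (_%:C)%C.
    by rewrite -{1}[S]sqr_sqrtr// expr2 mulfK// gt_eqF.
  move=> l _; under eq_bigr do rewrite -mulrA.
  by rewrite -mulr_sumr -/(u x l) /w normCK; ring.
have [M hM] : exists M : nat, {in s, forall h j, (`|h j| <= M)%N}.
  exists (\sum_(h <- s) \sum_j `|h j|)%N => h hs j.
  rewrite (bigD1_seq h)//= (bigD1 j)//= -addnA; exact: leq_addr.
have [y [r [ycube rinj ysum]]] := lattice_points R hM (ltnSn _).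
set N := (_ * _).+1 in y ycube ysum.
have N0 : 0 < N%:R :> R by rewrite ltr0n.
have key : \sum_j weight om a b (f j) * Q j <= t ^+ 2.
  have : \sum_(i < N) \sum_l cabs (u (y i) l) ^+ 2 <= \sum_(i < N) t ^+ 2.
    by apply: ler_sum => i _; exact: ux.
  rewrite sumr_const card_ord -mulr_natl.
  suff -> : \sum_(i < N) \sum_l cabs (u (y i) l) ^+ 2 =
     N%:R * \sum_j weight om a b (f j) * Q j by rewrite ler_pM2l.
  apply: complexI; rewrite rmorphM rmorph_nat !rmorph_sum /=.
  under eq_bigr do rewrite rmorph_sum /=.
  rewrite exchange_big /=.
  transitivity (\sum_l N%:R * \sum_j (weight om a b (f j))%:C%C * `|U l j| ^+ 2); last first.
    rewrite -mulr_sumr exchange_big /=; congr (_ * _); apply: eq_bigr => j _.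
    by rewrite rmorphM /= QC mulr_sumr.
  apply: eq_bigr => l _.
  have expand i : (cabs (u (y i) l) ^+ 2)%:C%C = \sum_j \sum_j'
      U l j * ((sw j)%:C%C * cexp_freq (f j) (y i)) *
      (U l j' * ((sw j')%:C%C * cexp_freq (f j') (y i)))^*.
    rewrite sqr_cabs normCK /u rmorph_sum /= mulr_suml.
    by apply: eq_bigr => j _; rewrite mulr_sumr.
  under eq_bigr do rewrite expand.
  rewrite exchange_big /= mulr_sumr; apply: eq_bigr => j _.
  (* Cross terms of distinct frequencies of [s] cancel in the sum over the lattice, as their
     residues differ. *)
  rewrite exchange_big /= (bigD1 j)//= [X in _ + X]big1 ?addr0.
    rewrite (eq_bigr (fun i => (`|U l j| ^+ 2 * (weight om a b (f j))%:C%C) *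
       (cexp_freq (f j) (y i) * (cexp_freq (f j) (y i))^*))).
      by rewrite -mulr_sumr ysum eqxx; ring.
    move=> i _; rewrite -sw2 rmorphXn normCK !rmorphM /=.
    by rewrite [((sw j)%:C%C)^*]conj_conjc conjc_real; ring.
  move=> j' jj'; rewrite (eq_bigr (fun i => (U l j * (U l j')^* * (sw j)%:C%C * (sw j')%:C%C) *
       (cexp_freq (f j) (y i) * (cexp_freq (f j') (y i))^*))).
    rewrite -mulr_sumr ysum; case: eqP => [/rinj e|_]; last by rewrite mulr0.
    by move: jj'; rewrite -(inj_eq f_inj) e ?f_mem ?eqxx.
  move=> i _; rewrite !rmorphM /=.
  have AC (A B C D E F : R[i]) : A * (B * C) * (D * (E * F)) = A * D * B * E * (C * F) by ring.
  have -> : ((sw j')%:C%C)^* = (sw j')%:C%C by rewrite conj_conjc conjc_real.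
  exact: AC.
apply: le_trans key; rewrite big_s lerBlDr -lerBlDl -sumrB.
(* Termwise [min(w, lam) - w Q <= min(w, lam) (1 - Q) <= lam (1 - Q)], and the right-hand sides sum
   to [lam (m - k) <= lam n]. *)
apply: (@le_trans _ _ (\sum_j lam * (1 - Q j))).
  apply: ler_sum => j _; have w0 := weight_gt0 a b om0 (f j).
  have q1 := Q1 j; have q0 : 0 <= Q j by apply: sumr_ge0 => l _; rewrite sqr_ge0.
  have m1 : Num.min (weight om a b (f j)) lam <= weight om a b (f j) by rewrite ge_min lexx.
  have m2 : Num.min (weight om a b (f j)) lam <= lam by rewrite ge_min lexx orbT.
  nra.
rewrite -mulr_sumr sumrB Qk sumr_const card_ord mulrC ler_wpM2r//.
by rewrite lerBlDr -natrD ler_nat.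
Qed.

End LowerBound.

(** * Sums of weights over boxes *)

Section NthErrorLower.
Variables (R : realType) (om : R) (a b : nat -> R) (d : nat).
Hypothesis om0 : 0 < om.
Variable P : R.
Hypothesis P0 : 0 < P.
Hypothesis sum_weight : forall s : seq (freq d), uniq s -> \sum_(h <- s) weight om a b h <= P.

(** The infimum over algorithms need not be attained, so the trace bound is applied to an algorithm
    with error below some [t'] strictly between [t] and the claimed bound. *)
Lemma nth_error_lower cl n (t lam : R) (s : seq (freq d)) : 0 <= t -> 0 <= lam -> uniq s ->
  (nth_error om a b cl n d <= t%:E)%E ->
  \sum_(h <- s) Num.min (weight om a b h) lam - n%:R * lam <= t ^+ 2.
Proof.
move=> t0 lam0 us he; rewrite leNgt; apply/negP; set X := _ - _ => tX.
have X0 : 0 < X by apply: le_lt_trans tX; exact: sqr_ge0.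
have tsX : t < Num.sqrt X by rewrite -(ger0_norm t0) -sqrtr_sqr ltr_sqrt.
pose t' := (t + Num.sqrt X) / 2.
have [tt' t'X] : t < t' /\ t' < Num.sqrt X by split; rewrite /t'; lra.
have : (nth_error om a b cl n d < t'%:E)%E.
  by apply: le_lt_trans he _; rewrite lte_fin.
move=> /ereal_inf_lt[_ [L hL [phi _ <-]]] hlt.
have L_all i : Lall om a b (L i).
  have := hL i; rewrite /admissible; case: (cl) => // hS.
  exact: (Lstd_Lall om0 P0 sum_weight).
have t'0 : 0 <= t' by rewrite ltW// (le_lt_trans t0).
have := trace_lower_bound om0 us L_all (ltW hlt) t'0 lam0.
rewrite -/X => hX; have : X < X; last by rewrite ltxx.
apply: le_lt_trans hX _; rewrite -[ltRHS](sqr_sqrtr (ltW X0)).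
by rewrite ltr_sqr ?nnegrE ?sqrtr_ge0.
Qed.

End NthErrorLower.

Section Box.
Variables (R : realType).

Definition box (d m : nat) : seq (freq d) :=
  [seq [ffun k => (g k : nat)%:Z - m%:Z] | g : {ffun 'I_d -> 'I_(m.*2.+1)}].

Lemma box_inj (d m : nat) : injective
  (fun g : {ffun 'I_d -> 'I_(m.*2.+1)} => [ffun k => (g k : nat)%:Z - m%:Z] : freq d).
Proof.
move=> g g' /ffunP e; apply/ffunP => k; apply: val_inj.
by have := e k; rewrite !ffunE => /addIr [].
Qed.

Lemma box_uniq d m : uniq (box d m).
Proof. by rewrite map_inj_uniq ?enum_uniq//; exact: box_inj. Qed.

Lemma mem_box d m (h : freq d) : (forall k, (`|h k| <= m)%N) -> h \in box d m.
Proof.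
move=> hm; apply/mapP; exists [ffun k => inord (absz (h k + m%:Z))].
  by rewrite mem_enum.
apply/ffunP => k; rewrite !ffunE; have := hm k; move: (h k : int) => z hz.
by rewrite inordK; lia.
Qed.

Lemma big_box d m (F : 'I_d -> int -> R) :
  \sum_(h <- box d m) \prod_k F k (h k) =
  \prod_k \sum_(i < m.*2.+1) F k ((i : nat)%:Z - m%:Z).
Proof.
rewrite bigA_distr_bigA /= big_map big_enum /=; apply: eq_bigr => g _.
by apply: eq_bigr => k _; rewrite ffunE.
Qed.

Lemma sum_sym m (G : nat -> R) :
  \sum_(i < m.*2.+1) G (absz ((i : nat)%:Z - m%:Z)) = G 0%N + 2 * \sum_(1 <= j < m.+1) G j.
Proof.
rewrite -(big_mkord xpredT (fun i => G (absz (i%:Z - m%:Z)))) -addnn.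
rewrite (@big_cat_nat _ _ _ m)//=; last by lia.
rewrite big_nat_rev /= add0n.
have -> : \sum_(0 <= i < m) G (absz ((m - i.+1)%N%:Z - m%:Z)) = \sum_(0 <= i < m) G i.+1.
  rewrite !big_mkord; apply: eq_bigr => i _; congr G; have := ltn_ord i; lia.
have -> : \sum_(m <= i < (m + m).+1) G (absz (i%:Z - m%:Z)) = \sum_(0 <= i < m.+1) G i.
  rewrite -{1}[m]add0n big_addn subSn ?leq_addr// addnK.
  by rewrite !big_mkord; apply: eq_bigr => i _; congr G; lia.
rewrite [X in _ + X = _]big_nat_recl// [X in 2 * X]big_add1 /=; ring.
Qed.

End Box.

(** * Power sums of the weights and their superlevel sets *)

Section Weights.
Variables (R : realType) (om : R) (a b : nat -> R).
Hypothesis hom : 0 < om < 1.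
Hypothesis ha1 : 0 < a 1%N.
Hypothesis hamono : forall j : nat, (0 < j)%N -> a j <= a j.+1.
Variable b0 : R.
Hypothesis b0_gt0 : 0 < b0.
Hypothesis hb0 : forall j : nat, (0 < j)%N -> b0 <= b j.

Lemma om_gt0 : 0 < om. Proof. by case/andP: hom. Qed.
Lemma om_le1 : 0 < om <= 1. Proof. by case/andP: hom => -> /ltW ->. Qed.

Lemma a_mono i j : (0 < i)%N -> (i <= j)%N -> a i <= a j.
Proof.
move=> i0 /subnK <-; elim: (j - i)%N => [|n IH]; first by rewrite add0n.
by rewrite addSn; apply: le_trans IH _; apply: hamono; rewrite addn_gt0 i0 orbT.
Qed.

Lemma a_ge j : (0 < j)%N -> a 1%N <= a j.
Proof. by move=> j0; apply: a_mono. Qed.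

Lemma a_gt0 j : (0 < j)%N -> 0 < a j.
Proof. by move=> /a_ge; exact: lt_le_trans. Qed.

Lemma b_gt0 j : (0 < j)%N -> 0 < b j.
Proof. by move=> /hb0; exact: lt_le_trans. Qed.

Lemma le_powom x y : x <= y -> om `^ y <= om `^ x.
Proof. by move=> xy; apply: ger_powR xy; exact: om_le1. Qed.

Lemma powom_gt0 x : 0 < om `^ x.
Proof. by apply: powR_gt0; exact: om_gt0. Qed.

Lemma powom_le1 x : 0 <= x -> om `^ x <= 1.
Proof. by move=> x0; rewrite -(powRr0 om) le_powom. Qed.

Lemma powomD x y : om `^ (x + y) = om `^ x * om `^ y.
Proof. by rewrite powRD// (gt_eqF om_gt0) implybT. Qed.

Lemma expo_ge0 d (h : freq d) (k : 'I_d) : 0 <= a k.+1 * (`|h k|%:~R) `^ (b k.+1).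
Proof. by rewrite mulr_ge0 ?powR_ge0// ltW// a_gt0. Qed.

Lemma weight_le1 d (h : freq d) : weight om a b h <= 1.
Proof. by apply: powom_le1; apply: sumr_ge0 => k _; exact: expo_ge0. Qed.

Definition axis_sum (tau : R) (m k : nat) : R :=
  \sum_(1 <= j < m.+1) om `^ (tau * (a k * j%:R `^ b k)).

Definition boxprod (tau : R) (d m : nat) : R := \prod_(k < d) (1 + 2 * axis_sum tau m k.+1).

Lemma weight_powR tau d (h : freq d) : weight om a b h `^ tau =
  \prod_(k < d) om `^ (tau * (a k.+1 * (absz (h k))%:R `^ b k.+1)).
Proof.
rewrite /weight -powRrM mulrC mulr_sumr.
rewrite (big_morph (powR om) (id1 := 1) (op1 := *%R) powomD (powRr0 om)).
by apply: eq_bigr => k _; rewrite -abszE.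
Qed.

Lemma sum_box tau d m : \sum_(h <- box d m) weight om a b h `^ tau = boxprod tau d m.
Proof.
under eq_bigr do rewrite weight_powR.
rewrite (big_box m (fun k z => om `^ (tau * (a k.+1 * (absz z)%:R `^ b k.+1)))).
apply: eq_bigr => k _.
rewrite (sum_sym m (fun j => om `^ (tau * (a k.+1 * j%:R `^ b k.+1)))).
by rewrite powR0 ?gt_eqF ?b_gt0// !mulr0 powRr0.
Qed.

Lemma axis_sum_ge0 tau m k : 0 <= axis_sum tau m k.
Proof. by apply: sumr_ge0 => j _; rewrite ltW// powom_gt0. Qed.

Lemma boxprod_ge1 tau d m : 1 <= boxprod tau d m.
Proof.
rewrite /boxprod; elim/big_ind: _ => // [x y x1 y1|k _]; first by rewrite -[1]mulr1 ler_pM.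
by rewrite lerDl mulr_ge0// axis_sum_ge0.
Qed.

(** Every finite set of frequencies lies in a box. Bounds on [boxprod] uniform in [m] therefore
    control all finite sums, and infinite products are never formed. *)
Lemma sum_weight_box tau d (s : seq (freq d)) : uniq s ->
  exists m, \sum_(h <- s) weight om a b h `^ tau <= boxprod tau d m.
Proof.
move=> us; exists (\sum_(h <- s) \sum_j `|h j|)%N; rewrite -sum_box.
apply: ler_sum_sub => //; [by move=> h; exact: powR_ge0 | exact: box_uniq |].
move=> h hs; apply: mem_box => j.
by rewrite (bigD1_seq h)//= (bigD1 j)//= -addnA; exact: leq_addr.
Qed.

Lemma sum_weight_le tau d (E : R) (s : seq (freq d)) : (forall m, boxprod tau d m <= E) ->
  uniq s -> \sum_(h <- s) weight om a b h `^ tau <= E.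
Proof. by move=> hE us; have [m /le_trans] := sum_weight_box tau us; apply. Qed.

Lemma weight_pow1 d (h : freq d) : weight om a b h `^ 1 = weight om a b h.
Proof. by rewrite powRr1// ltW// weight_gt0// om_gt0. Qed.

(** On the superlevel set [de <= de^(1-sg) <= w^(1-sg)], because [de <= 1]. *)
Lemma card_superlevel sg d (E de : R) (s : seq (freq d)) : 0 < sg < 1 -> 0 < de <= 1 ->
  (forall m, boxprod (1 - sg) d m <= E) -> uniq s ->
  {in s, forall h, de <= weight om a b h} -> (size s)%:R <= E / de.
Proof.
move=> /andP[sg0 sg1] /andP[de0 de1] hE us hs.
rewrite ler_pdivlMr// mulr_natl.
have -> : de *+ size s = \sum_(h <- s) de by rewrite big_const_seq count_predT iter_addr_0.
apply: le_trans (sum_weight_le hE us); rewrite big_seq [leRHS]big_seq.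
apply: ler_sum => h /hs hw; apply: (@le_trans _ _ (de `^ (1 - sg))).
  by apply: ger1_powR; rewrite ?de0//; lra.
by apply: ge0_ler_powR => //; rewrite ?nnegrE ?ltW ?weight_gt0 ?om_gt0//; lra.
Qed.

(** With [h], the superlevel set contains all frequencies supported on coordinate [k] with entry [i]
    between 0 and [|h_k|], since decreasing entries in modulus raises the weight. Counting them
    bounds the extent of the set. *)
Lemma abs_superlevel sg d (E de : R) (h : freq d) k : 0 < sg < 1 -> 0 < de <= 1 ->
  (forall m, boxprod (1 - sg) d m <= E) -> de <= weight om a b h ->
  (absz (h k)).+1%:R <= E / de.
Proof.
move=> hsg hde hE hw.
pose g (i : nat) : freq d := [ffun k' => if k' == k then i%:Z else 0].
pose s := [seq g i | i <- iota 0 (absz (h k)).+1].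
have us : uniq s.
  rewrite map_inj_uniq ?iota_uniq// => i j /ffunP/(_ k).
  by rewrite !ffunE eqxx => -[].
have := card_superlevel hsg hde hE us; rewrite size_map size_iota; apply.
apply/allP; rewrite all_map; apply/allP => i; rewrite mem_iota add0n ltnS => /andP[_ ih] /=.
apply: le_trans hw _; apply: le_powom; apply: ler_sum => k' _.
rewrite ler_wpM2l ?(ltW (a_gt0 _))// ge0_ler_powR ?nnegrE ?ler0z//.
  by rewrite ltW// b_gt0.
by rewrite ler_int ffunE; case: eqP => [->|_]; rewrite ?normr0 -?abszE ?lez_nat.
Qed.

(** Both [|A|] and [M] are at most [X = E / de], so the lattice size [|A|^2 (2 M + 1) + 1] is at
    most [3 X^3 + 1 <= 4 X^3]. Outside [A], [w = w^sg w^(1-sg) <= de^sg w^(1-sg)]. *)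
Lemma nth_error_upper cl sg d (E de : R) : 0 < sg < 1 -> 0 < de <= 1 ->
  (forall m, boxprod (1 - sg) d m <= E) ->
  exists N : nat, [/\ (0 < N)%N, N%:R <= 4 * (E / de) ^+ 3 &
    (nth_error om a b cl N d <= (4 * Num.sqrt (de `^ sg * E))%:E)%E].
Proof.
move=> hsg hde hE; have [de0 de1] := andP hde; have [sg0 sg1] := andP hsg.
have E1 : 1 <= E by apply: le_trans (hE 0%N); exact: boxprod_ge1.
set X := E / de; have X1 : 1 <= X by rewrite /X ler_pdivlMr// mul1r (le_trans de1).
pose M := Num.trunc X; pose A := [seq h <- box d M | de <= weight om a b h].
have uA : uniq A by rewrite filter_uniq ?box_uniq.
have MX : M%:R <= X by rewrite /M truncn_le// (le_trans ler01).
have AM : {in A, forall (h : freq d) k, (`|h k| <= M)%N}.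
  move=> h; rewrite mem_filter => /andP[hw _] k; rewrite /M truncn_ge_nat.
    by apply: le_trans (abs_superlevel k hsg hde hE hw); rewrite ler_nat.
  by rewrite (le_trans ler01).
have inA h : de <= weight om a b h -> h \in A.
  move=> hw; rewrite mem_filter hw mem_box// => k; rewrite /M truncn_ge_nat.
    by apply: le_trans (abs_superlevel k hsg hde hE hw); rewrite ler_nat.
  by rewrite (le_trans ler01).
have AX : (size A)%:R <= X.
  apply: (card_superlevel hsg hde hE uA) => h.
  by rewrite mem_filter => /andP[].
pose N := (size A * size A * M.*2.+1).+1.
exists N; split => //.
  rewrite /N -addn1 natrD !natrM -addn1 natrD -muln2 natrM.
  have A0 : 0 <= (size A)%:R :> R by [].
  have M0 : 0 <= M%:R :> R by [].
  have : (size A)%:R * (size A)%:R <= X * X by rewrite ler_pM.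
  have : M%:R * 2 + 1 <= 3 * X by lra.
  move=> h1 h2; have : (size A)%:R * (size A)%:R * (M%:R * 2 + 1) <= X * X * (3 * X).
    by rewrite ler_pM ?mulr_ge0 ?addr_ge0 ?mulr_ge0.
  have : 1 <= X ^+ 3 by rewrite exprn_ege1.
  by rewrite !exprS expr0; nra.
have wle1 (s : seq (freq d)) : uniq s -> \sum_(h <- s) weight om a b h <= E.
  move=> us; apply: le_trans (sum_weight_le hE us); apply: ler_sum => h _.
  apply: ger1_powR; rewrite ?weight_gt0 ?weight_le1 ?om_gt0//; lra.
have E0 : 0 < E by apply: lt_le_trans E1.
apply: (lattice_error om_gt0 E0 wle1 cl uA AM (ltnSn _)).
  by rewrite mulr_gt0// powR_gt0.
move=> s us /allP hs.
have wE (h : freq d) : weight om a b h = weight om a b h `^ sg * weight om a b h `^ (1 - sg).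
  rewrite -powRD; first by rewrite addrC subrK weight_pow1.
  by apply/implyP => _; rewrite gt_eqF// weight_gt0// om_gt0.
apply: (@le_trans _ _ (\sum_(h <- s) de `^ sg * weight om a b h `^ (1 - sg))).
  rewrite big_seq [leRHS]big_seq; apply: ler_sum => h hin; rewrite [leLHS]wE.
  rewrite ler_wpM2r ?powR_ge0// ge0_ler_powR ?nnegrE ?(ltW sg0) ?(ltW de0)//.
    by rewrite ltW// weight_gt0// om_gt0.
  by rewrite leNgt; apply: contra (hs _ hin) => /ltW /inA.
by rewrite -mulr_sumr ler_wpM2l ?powR_ge0// sum_weight_le.
Qed.

Lemma init_error_le_boxprod d (Q : R) : (forall m, boxprod 1 d m <= Q) ->
  (init_error om a b d <= (2 * Num.sqrt Q)%:E)%E.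
Proof.
move=> hQ; have Q0 : 0 < Q by apply: lt_le_trans (hQ 0%N); exact: lt_le_trans (boxprod_ge1 _ _ _).
apply: (init_error_le om_gt0 Q0) => s us.
by under eq_bigr do rewrite -weight_pow1; exact: sum_weight_le.
Qed.

Lemma boxprod_le_init_error d m :
  ((Num.sqrt (boxprod 1 d m))%:E <= init_error om a b d)%E.
Proof.
rewrite -sum_box; under eq_bigr do rewrite weight_pow1.
exact: (init_error_ge _ _ om_gt0 (box_uniq d m)).
Qed.

End Weights.

(** * Estimates of the coordinate factors *)

Section Elementary.
Variable R : realType.
Implicit Types (x y c q : R).

Lemma ln_le_sub1 x : 0 < x -> ln x <= x - 1.
Proof.
by move=> x0; have := @le_ln1Dx R (x - 1); rewrite (addrC 1) subrK; apply; lra.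
Qed.

(** The graph of [ln] lies below its tangent at [q / c]. *)
Lemma mul_ln_le c q y : 0 < c -> 0 < q -> 0 < y ->
  q * ln y <= c * y - q + q * ln (q / c).
Proof.
move=> c0 q0 y0; have z0 : 0 < c * y / q by rewrite divr_gt0 ?mulr_gt0.
have := ln_le_sub1 z0.
have -> : c * y / q = y / (q / c) by field; rewrite !gt_eqF.
rewrite ln_div ?posrE ?divr_gt0// => h.
have : q * (ln y - ln (q / c)) <= q * (y / (q / c) - 1) by rewrite ler_pM2l.
have -> : q * (y / (q / c) - 1) = c * y - q by field; rewrite !gt_eqF.
lra.
Qed.

Lemma sum_inv_sq m : \sum_(1 <= j < m.+1) (j%:R ^+ 2)^-1 <= 2 :> R.
Proof.
case: m => [|m]; first by rewrite big_geq.
(* The stronger bound [2 - 1/m] makes the induction work. *)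
suff : \sum_(1 <= j < m.+2) (j%:R ^+ 2)^-1 <= 2 - m.+1%:R^-1 :> R.
  by move=> /le_trans; apply; rewrite gerBl.
elim: m => [|m IH]; first by rewrite big_nat1 expr1n invr1; lra.
rewrite big_nat_recr//=; apply: le_trans (lerD IH (lexx _)) _.
set u := m.+1%:R : R; have u1 : 1 <= u by rewrite /u ler1n.
have -> : m.+2%:R = u + 1 by rewrite /u -addn1 natrD.
rewrite -subr_ge0 [X in 0 <= X](_ : _ = (u * (u + 1) ^+ 2)^-1).
  by rewrite invr_ge0 mulr_ge0 ?sqr_ge0//; lra.
by field; rewrite !gt_eqF//; lra.
Qed.

End Elementary.

Section Analytic.
Variables (R : realType) (om : R) (a b : nat -> R).
Hypothesis hom : 0 < om < 1.
Hypothesis ha1 : 0 < a 1%N.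
Hypothesis hamono : forall j : nat, (0 < j)%N -> a j <= a j.+1.
Variable b0 : R.
Hypothesis b0_gt0 : 0 < b0.
Hypothesis hb0 : forall j : nat, (0 < j)%N -> b0 <= b j.

Local Notation axis_sum := (axis_sum om a b).
Local Notation boxprod := (boxprod om a b).
Local Notation Lom := (ln om^-1).
Let a0 j : (0 < j)%N -> 0 < a j. Proof. exact: a_gt0. Qed.
Let pow_gt0 x : 0 < om `^ x. Proof. exact: powom_gt0. Qed.
Let pow_ge0 x : 0 <= om `^ x. Proof. by rewrite ltW. Qed.

Lemma Lom_gt0 : 0 < Lom.
Proof. by case/andP: hom => o0 o1; rewrite ln_gt0// invf_gt1. Qed.

Lemma powomE x : om `^ x = expR (- (Lom * x)).
Proof.
case/andP: hom => o0 o1; rewrite /powR gt_eqF// lnV ?posrE//.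
by rewrite mulNr opprK mulrC.
Qed.

(** The extra factor [j^(b_k)] is what differentiation in [tau] brings down, besides [a_k].
    Uniformity in [k] is essential, since products over all coordinates are taken. *)
Definition moment_bound (C : R) : Prop :=
  forall tau k m, 1 / 2 <= tau <= 1 -> (0 < k)%N ->
  \sum_(1 <= j < m.+1) j%:R `^ b k * om `^ (tau * (a k * j%:R `^ b k)) <= C * om `^ (tau * a k).

Lemma axis_moment : exists2 C : R, 0 < C & moment_bound C.
Proof.
have L0 := Lom_gt0.
(* Put [y = j^(b_k) >= 1]. Then [c <= Lom tau a_k], and [j^2 <= y^p] because [b_k >= b0]. Hence
   [y j^2 <= y^q <= K exp(c (y - 1))], so each term is at most [K om^(tau a_k) / j^2]; the factor 2
   bounds the sum of the inverse squares. *)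
pose c := Lom * a 1%N / 2; pose p := 2 / b0; pose q := 1 + p.
have c0 : 0 < c by rewrite divr_gt0// mulr_gt0.
have p0 : 0 < p by rewrite divr_gt0.
have q0 : 0 < q by rewrite addr_gt0.
pose K := expR (q * ln (q / c) - q + c).
exists (K * 2) => [|tau k m /andP[t1 t2] k0]; first by rewrite mulr_gt0 ?expR_gt0.
rewrite -mulrA (mulrC 2) mulrA (mulrC K); apply: (@le_trans _ _ (\sum_(1 <= j < m.+1) (om `^ (tau * a k) * K) * (j%:R ^+ 2)^-1)); last first.
  by rewrite -mulr_sumr ler_wpM2l ?sum_inv_sq// mulr_ge0// expR_ge0.
rewrite big_nat_cond [leRHS]big_nat_cond; apply: ler_sum => j /andP[/andP[j1 _] _].
have j0 : 0 < j%:R :> R by rewrite ltr0n.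
have lj0 : 0 <= ln j%:R :> R by rewrite ln_ge0// ler1n.
have bk := hb0 k0.
set y := j%:R `^ b k; have y0 : 0 < y by rewrite powR_gt0.
have lny : ln y = b k * ln j%:R by rewrite ln_powR.
have y1 : 1 <= y.
  by rewrite -(powRr0 j%:R) /y ler_powR ?ler1n// ltW// (lt_le_trans b0_gt0).
rewrite !powomE -[X in X * expR _ <= _]lnK ?posrE// -[j%:R ^+ 2]lnK ?posrE ?exprn_gt0// -expRN -!expRD.
rewrite lnXn// ler_expR.
have h1 : q * ln y <= c * y - q + q * ln (q / c) by apply: mul_ln_le.
have h2 : 2 * ln j%:R <= p * ln y.
  rewrite lny mulrA ler_wpM2r// /p mulrAC ler_pdivlMr// ler_pM2l//.
have h3 : c * (y - 1) <= Lom * (tau * a k) * (y - 1).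
  rewrite ler_wpM2r ?subr_ge0// /c -mulrA ler_pM2l// mulrC.
  have := a_ge hamono k0; have := a0 k0; nra.
rewrite mulr2n /K.
have -> : Lom * (tau * (a k * y)) = Lom * (tau * a k) * (y - 1) + Lom * (tau * a k) by ring.
have e : q * ln y = ln y + p * ln y by rewrite /q; ring.
rewrite e in h1; move: (q * ln (q / c)) h1 => z h1.
lra.
Qed.

Lemma axis_sum_le (C : R) tau k m : moment_bound C ->
  1 / 2 <= tau <= 1 -> (0 < k)%N -> axis_sum tau m k <= C * om `^ (tau * a k).
Proof.
move=> hC ht k0; apply: le_trans (hC tau k m ht k0).
rewrite /axis_sum big_nat_cond [leRHS]big_nat_cond; apply: ler_sum => j /andP[/andP[j1 _] _].
rewrite ler_peMl//; apply: (@le_trans _ _ (j%:R `^ 0)); first by rewrite powRr0.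
by rewrite ler_powR ?ler1n// ltW// (b_gt0 b0_gt0 hb0).
Qed.

(** Termwise [1 - exp(-v) <= v] with [v = Lom sg a_k j^(b_k)]; the moment bound then sums the
    factors [j^(b_k)]. *)
Lemma axis_sum_diff (C : R) sg k m : moment_bound C ->
  0 <= sg <= 1 / 2 -> (0 < k)%N ->
  axis_sum (1 - sg) m k - axis_sum 1 m k <= sg * (Lom * C * (a k * om `^ ((1 - sg) * a k))).
Proof.
move=> hC /andP[s0 s1] k0; have ht : 1 / 2 <= 1 - sg <= 1 by apply/andP; split; lra.
have L0 := Lom_gt0; have ak0 := a0 k0.
apply: (@le_trans _ _ (sg * Lom * a k *
    \sum_(1 <= j < m.+1) j%:R `^ b k * om `^ ((1 - sg) * (a k * j%:R `^ b k)))); last first.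
  apply: (@le_trans _ _ (sg * Lom * a k * (C * om `^ ((1 - sg) * a k)))); last by rewrite le_eqVlt; apply/orP; left; apply/eqP; ring.
  by rewrite ler_wpM2l ?hC// !mulr_ge0// ltW.
rewrite /axis_sum -sumrB mulr_sumr; apply: ler_sum => j _.
set y := j%:R `^ b k; have y0 : 0 <= y by apply: powR_ge0.
rewrite (_ : 1 * (a k * y) = (1 - sg) * (a k * y) + sg * (a k * y)); last by ring.
rewrite powomD// [om `^ (sg * _)]powomE.
have h := expR_ge1Dx (- (Lom * (sg * (a k * y)))).
set w := om `^ ((1 - sg) * (a k * y)); have w0 : 0 <= w by apply: pow_ge0.
set v := Lom * (sg * (a k * y)) in h *.
have -> : sg * Lom * a k * (y * w) = w * v by rewrite /v; ring.
have : w * (1 - v) <= w * expR (- v) by rewrite ler_wpM2l//; lra.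
lra.
Qed.

(** Only the term [j = 1] is kept, which is why [m] must be positive. *)
Lemma axis_sum_diff_ge th k m : 0 <= th -> (0 < k)%N -> (0 < m)%N ->
  om `^ a k * (1 - om `^ (th * a k)) <= axis_sum 1 m k - axis_sum (1 + th) m k.
Proof.
move=> th0 k0 m0; rewrite /axis_sum -sumrB big_ltn//.
rewrite powR1 !mulr1 mul1r mulrDl mul1r powomD// mulrBr mulr1 lerDl.
apply: sumr_ge0 => j _; rewrite subr_ge0 mul1r mulrDl mul1r le_powom// lerDl.
by rewrite mulr_ge0// mulr_ge0 ?powR_ge0// ltW// a0.
Qed.

Lemma le_expR_prod (I : finType) (F G : I -> R) : (forall i, 0 <= F i) ->
  (forall i, F i <= expR (G i)) -> \prod_i F i <= expR (\sum_i G i).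
Proof.
by move=> F0 FG; rewrite expR_sum; apply: ler_prod => i _; rewrite F0 FG.
Qed.

Lemma boxprod_le (C : R) tau d m : moment_bound C ->
  1 / 2 <= tau <= 1 ->
  boxprod tau d m <= expR (2 * C * \sum_(k < d) om `^ (tau * a k.+1)).
Proof.
move=> hC ht; rewrite mulr_sumr; apply: le_expR_prod => k.
  by rewrite addr_ge0// mulr_ge0// axis_sum_ge0.
apply: le_trans (expR_ge1Dx _); rewrite lerD2l -mulrA ler_pM2l//.
exact: axis_sum_le.
Qed.

(** Factor by factor, [1 + 2 S' <= (1 + 2 S) (1 + 2 (S' - S))]. Keeping [boxprod 1] as a factor is
    what allows it to cancel against the squared initial error. *)
Lemma boxprod_shift (C : R) sg d m : moment_bound C ->
  0 <= sg <= 1 / 2 ->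
  boxprod (1 - sg) d m <=
  boxprod 1 d m * expR (sg * (2 * Lom * C * \sum_(k < d) a k.+1 * om `^ ((1 - sg) * a k.+1))).
Proof.
move=> hC hs; have [s0 s1] := andP hs.
rewrite !mulr_sumr expR_sum /boxprod -big_split /=; apply: ler_prod => k _.
have S0 := axis_sum_ge0 a b hom 1 m k.+1.
have S'0 := axis_sum_ge0 a b hom (1 - sg) m k.+1.
apply/andP; split; first by rewrite addr_ge0// mulr_ge0.
have hd := axis_sum_diff m hC hs (ltn0Sn k).
set S := axis_sum 1 m k.+1 in S0 hd *; set S' := axis_sum (1 - sg) m k.+1 in S'0 hd *.
have SS' : S <= S'.
  apply: ler_sum => j _; rewrite le_powom// ler_wpM2r ?mulr_ge0 ?powR_ge0 ?(ltW (a0 _))//.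
  by rewrite gerBl.
set D := sg * (2 * _ * _ * _).
have D2 : 1 + 2 * (S' - S) <= expR D.
  apply: le_trans (expR_ge1Dx _); rewrite lerD2l.
  have -> : D = 2 * (sg * (Lom * C * (a k.+1 * om `^ ((1 - sg) * a k.+1)))).
    by rewrite /D; ring.
  by rewrite ler_pM2l.
have : (1 + 2 * S) * (1 + 2 * (S' - S)) <= (1 + 2 * S) * expR D by rewrite ler_wpM2l//; lra.
apply: le_trans; nra.
Qed.

(** Since [S <= C], a decrease [D] of the axis sum lowers [1 + 2 S] at least by the proportion [x D]
    with [x = 2 / (1 + 2 C)], and [1 - x D <= exp(-x D)]. *)
Lemma boxprod_drop (C : R) th d m : moment_bound C ->
  0 < C -> 0 <= th -> (0 < m)%N ->
  boxprod (1 + th) d m <= boxprod 1 d m *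
    expR (- (2 / (1 + 2 * C)) * \sum_(k < d) om `^ a k.+1 * (1 - om `^ (th * a k.+1))).
Proof.
move=> hC C0 th0 m0.
rewrite !mulr_sumr expR_sum /boxprod -big_split /=; apply: ler_prod => k _.
have S0 := axis_sum_ge0 a b hom 1 m k.+1.
have S'0 := axis_sum_ge0 a b hom (1 + th) m k.+1.
apply/andP; split; first by rewrite addr_ge0// mulr_ge0.
have hd := axis_sum_diff_ge th0 (ltn0Sn k) m0.
have hS : axis_sum 1 m k.+1 <= C.
  have h1 : 1 / 2 <= (1 : R) <= 1 by apply/andP; split; lra.
  apply: (le_trans (axis_sum_le m hC h1 (ltn0Sn k))).
  by rewrite ler_piMr ?(ltW C0)// powom_le1// mul1r ltW// a0.
set S := axis_sum 1 m k.+1 in S0 hd hS *; set S' := axis_sum (1 + th) m k.+1 in S'0 hd *.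
set D := om `^ a k.+1 * _ in hd *.
have D0 : 0 <= D.
  by rewrite mulr_ge0// subr_ge0 powom_le1// mulr_ge0// ltW// a0.
have p1 : 0 < 1 + 2 * C by lra.
set x := 2 / (1 + 2 * C).
have hx : x * (1 + 2 * S) <= 2.
  have -> : x * (1 + 2 * S) = 2 * ((1 + 2 * S) / (1 + 2 * C)) by rewrite /x; field; rewrite gt_eqF.
  by rewrite -[leRHS]mulr1 ler_pM2l// ler_pdivrMr// mul1r; lra.
have x0 : 0 < x by rewrite divr_gt0.
have : (1 + 2 * S) * (1 - x * D) <= (1 + 2 * S) * expR (- x * D).
  rewrite ler_wpM2l//; first by lra.
  by apply: le_trans (expR_ge1Dx _); rewrite mulNr.
apply: le_trans; nra.
Qed.

Lemma boxprod_ge d m : (0 < m)%N ->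
  expR (1 / 2 * \sum_(k < d) om `^ a k.+1) <= boxprod 1 d m.
Proof.
move=> m0; rewrite mulr_sumr expR_sum; apply: ler_prod => k _; rewrite expR_ge0 /=.
set x := om `^ a k.+1.
have x0 : 0 <= x by apply: pow_ge0.
have x1 : x <= 1 by rewrite powom_le1// ltW// a0.
have hS : x <= axis_sum 1 m k.+1.
  rewrite /axis_sum big_ltn// powR1 mulr1 mul1r lerDl.
  by apply: sumr_ge0.
have h := expR_ge1Dx (- (1 / 2 * x)).
have e := expRxMexpNx_1 (1 / 2 * x).
have := expR_gt0 (1 / 2 * x).
set u := expR _ in e *; set v := expR (- _) in e h *; nra.
Qed.

End Analytic.

(** * Bounds on the information complexity *)

Section Complexity.
Variables (R : realType) (om : R) (a b : nat -> R).
Hypothesis hom : 0 < om < 1.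
Hypothesis ha1 : 0 < a 1%N.
Hypothesis hamono : forall j : nat, (0 < j)%N -> a j <= a j.+1.
Variable b0 : R.
Hypothesis b0_gt0 : 0 < b0.
Hypothesis hb0 : forall j : nat, (0 < j)%N -> b0 <= b j.

Local Notation boxprod := (boxprod om a b).
Local Notation Lom := (ln om^-1).
Local Notation nth_error := (nth_error om a b).
Local Notation init := (init_error om a b).
Let a0 j : (0 < j)%N -> 0 < a j. Proof. exact: a_gt0. Qed.
Let pow_ge0 x : 0 <= om `^ x. Proof. by rewrite ltW// powom_gt0. Qed.

(** The factor 8 is 4 from the squared constant of [init_error_le] times 2 for a box whose sum is
    within a factor 2 of the supremum. The box has [m > 0], as the lower bounds use the frequencies
    with entry 1. *)
Lemma init_errorP : exists2 C : R, 0 < C & forall d, exists I : R,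
  [/\ 1 <= I, init d = I%:E, forall m, boxprod 1 d m <= I ^+ 2,
   ln (I ^+ 2) <= C * (1 + \sum_(k < d) om `^ a k.+1) &
   exists2 m, (0 < m)%N & I ^+ 2 <= 8 * boxprod 1 d m].
Proof.
have [C C0 hC] := axis_moment hom ha1 hamono b0_gt0 hb0.
exists (ln 4 + 2 * C); first by rewrite addr_gt0 ?mulr_gt0 ?ln_gt0//; lra.
move=> d.
have le_init (Q : R) : (forall m, boxprod 1 d m <= Q) -> (init d <= (2 * Num.sqrt Q)%:E)%E.
  exact: (init_error_le_boxprod hom b0_gt0 hb0).
set S := \sum_(k < d) om `^ a k.+1.
have hQ m : boxprod 1 d m <= expR (2 * C * S).
  apply: le_trans (boxprod_le hom b0_gt0 hb0 d m hC _) _; first by apply/andP; split; lra.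
  by rewrite /S; under eq_bigr do rewrite mul1r.
have box_le m : ((Num.sqrt (boxprod 1 d m))%:E <= init d)%E.
  exact: (boxprod_le_init_error a hom b0_gt0 hb0).
have init_fin : init d \is a fin_num.
  rewrite fin_numElt (lt_le_trans (ltNyr _) (box_le 0%N))/=.
  exact: le_lt_trans (le_init _ hQ) (ltry _).
pose I := fine (init d); have IE : init d = I%:E by rewrite fineK.
have P1 m : 1 <= boxprod 1 d m by apply: boxprod_ge1.
have boxI m : boxprod 1 d m <= I ^+ 2.
  have := box_le m; rewrite IE lee_fin => h.
  rewrite -[leLHS]sqr_sqrtr; last by rewrite (le_trans ler01).
  by rewrite ler_sqr ?nnegrE ?sqrtr_ge0// (le_trans _ h) ?sqrtr_ge0.
have I1 : 1 <= I.
  have := box_le 0%N; rewrite IE lee_fin; apply: le_trans.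
  by rewrite -[leLHS]sqrtr1 ler_wsqrtr.
have leI (Q : R) : (forall m, boxprod 1 d m <= Q) -> I ^+ 2 <= 4 * Q.
  move=> hQ'; have Q0 : 0 <= Q by apply: le_trans (hQ' 0%N); apply: le_trans (P1 _); lra.
  have := le_init Q hQ'; rewrite IE lee_fin => h.
  have -> : 4 * Q = (2 * Num.sqrt Q) ^+ 2 by rewrite exprMn sqr_sqrtr// expr2 -natrM.
  by rewrite ler_sqr ?nnegrE ?mulr_ge0 ?sqrtr_ge0//; lra.
exists I; split => //.
  have S0 : 0 <= S by apply: sumr_ge0.
  have l4 : 0 <= ln 4 :> R by rewrite ln_ge0//; lra.
  apply: (@le_trans _ _ (ln (4 * expR (2 * C * S)))).
    rewrite ler_ln ?posrE ?exprn_gt0 ?mulr_gt0 ?expR_gt0//; last by rewrite (lt_le_trans ltr01).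
    exact: leI.
  rewrite lnM ?posrE ?expR_gt0// expRK; nra.
apply: contrapT => hno.
have : I ^+ 2 <= 4 * (I ^+ 2 / 8).
  apply: leI => m; rewrite leNgt; apply/negP => hm; apply: hno.
  exists m.+1 => //.
  have mono : boxprod 1 d m <= boxprod 1 d m.+1.
    apply: ler_prod => k _; rewrite addr_ge0 ?mulr_ge0 ?axis_sum_ge0//=.
    by rewrite lerD2l ler_pM2l// /axis_sum [leRHS]big_nat_recr//= lerDl.
  move: hm mono; set x := boxprod 1 d m; set y := boxprod 1 d m.+1; lra.
have : 0 < I ^+ 2 by rewrite exprn_gt0// (lt_le_trans ltr01).
move: (I ^+ 2) => z; lra.
Qed.

Let ln_size (E t sg : R) (N : nat) : 0 < sg -> 0 < E -> (0 < N)%N ->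
  N%:R <= 4 * (E / expR (- (t / sg))) ^+ 3 ->
  ln N%:R <= ln 4 + 3 * (ln E + t / sg).
Proof.
move=> sg0 E0 N0 h.
have e0 : 0 < E / expR (- (t / sg)) by rewrite divr_gt0 ?expR_gt0.
apply: (@le_trans _ _ (ln (4 * (E / expR (- (t / sg))) ^+ 3))).
  by rewrite ler_ln ?posrE ?ltr0n// mulr_gt0 ?exprn_gt0.
rewrite lnM ?posrE ?exprn_gt0// lnXn// ln_div ?posrE ?expR_gt0// expRK.
by rewrite opprK mulr_natl.
Qed.

Let powR_expN (t sg : R) : 0 < sg -> expR (- (t / sg)) `^ sg = expR (- t).
Proof. by move=> sg0; rewrite -expRM mulNr divfK ?gt_eqF. Qed.

Let expR_eps (eps : R) : 0 < eps -> expR (- (2 * ln eps^-1 + ln 16)) = eps ^+ 2 / 16.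
Proof.
move=> e0; rewrite opprD expRD lnV ?posrE// mulrN opprK expRM_natl lnK ?posrE//.
by rewrite expRN lnK ?posrE.
Qed.

(** With [E = exp(2 C S)], the threshold [de = exp(-t / sg)] satisfies [de^sg E = (eps / 4)^2],
    which is accuracy [eps] after the constant 4 of the lattice error. *)
Lemma complexity_upper_abs : exists2 C : R, 0 < C & forall cl sg d eps,
  0 < sg <= 1 / 2 -> 0 < eps < 1 -> exists N : nat,
  [/\ (0 < N)%N, (nth_error cl N d <= eps%:E)%E &
   ln N%:R <= C / sg * (1 + ln eps^-1 + \sum_(k < d) om `^ ((1 - sg) * a k.+1))].
Proof.
have [C C0 hC] := axis_moment hom ha1 hamono b0_gt0 hb0.
have l4 : 0 <= ln 4 :> R by rewrite ln_ge0//; lra.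
have l16 : 0 <= ln 16 :> R by rewrite ln_ge0//; lra.
exists (ln 4 + 3 * ln 16 + 6 + 12 * C); first by lra.
move=> cl sg d eps /andP[sg0 sg1] /andP[e0 e1].
set S := \sum_(k < d) _.
have S0 : 0 <= S by apply: sumr_ge0.
have le0 : 0 <= ln eps^-1 by rewrite ln_ge0// invf_ge1// ltW.
pose t := 2 * ln eps^-1 + ln 16 + 2 * C * S.
have CS0 : 0 <= C * S by rewrite mulr_ge0// ltW.
have t0 : 0 <= t by rewrite /t; lra.
have hsg : 0 < sg < 1 by apply/andP; split; lra.
have hde : 0 < expR (- (t / sg)) <= 1.
  by rewrite expR_gt0 expR_le1 oppr_le0 divr_ge0// ltW.
have hE m : boxprod (1 - sg) d m <= expR (2 * C * S).
  by apply: (boxprod_le hom b0_gt0 hb0 d m hC); apply/andP; split; lra.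
have [N [N0 hN hNerr]] := nth_error_upper hom ha1 hamono b0_gt0 hb0 cl hsg hde hE.
exists N; split => //.
  apply: le_trans hNerr _; rewrite lee_fin powR_expN// -expRD.
  have -> : - t + 2 * C * S = - (2 * ln eps^-1 + ln 16) by rewrite /t; ring.
  have -> : expR (- (2 * ln eps^-1 + ln 16)) = (eps / 4) ^+ 2 by rewrite expR_eps//; field.
  by rewrite sqrtr_sqr ger0_norm ?divr_ge0 ?(ltW e0)// mulrC divfK.
apply: le_trans (ln_size sg0 (expR_gt0 _) N0 hN) _; rewrite expRK.
have s1 : 1 <= sg^-1 by rewrite invf_ge1//; lra.
have -> : t / sg = sg^-1 * t by rewrite mulrC.
rewrite /t.
have -> : (ln 4 + 3 * ln 16 + 6 + 12 * C) / sg * (1 + ln eps^-1 + S) =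
  sg^-1 * ((ln 4 + 3 * ln 16 + 6 + 12 * C) * (1 + ln eps^-1 + S)) by ring.
set v := sg^-1 in s1 *; set l := ln eps^-1 in le0 *.
have h1 : ln 4 + 3 * (2 * C * S) <= v * (ln 4 + 3 * (2 * C * S)).
  by rewrite ler_peMl//; lra.
have h2 : v * (ln 4 + 3 * (2 * C * S) + 3 * (2 * l + ln 16 + 2 * C * S)) <=
   v * ((ln 4 + 3 * ln 16 + 6 + 12 * C) * (1 + l + S)).
  rewrite ler_pM2l//; last by lra.
  have : 0 <= ln 4 * (l + S) by rewrite mulr_ge0 ?addr_ge0.
  have : 0 <= ln 16 * (l + S) by rewrite mulr_ge0 ?addr_ge0.
  have : 0 <= C * l by rewrite mulr_ge0// ltW.
  lra.
apply: le_trans h2; lra.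
Qed.

(** Now [E = I^2 exp(sg W)]. The factor [I^2] belongs to the normalized accuracy, so the threshold
    only has to absorb [exp(sg W)]. This contributes [sg W / sg = W] to [ln N], free of [1 / sg]. *)
Lemma complexity_upper_nor : exists2 C : R, 0 < C & forall cl sg d eps,
  0 < sg <= 1 / 2 -> 0 < eps < 1 -> exists N : nat,
  [/\ (0 < N)%N, (nth_error cl N d <= eps%:E * init d)%E &
   ln N%:R <= C / sg * (1 + ln eps^-1) + C * \sum_(k < d) a k.+1 * om `^ ((1 - sg) * a k.+1)].
Proof.
have [C C0 hC] := axis_moment hom ha1 hamono b0_gt0 hb0.
have [C' C'0 hI] := init_errorP.
have l4 : 0 <= ln 4 :> R by rewrite ln_ge0//; lra.
have l16 : 0 <= ln 16 :> R by rewrite ln_ge0//; lra.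
have L0 := Lom_gt0 hom; have a10 := ha1.
pose K := ln 4 + 3 * ln 16 + 6 + 12 * (Lom * C) + 3 * C' + 3 * (C' / a 1%N).
have LC0 : 0 < Lom * C by rewrite mulr_gt0.
have Ca0 : 0 < C' / a 1%N by rewrite divr_gt0.
exists K; first by rewrite /K; lra.
move=> cl sg d eps /andP[sg0 sg1] /andP[e0 e1].
have [I [I1 IE boxI lnI _]] := hI d.
set S := \sum_(k < d) _.
have S0 : 0 <= S by apply: sumr_ge0 => k _; rewrite mulr_ge0// ltW// a0.
have le0 : 0 <= ln eps^-1 by rewrite ln_ge0// invf_ge1// ltW.
pose W := 2 * Lom * C * S.
have W0 : 0 <= W by rewrite /W -!mulrA mulr_ge0// mulr_ge0 ?(ltW L0)// mulr_ge0// ltW.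
pose t := 2 * ln eps^-1 + ln 16 + sg * W.
have sW0 : 0 <= sg * W by rewrite mulr_ge0// ltW.
have t0 : 0 <= t by rewrite /t; lra.
have hsg : 0 < sg < 1 by apply/andP; split; lra.
have hde : 0 < expR (- (t / sg)) <= 1.
  by rewrite expR_gt0 expR_le1 oppr_le0 divr_ge0// ltW.
have I20 : 0 < I ^+ 2 by rewrite exprn_gt0// (lt_le_trans ltr01).
have hE m : boxprod (1 - sg) d m <= I ^+ 2 * expR (sg * W).
  have hs : 0 <= sg <= 1 / 2 by rewrite (ltW sg0).
  apply: (le_trans (boxprod_shift hom ha1 hamono d m hC hs)).
  by rewrite ler_wpM2r ?expR_ge0.
have [N [N0 hN hNerr]] := nth_error_upper hom ha1 hamono b0_gt0 hb0 cl hsg hde hE.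
exists N; split => //.
  apply: le_trans hNerr _; rewrite IE -EFinM lee_fin powR_expN//.
  rewrite mulrCA -expRD.
  have -> : - t + sg * W = - (2 * ln eps^-1 + ln 16) by rewrite /t; ring.
  rewrite expR_eps//.
  have -> : I ^+ 2 * (eps ^+ 2 / 16) = (eps * I / 4) ^+ 2 by field.
  rewrite sqrtr_sqr ger0_norm; first by rewrite mulrC divfK.
  by rewrite divr_ge0// mulr_ge0 ?(ltW e0)// (le_trans ler01).
have E0 : 0 < I ^+ 2 * expR (sg * W) by rewrite mulr_gt0 ?expR_gt0.
apply: le_trans (ln_size sg0 E0 N0 hN) _; rewrite lnM ?posrE ?expR_gt0// expRK.
have sumle : \sum_(k < d) om `^ a k.+1 <= S / a 1%N.
  rewrite ler_pdivlMr// mulr_suml; apply: ler_sum => k _; rewrite mulrC.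
  apply: ler_pM => //; [exact: ltW | exact: a_ge | apply: le_powom => //].
  by rewrite ler_piMl ?(ltW (a0 _))//; lra.
have lnI' : ln (I ^+ 2) <= C' + C' / a 1%N * S.
  apply: (le_trans lnI); rewrite mulrDr mulr1 lerD2l -mulrA ler_pM2l//.
  by rewrite mulrC.
have s1 : 1 <= sg^-1 by rewrite invf_ge1//; lra.
have -> : t / sg = sg^-1 * (2 * ln eps^-1 + ln 16) + W by rewrite /t; field; rewrite gt_eqF.
have -> : K / sg * (1 + ln eps^-1) = sg^-1 * (K * (1 + ln eps^-1)) by ring.
have sgW : sg * W <= W by rewrite ler_piMl//; lra.
have WE : W = 2 * (Lom * C) * S by rewrite /W; ring.
set v := sg^-1 in s1 *; set l := ln eps^-1 in le0 *.
set x := Lom * C in LC0 WE *; set y := C' / a 1%N in Ca0 lnI' *.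
have h1 : ln 4 + 3 * C' <= v * (ln 4 + 3 * C') by rewrite ler_peMl//; lra.
have h2 : v * (ln 4 + 3 * C' + 3 * (2 * l + ln 16)) <= v * (K * (1 + l)).
  rewrite ler_pM2l//; last by lra.
  have : 0 <= ln 4 * l by rewrite mulr_ge0.
  have : 0 <= ln 16 * l by rewrite mulr_ge0.
  have : 0 <= C' * l by rewrite mulr_ge0// ltW.
  have : 0 <= x * l by rewrite mulr_ge0// ltW.
  have : 0 <= y * l by rewrite mulr_ge0// ltW.
  rewrite /K -/x -/y; lra.
have h3 : (12 * x + 3 * y) * S <= K * S.
  rewrite ler_wpM2r// /K -/x -/y; lra.
have h4 : 3 * (ln (I ^+ 2) + sg * W + W) <= 3 * C' + (12 * x + 3 * y) * S.
  rewrite WE in sgW *; lra.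
lra.
Qed.

Lemma nth_error_init cl cr n d (eps : R) : 0 <= eps ->
  (nth_error cl n d <= eps%:E * CRI om a b cr d)%E ->
  (nth_error cl n d <= eps%:E * init d)%E.
Proof.
move=> e0; case: cr => //= h; apply: le_trans h _.
have [C _ /(_ d)[I [I1 IE _ _ _]]] := init_errorP.
by rewrite IE mule1 -EFinM lee_fin ler_peMr.
Qed.

Lemma complexity_lower cl cr n d (eps lam : R) (s : seq (freq d)) (I : R) : 0 <= eps -> 0 <= lam ->
  uniq s -> 1 <= I -> init d = I%:E ->
  (nth_error cl n d <= eps%:E * CRI om a b cr d)%E ->
  \sum_(h <- s) Num.min (weight om a b h) lam - n%:R * lam <= (eps * I) ^+ 2.
Proof.
move=> e0 lam0 us I1 IE /(nth_error_init e0); rewrite IE -EFinM => h.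
have [C C0 hC] := axis_moment hom ha1 hamono b0_gt0 hb0.
have P0 : 0 < expR (2 * C * \sum_(k < d) om `^ (1 * a k.+1)) by exact: expR_gt0.
apply: (nth_error_lower (om_gt0 hom) P0 _ _ lam0 us h).
  move=> s' us'; under eq_bigr do rewrite -(weight_pow1 a b hom).
  apply: (sum_weight_le hom b0_gt0 hb0 _ us') => m.
  by apply: (boxprod_le hom b0_gt0 hb0 d m hC); apply/andP; split; lra.
by rewrite mulr_ge0// (le_trans ler01).
Qed.

(** At accuracy 1/8 the squared error is at most [I^2 / 64 <= boxprod / 8]. Taking [lam = 1] gives
    the first bound, as all weights are at most 1; the second uses
    [min(w, lam) >= w - lam^(-th) w^(1+th)]. *)
Lemma complexity_lower_init cl cr n d : (nth_error cl n d <= (1 / 8)%:E * CRI om a b cr d)%E ->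
  exists2 m, (0 < m)%N & 7 / 8 * boxprod 1 d m <= n%:R /\
  (forall lam th : R, 0 < lam -> 0 <= th ->
     7 / 8 * boxprod 1 d m <= lam `^ (- th) * boxprod (1 + th) d m + n%:R * lam) /\
  exists2 I : R, init d = I%:E /\ 1 <= I & I ^+ 2 <= 8 * boxprod 1 d m.
Proof.
move=> h; have [C _ /(_ d)[I [I1 IE _ _ [m m0 hm]]]] := init_errorP.
have low lam : 0 <= lam ->
    \sum_(h <- box d m) Num.min (weight om a b h) lam - n%:R * lam <= boxprod 1 d m / 8.
  move=> lam0; have := complexity_lower _ lam0 (box_uniq d m) I1 IE h.
  have e0 : 0 <= 1 / 8 :> R by lra.
  move=> /(_ e0) /le_trans; apply; rewrite exprMn.
  have -> : (1 / 8) ^+ 2 = 1 / 64 :> R by lra.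
  lra.
exists m => //; split; last split; last by exists I.
  have := low 1 ler01.
  rewrite (eq_bigr (fun h : freq d => weight om a b h `^ 1)).
    by rewrite (sum_box a hom b0_gt0 hb0) mulr1; lra.
  by move=> h' _; rewrite min_l ?weight_pow1//; exact: weight_le1.
move=> lam th lam0 th0.
suff : boxprod 1 d m - lam `^ (- th) * boxprod (1 + th) d m <=
    \sum_(h <- box d m) Num.min (weight om a b h) lam.
  by have := low lam (ltW lam0); lra.
rewrite -!(sum_box a hom b0_gt0 hb0) mulr_sumr -sumrB; apply: ler_sum => h' _.
set w := weight om a b h'.
have w0 : 0 < w by exact: weight_gt0 (om_gt0 hom) _.
have w1 : w `^ 1 = w by rewrite powRr1// ltW.
have wD : w `^ (1 + th) = w * w `^ th.
  by rewrite powRD ?w1// (gt_eqF w0) implybT.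
rewrite wD w1 powRN; have l0 : 0 < lam `^ th by rewrite powR_gt0.
have x0 : 0 < w `^ th by rewrite powR_gt0.
have [wl|wl] := leP w lam.
  by rewrite gerBl mulr_ge0 ?invr_ge0 ?mulr_ge0 ?ltW.
have : lam `^ th <= w `^ th by apply: ge0_ler_powR => //; rewrite ?nnegrE; exact: ltW.
move=> hp; have hx : 1 <= (lam `^ th)^-1 * w `^ th by rewrite mulrC ler_pdivlMr// mul1r.
have : w <= (lam `^ th)^-1 * (w * w `^ th) by rewrite mulrCA ler_peMr// ltW.
lra.
Qed.

Lemma complexity_lower_exp : exists2 C : R, 0 < C & forall cl cr n d (th N : R), 0 <= th -> 1 <= N ->
  n%:R <= N -> (nth_error cl n d <= (1 / 8)%:E * CRI om a b cr d)%E ->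
  \sum_(k < d) om `^ a k.+1 * (1 - om `^ (th * a k.+1)) <= C * (1 + th * (1 + ln N)).
Proof.
have [C C0 hC] := axis_moment hom ha1 hamono b0_gt0 hb0.
have l8 : 0 <= ln 8 :> R by rewrite ln_ge0//; lra.
pose c := 2 / (1 + 2 * C); have c0 : 0 < c by rewrite divr_gt0//; lra.
exists ((1 + ln 8) / c); first by rewrite divr_gt0//; lra.
move=> cl cr n d th N th0 N1 nN h.
have [m m0 [_ [low _]]] := complexity_lower_init h.
have N0 : 0 < N by lra.
(* This [lam] makes [n lam <= 1/8], so at least [3/4 P] is left for the term with exponent [1 + th].
   As [exp(-1) <= 1/2 < 3/4], the exponent [th (ln 8 + ln N) - c S] exceeds -1. *)
have lam0 : 0 < (8 * N)^-1 by rewrite invr_gt0 mulr_gt0.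
have := low _ _ lam0 th0; have P1 := boxprod_ge1 a b hom 1 d m.
have hdrop := boxprod_drop hom ha1 hamono b0_gt0 hb0 d hC C0 th0 m0.
set S := \sum_(k < d) _ in hdrop *.
have lnN : 0 <= ln N by rewrite ln_ge0.
have -> : (8 * N)^-1 `^ (- th) = expR (th * (ln 8 + ln N)).
  rewrite /powR gt_eqF// lnV ?posrE ?mulr_gt0// lnM ?posrE//.
  by rewrite mulNr mulrN opprK.
have nlam : n%:R * (8 * N)^-1 <= 1 / 8.
  by rewrite ler_pdivrMr ?mulr_gt0//; lra.
move=> low'.
set P := boxprod 1 d m in hdrop low' P1 *.
have h2 : expR (th * (ln 8 + ln N)) * boxprod (1 + th) d m <=
    P * expR (th * (ln 8 + ln N) - c * S).
  by rewrite expRD -mulNr mulrCA ler_pM2l ?expR_gt0.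
have h3 : 3 / 4 * P <= P * expR (th * (ln 8 + ln N) - c * S) by apply: le_trans h2; lra.
have h4 : 3 / 4 <= expR (th * (ln 8 + ln N) - c * S).
  by move: h3; rewrite mulrC ler_pM2l//; lra.
have h5 : c * S <= 1 + th * (ln 8 + ln N).
  rewrite leNgt; apply/negP => h5.
  have : expR (th * (ln 8 + ln N) - c * S) <= expR (- 1) by rewrite ler_expR; lra.
  rewrite expRN => h6; have := expR_ge1Dx (1 : R).
  have e0 : 0 < expR 1 :> R by exact: expR_gt0.
  move=> h7; have : (expR 1)^-1 <= 2^-1 :> R by rewrite lef_pV2 ?posrE//; lra.
  lra.
rewrite -(ler_pM2l c0); apply: le_trans h5 _.
rewrite mulrA [c * _]mulrC divfK ?gt_eqF//.
have : 0 <= th * ln N by rewrite mulr_ge0.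
have : 0 <= ln 8 * (th * ln N) by rewrite !mulr_ge0.
have : 0 <= th * ln 8 by rewrite mulr_ge0.
lra.
Qed.

Lemma complexity_lower_sum cl cr n d :
  (nth_error cl n d <= (1 / 8)%:E * CRI om a b cr d)%E ->
  (0 < n)%N /\ \sum_(k < d) om `^ a k.+1 <= 2 * (1 + ln n%:R).
Proof.
move=> h; have [m m0 [low _]] := complexity_lower_init h.
have P1 := boxprod_ge1 a b hom 1 d m.
have n0 : 0 < n%:R :> R by lra.
have hge := boxprod_ge b hom ha1 hamono d m0.
split; first by rewrite -(ltr0n R).
have : expR (1 / 2 * \sum_(k < d) om `^ a k.+1) <= expR (1 + ln n%:R).
  apply: (le_trans hge); rewrite expRD lnK ?posrE//.
  have := expR_ge1Dx (1 : R) => e1.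
  apply: (@le_trans _ _ (8 / 7 * n%:R)); first by lra.
  by rewrite ler_pM2r//; lra.
by rewrite ler_expR; lra.
Qed.

End Complexity.

(** * Growth of sequences *)

Section Growth.
Variable R : realType.
Implicit Types (x s t A e : R) (u : nat -> R).

(** Used with [x = ln eps^-1] and [x = ln d], where [exp(s x)] becomes [eps^(-s)] and [d^s]. The
    square covers products of the two logarithms. *)
Lemma sqr_le_expR A s e : 0 < A -> 0 < s -> 0 < e ->
  exists2 K, 0 <= K & forall x, 0 <= x -> A * (x + x ^+ 2) <= K + e * expR (s * x).
Proof.
move=> A0 s0 e0.
pose c : R := Num.sqrt (e / (4 * A)); have c0 : 0 < c by rewrite sqrtr_gt0 divr_gt0// mulr_gt0.
have c2 : 4 * A * c ^+ 2 = e.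
  rewrite sqr_sqrtr; last by rewrite divr_ge0 ?mulr_ge0// ltW.
  by rewrite mulrC divfK// gt_eqF// mulr_gt0.
pose s2 : R := s / 2; have s20 : 0 < s2 by rewrite divr_gt0.
pose cs : R := c * s2; have cs0 : 0 < cs by rewrite mulr_gt0.
pose K1 : R := `|(ln (1 / cs) - 1) / s2|.
exists (A + 4 * A * K1 ^+ 2).
  by have := sqr_ge0 K1; nra.
move=> x x0; have hx : x <= K1 + c * expR (s2 * x).
  have := mul_ln_le cs0 ltr01 (expR_gt0 (s2 * x)).
  rewrite mul1r expRK mul1r => h.
  have h1 : (ln (1 / cs) - 1) / s2 <= K1 by apply: ler_norm.
  rewrite -(ler_pM2l s20); apply: (le_trans h).
  have : s2 * ((ln (1 / cs) - 1) / s2) <= s2 * K1 by rewrite ler_pM2l.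
  have -> : s2 * ((ln (1 / cs) - 1) / s2) = ln (1 / cs) - 1 by field; rewrite gt_eqF.
  rewrite /cs; set E := expR _; set z := ln _; nra.
set E := expR (s2 * x) in hx.
have EE : expR (s * x) = E ^+ 2.
  by rewrite /E -expRM_natl; congr expR; rewrite /s2; field.
have E0 : 0 < E by exact: expR_gt0.
have K10 : 0 <= K1 by exact: normr_ge0.
rewrite EE -c2.
have h2 : x ^+ 2 <= 2 * K1 ^+ 2 + 2 * (c * E) ^+ 2.
  have : x ^+ 2 <= (K1 + c * E) ^+ 2.
    by rewrite ler_sqr ?nnegrE// addr_ge0// mulr_ge0// ltW.
  have := sqr_ge0 (K1 - c * E); nra.
have h3 : x + x ^+ 2 <= 1 + 2 * x ^+ 2 by have := sqr_ge0 (x - 1); nra.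
have h4 : x + x ^+ 2 <= 1 + 4 * K1 ^+ 2 + 4 * (c * E) ^+ 2 by lra.
have := ler_wpM2l (ltW A0) h4; rewrite exprMn; nra.
Qed.

Lemma expR_lnM t (d : nat) : (0 < d)%N -> expR (t * ln d%:R) = d%:R `^ t.
Proof. by move=> d0; rewrite /powR gt_eqF// ltr0n. Qed.

Lemma expR_ln_eps t x : 0 < x -> expR (t * ln x^-1) = x `^ (- t).
Proof. by move=> x0; rewrite /powR gt_eqF// lnV ?posrE// mulrN mulNr. Qed.

Lemma linear_le_powR t A e : 1 < t -> 0 < A -> 0 < e ->
  exists2 K, 0 <= K & forall d : nat, (0 < d)%N -> A * d%:R <= K + e * d%:R `^ t.
Proof.
move=> t1 A0 e0; pose B := (A / e) `^ (t - 1)^-1.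
exists (A * B) => [|d d0]; first by rewrite mulr_ge0 ?powR_ge0// ltW.
have d0' : 0 < d%:R :> R by rewrite ltr0n.
have [dB|Bd] := leP d%:R B.
  by apply: (@le_trans _ _ (A * B)); [rewrite ler_pM2l | rewrite lerDl mulr_ge0 ?powR_ge0// ltW].
apply: (@le_trans _ _ (e * d%:R `^ t)); last by rewrite lerDr mulr_ge0 ?powR_ge0// ltW.
have -> : d%:R `^ t = d%:R * d%:R `^ (t - 1) by rewrite mulr_powRB1// ?ltW//; lra.
rewrite mulrCA mulrC ler_pM2l// mulrC -ler_pdivrMr//.
have -> : A / e = B `^ (t - 1).
  by rewrite -powRrM mulVf ?powRr1 ?divr_ge0 ?(ltW A0) ?(ltW e0)// gt_eqF//; lra.
by apply: ge0_ler_powR; rewrite ?nnegrE ?powR_ge0 ?(ltW Bd) ?(ltW d0')//; lra.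
Qed.

Lemma le_powR_of_root A t x : 0 <= A -> 0 < t -> A `^ t^-1 <= x -> A <= x `^ t.
Proof.
move=> A0 t0 h; apply: (@le_trans _ _ ((A `^ t^-1) `^ t)).
  by rewrite -powRrM mulVf ?gt_eqF// powRr1.
apply: ge0_ler_powR => //; rewrite ?nnegrE ?powR_ge0 ?(ltW t0)//.
by apply: le_trans h; exact: powR_ge0.
Qed.

Lemma powR_large t A : 0 < t -> exists D : nat, forall d : nat, (D <= d)%N -> A <= d%:R `^ t.
Proof.
move=> t0; exists (Num.trunc (Num.max A 0 `^ t^-1)).+1 => d hd.
have A0 : 0 <= Num.max A 0 by rewrite le_max lexx orbT.
apply: (@le_trans _ _ (Num.max A 0)); first by rewrite le_max lexx.
apply: le_powR_of_root => //; apply/ltW.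
by apply: lt_le_trans (truncnS_gt _) _; rewrite ler_nat.
Qed.

(** Lets additive constants be absorbed in the limit [eps^-1 + d -> oo]. *)
Lemma powR_sum_growth (K s t : R) : 0 < s -> 0 < t -> exists M : R, forall (d : nat) (x : R),
  0 < x < 1 -> M <= x^-1 + d%:R -> K <= x `^ (- s) + d%:R `^ t.
Proof.
move=> s0 t0.
pose K' : R := Num.max K 0; have K'0 : 0 <= K' by rewrite le_max lexx orbT.
exists (K' `^ s^-1 + K' `^ t^-1) => d x /andP[x0 x1] h.
apply: (@le_trans _ _ K'); first by rewrite le_max lexx.
have [h1|h1] := leP (K' `^ t^-1) d%:R.
  apply: (@le_trans _ _ (d%:R `^ t)); last by rewrite lerDr powR_ge0.
  exact: le_powR_of_root.
have h2 : K' `^ s^-1 <= x^-1 by lra.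
apply: (@le_trans _ _ (x `^ (- s))); last by rewrite lerDl powR_ge0.
have -> : x `^ (- s) = x^-1 `^ s by rewrite -powR_inv1 ?(ltW x0)// -powRrM mulN1r.
exact: le_powR_of_root.
Qed.

(** The induction step is Bernoulli's inequality [(y - 1)^t <= y^t (1 - t/y)] for an exponent at
    most 1. *)
Lemma sum_powR_le t (d : nat) : 0 < t <= 1 ->
  \sum_(1 <= k < d.+1) k%:R `^ (t - 1) <= d%:R `^ t / t :> R.
Proof.
move=> /andP[t0 t1]; elim: d => [|d IH].
  by rewrite big_geq// divr_ge0 ?powR_ge0// ltW.
rewrite big_nat_recr//=; apply: le_trans (lerD IH (lexx _)) _.
rewrite ler_pdivlMr// mulrDl divfK ?gt_eqF//.
set y := d.+1%:R : R; have y0 : 0 < y by rewrite /y ltr0n.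
have yt : 0 < y `^ t by rewrite powR_gt0.
have yE : y `^ (t - 1) = y `^ t / y.
  rewrite powRD ?powR_inv1 ?(ltW y0)//; by apply/implyP => _; rewrite gt_eqF.
rewrite yE; case: d IH @y y0 yt yE => [|d] IH y y0 yt yE.
  by rewrite powR0 ?gt_eqF// add0r /y divr1 ler_piMr// ltW.
have z0 : 0 < d.+1%:R :> R by rewrite ltr0n.
have dy : d.+1%:R = y - 1 :> R by rewrite /y -[d.+2]addn1 natrD addrK.
have hln : ln d.+1%:R <= ln y - y^-1 :> R.
  have := ln_le_sub1 (divr_gt0 z0 y0); rewrite ln_div ?posrE//.
  have -> : d.+1%:R / y = 1 - y^-1 by rewrite dy mulrBl divff ?gt_eqF// mul1r.
  by move: (ln _) (ln y) (y^-1) => p r w; lra.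
have : d.+1%:R `^ t <= y `^ t * (1 - t / y).
  have v0 : 0 < y^-1 by rewrite invr_gt0.
  have v1 : y^-1 < 1.
    by rewrite invf_lt1// /y ltr1n.
  have zE : d.+1%:R = y * (1 - y^-1) :> R by rewrite mulrBr mulr1 divff ?gt_eqF.
  have w0' : 0 <= 1 - y^-1 by rewrite subr_ge0 ltW.
  rewrite zE powRM ?(ltW y0)// ler_pM2l//.
  have w0 : 0 < 1 - y^-1 by rewrite subr_gt0.
  set w := 1 - y^-1 in w0 *.
  (* The claim is [w^t <= t w + 1 - t]. Divided by [w^t], it reads
     [1 <= t w^(1-t) + (1 - t) w^(-t)]; bounding both powers by [exp u >= 1 + u] makes the terms in
     [ln w] cancel. *)
  have -> : 1 - t / y = t * w + (1 - t) by rewrite /w; ring.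
  have := expR_ge1Dx ((1 - t) * ln w); have := expR_ge1Dx (- (t * ln w)).
  set p := ln w => e1 e2.
  have wt : w `^ t = expR (t * p) by rewrite /powR gt_eqF.
  have ewp : w = expR (t * p) * expR ((1 - t) * p).
    by rewrite -expRD -mulrDl addrC subrK mul1r lnK// posrE.
  have eone : expR (t * p) * expR (- (t * p)) = 1 by exact: expRxMexpNx_1.
  rewrite wt [w in leRHS]ewp; have E0 := expR_gt0 (t * p).
  set E := expR (t * p) in ewp eone E0 *; set F := expR ((1 - t) * p) in ewp e2 *.
  set G := expR (- (t * p)) in eone e1 *.
  have -> : t * (E * F) + (1 - t) = E * (t * F + (1 - t) * G) by rewrite -[1 - t in LHS]mulr1 -eone; ring.
  rewrite ler_peMr ?(ltW E0)//.
  have : t * (1 + (1 - t) * p) <= t * F by rewrite ler_pM2l.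
  have : (1 - t) * (1 - t * p) <= (1 - t) * G by rewrite ler_wpM2l//; lra.
  nra.
have -> : y `^ t * (1 - t / y) = y `^ t - y `^ t / y * t by ring.
by rewrite lerBrDr.
Qed.

Lemma sum_powRN_le q (d : nat) : 0 < q ->
  \sum_(1 <= k < d.+1) k%:R `^ (- (1 + q)) <= 1 + q^-1 :> R.
Proof.
move=> q0; case: d => [|d]; first by rewrite big_geq// addr_ge0// invr_ge0 ltW.
(* The subtracted power makes the bound telescope; the step is
   [y^(-q) (1 + q/y) <= (y - 1)^(-q)]. *)
suff : \sum_(1 <= k < d.+2) k%:R `^ (- (1 + q)) <= 1 + (1 - d.+1%:R `^ (- q)) / q :> R.
  move=> /le_trans; apply; rewrite lerD2l ler_piMl ?invr_ge0 ?(ltW q0)//.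
elim: d => [|d IH]; first by rewrite big_nat1 !powR1 subrr mul0r addr0.
rewrite big_nat_recr//=; apply: le_trans (lerD IH (lexx _)) _.
rewrite -addrA lerD2l -(ler_pM2r q0) mulrDl !divfK ?gt_eqF//.
set y := d.+2%:R : R; have y0 : 0 < y by rewrite /y ltr0n.
set z := d.+1%:R : R; have z0 : 0 < z by rewrite /z ltr0n.
have zy : z = y - 1 by rewrite /y -[d.+2]addn1 natrD addrK.
have hln : ln z <= ln y - y^-1 :> R.
  have := ln_le_sub1 (divr_gt0 z0 y0); rewrite ln_div ?posrE//.
  have -> : z / y = 1 - y^-1 by rewrite zy mulrBl divff ?gt_eqF// mul1r.
  by move: (ln _) (ln y) (y^-1) => p r w; lra.
have yE : y `^ (- (1 + q)) = y `^ (- q) / y.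
  rewrite opprD addrC powRD ?powR_inv1 ?(ltW y0)//; by apply/implyP => _; rewrite gt_eqF.
have yq : 0 < y `^ (- q) by rewrite powR_gt0.
suff : y `^ (- q) * (1 + q / y) <= z `^ (- q).
  have -> : y `^ (- q) * (1 + q / y) = y `^ (- q) + y `^ (- q) / y * q by ring.
  rewrite yE; move: (y `^ (- q) / y * q) => u.
  by move: (y `^ (- q)) (z `^ (- q)) => v w; lra.
have -> : z `^ (- q) = y `^ (- q) * expR (q * (ln y - ln z)).
  rewrite /powR !gt_eqF// -expRD; congr expR; ring.
rewrite ler_pM2l//; apply: le_trans (expR_ge1Dx _); rewrite lerD2l ler_pM2l//.
by move: hln; move: (ln z) (ln y) (y^-1) => p r w; lra.
Qed.

(** Accounts for the finitely many initial terms, each at most 1, in sums estimated only from index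
    [N] on. *)
Lemma sum_lt_le (N d : nat) : \sum_(1 <= k < d.+1) (k < N)%N%:R <= N%:R :> R.
Proof.
rewrite -natr_sum ler_nat -big_mkcond /= sum1_count.
rewrite -[leqRHS](size_iota 0) -size_filter; apply: uniq_leq_size.
  by rewrite filter_uniq// iota_uniq.
by move=> k; rewrite mem_filter mem_iota add0n => /andP[].
Qed.

Lemma cesaro_powR t (x : nat -> R) : 0 < t <= 1 ->
  (forall k, (0 < k)%N -> x k <= 1) ->
  (forall e, 0 < e -> exists N : nat, forall k, (N <= k)%N -> (0 < k)%N ->
    x k <= e * k%:R `^ (t - 1)) ->
  forall e, 0 < e -> exists2 K, 0 <= K & forall d : nat, \sum_(1 <= k < d.+1) x k <= K + e * d%:R `^ t.
Proof.
move=> ht hx hN e e0; have [t0 t1] := andP ht.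
have [N {}hN] := hN (e * t) (mulr_gt0 e0 t0).
exists N%:R => // d.
apply: (@le_trans _ _ (\sum_(1 <= k < d.+1) ((k < N)%N%:R + e * t * k%:R `^ (t - 1)))).
  rewrite big_nat_cond [leRHS]big_nat_cond; apply: ler_sum => k /andP[/andP[k0 _] _].
  have [kN|Nk] := ltnP k N.
    by rewrite -[leLHS]addr0 lerD ?hx// mulr_ge0 ?powR_ge0 ?mulr_ge0 ?(ltW e0) ?(ltW t0).
  by rewrite /= add0r; apply: hN.
rewrite big_split /= -mulr_sumr lerD ?sum_lt_le//.
have -> : e * d%:R `^ t = e * t * (d%:R `^ t / t) by field; rewrite gt_eqF.
by rewrite ler_wpM2l ?sum_powR_le// mulr_ge0 ?(ltW e0) ?(ltW t0).
Qed.

Lemma limn_einf_gt u (c : R) : (c%:E < limn_einf (fun j => (u j)%:E))%E <->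
  exists2 c', c < c' & exists N : nat, forall j, (N <= j)%N -> c' <= u j.
Proof.
have -> : limn_einf (fun j => (u j)%:E) = ereal_sup (range (einfs (fun j => (u j)%:E))).
  by rewrite limn_einf_lim; apply/cvg_lim => //; exact: cvg_einfs_sup.
split.
  move=> /ereal_sup_gt[_ [N _ <-]] h.
  have uN : (einfs (fun j => (u j)%:E) N <= (u N)%:E)%E.
    by apply: ereal_inf_lbound; exists N => /=.
  have fin : einfs (fun j => (u j)%:E) N \is a fin_num.
    by rewrite fin_numElt (lt_trans (ltNyr c) h) (le_lt_trans uN (ltry _)).
  exists (fine (einfs (fun j => (u j)%:E) N)).
    by rewrite -lte_fin fineK.
  exists N => j Nj; rewrite -lee_fin fineK//.
  by apply: ereal_inf_lbound; exists j.
move=> [c' cc' [N hN]]; apply: (@lt_le_trans _ _ c'%:E); first by rewrite lte_fin.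
apply: (@le_trans _ _ (einfs (fun j => (u j)%:E) N)).
  by apply: le_ereal_inf_tmp => _ [j /= Nj <-]; rewrite lee_fin; exact: hN.
by apply: ereal_sup_ubound; exists N.
Qed.

Lemma limn_einf_ge u (c : R) : (c%:E <= limn_einf (fun j => (u j)%:E))%E <->
  forall c', c' < c -> exists N : nat, forall j, (N <= j)%N -> c' <= u j.
Proof.
split=> [h c' c'c|h].
  have : (c'%:E < limn_einf (fun j => (u j)%:E))%E.
    by apply: lt_le_trans h; rewrite lte_fin.
  by move=> /limn_einf_gt[c2 c'c2 [N hN]]; exists N => j /hN; apply: le_trans; exact: ltW.
rewrite leNgt; apply/negP => hlt.
have [c' c'1 c'2] : exists2 c', c' < c & (limn_einf (fun j => (u j)%:E) < c'%:E)%E.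
  move: hlt; case: (limn_einf _) => [r| |] //=.
    by rewrite lte_fin => rc; exists ((r + c) / 2); rewrite ?lte_fin; lra.
  by move=> _; exists (c - 1); [lra | exact: ltNyr].
have [c2 c'c2 c2c] : exists2 c2, c' < c2 & c2 < c by exists ((c' + c) / 2); lra.
have [N hN] := h _ c2c.
have : (c'%:E < limn_einf (fun j => (u j)%:E))%E by apply/limn_einf_gt; exists c2 => //; exists N.
by move=> /(lt_trans c'2); rewrite ltxx.
Qed.

End Growth.

(** * Information complexity as a natural number *)

Section Nstar.
Variables (R : realType) (om : R) (a b : nat -> R).
Hypothesis hom : 0 < om < 1.
Hypothesis ha1 : 0 < a 1%N.
Hypothesis hamono : forall j : nat, (0 < j)%N -> a j <= a j.+1.
Variable b0 : R.
Hypothesis b0_gt0 : 0 < b0.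
Hypothesis hb0 : forall j : nat, (0 < j)%N -> b0 <= b j.
Variables (cl : info_class) (cr : criterion).

Definition suffices eps n d :=
  (nth_error om a b cl n d <= eps%:E * CRI om a b cr d)%E.

Lemma nstar_attained eps d N : suffices eps N d -> exists n : nat,
  [/\ (n <= N)%N, nstar om a b cl cr eps d = (n%:R)%:E & suffices eps n d].
Proof.
move=> hN.
have ex : exists n, `[< suffices eps n d >] by exists N; apply/asboolP.
case: (ex_minnP ex) => n /asboolP hn nmin.
exists n; split => //; first by apply: nmin; apply/asboolP.
apply/eqP; rewrite eq_le; apply/andP; split.
  by apply: ereal_inf_lbound; exists n.
apply: le_ereal_inf_tmp => _ [m hm <-]; rewrite lee_fin ler_nat.
by apply: nmin; apply/asboolP.
Qed.

Lemma nstar_lty eps d (x : R) : (nstar om a b cl cr eps d <= x%:E)%E ->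
  exists n : nat, nstar om a b cl cr eps d = (n%:R)%:E /\ suffices eps n d.
Proof.
move=> h; have : (nstar om a b cl cr eps d < (x + 1)%:E)%E.
  by apply: le_lt_trans h _; rewrite lte_fin ltrDl.
move=> /ereal_inf_lt[_ [N hN _] _].
by have [n [_ nE hn]] := nstar_attained hN; exists n.
Qed.

(** Includes [n = 0], where [ln 0 = 0] by convention. *)
Lemma ln_nat_ge0 (n : nat) : 0 <= ln n%:R :> R.
Proof. by case: n => [|n]; [rewrite ln0 | rewrite ln_ge0// ler1n]. Qed.

Lemma lnE_nstar (n : nat) : `|lnE (n%:R : R)%:E|%E = (ln n%:R)%:E.
Proof. by rewrite /= ger0_norm ?ln_nat_ge0. Qed.

Lemma CRI_ge1 d : (1 <= CRI om a b cr d)%E.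
Proof.
case: cr => //=; have [C _ /(_ d)[I [I1 -> _ _ _]]] := init_errorP hom ha1 hamono b0_gt0 hb0.
by rewrite lee_fin.
Qed.

Lemma suffices_abs eps n d : 0 <= eps -> (nth_error om a b cl n d <= eps%:E)%E ->
  suffices eps n d.
Proof.
move=> e0 h; apply: (le_trans h); rewrite -[leLHS]mule1.
by apply: lee_wpmul2l; [rewrite lee_fin | exact: CRI_ge1].
Qed.

Lemma nstar_upper : exists2 C : R, 0 < C & forall sg d eps,
  0 < sg <= 1 / 2 -> 0 < eps < 1 -> exists n : nat, nstar om a b cl cr eps d = (n%:R)%:E /\
   ln n%:R <= C / sg * (1 + ln eps^-1 + \sum_(1 <= k < d.+1) om `^ ((1 - sg) * a k)).
Proof.
have [C C0 hC] := complexity_upper_abs hom ha1 hamono b0_gt0 hb0.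
exists C => // sg d eps hsg heps; have [N [N0 hN lnN]] := hC cl sg d eps hsg heps.
have e0 : 0 <= eps by case/andP: heps => /ltW.
have [n [nN nE _]] := nstar_attained (suffices_abs e0 hN).
exists n; split => //; rewrite big_add1 big_mkord; apply: le_trans lnN.
case: n nN {nE} => [|n] nN; first by rewrite ln0// ln_nat_ge0.
by rewrite ler_ln ?posrE ?ltr0n// ler_nat.
Qed.

Lemma stWT_intro s t : 0 < s -> 0 < t ->
  (forall eta, 0 < eta -> exists K, forall d eps, (0 < d)%N -> 0 < eps < 1 ->
     exists n : nat, nstar om a b cl cr eps d = (n%:R)%:E /\
       ln n%:R <= K + eta * (eps `^ (- s) + d%:R `^ t)) ->
  ALG_stWT s t (nstar om a b cl cr).
Proof.
move=> s0 t0 h eta eta0; have eta2 : 0 < eta / 2 by rewrite divr_gt0.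
have [K hK] := h _ eta2; have [M hM] := powR_sum_growth (K / (eta / 2)) s0 t0.
exists M => d eps d0 heps hd; have [n [-> hn]] := hK d eps d0 heps.
rewrite lnE_nstar lee_fin; apply: (le_trans hn).
have := hM d eps heps hd; rewrite ler_pdivrMr//; lra.
Qed.

(** The accuracy stays at 1/8 while [d] grows. Eventually [(1/8)^(-s) <= d^t], so using [eta / 2]
    leaves the bound [eta d^t]. *)
Lemma stWT_elim s t : 0 < t -> ALG_stWT s t (nstar om a b cl cr) ->
  forall eta, 0 < eta -> exists D : nat, forall d, (D <= d)%N -> (0 < d)%N ->
    exists n : nat, suffices (1 / 8) n d /\ ln n%:R <= eta * d%:R `^ t.
Proof.
move=> t0 h eta eta0; have eta2 : 0 < eta / 2 by rewrite divr_gt0.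
have [M hM] := h _ eta2; have [D hD] := powR_large ((1 / 8) `^ (- s)) t0.
exists (maxn D (Num.trunc M).+1) => d; rewrite geq_max => /andP[Dd Md] d0.
have e8 : 0 < (1 / 8 : R) < 1 by apply/andP; split; lra.
have hMd : M <= (1 / 8)^-1 + d%:R.
  have : M < d%:R by apply: lt_le_trans (truncnS_gt _) _; rewrite ler_nat.
  have : 0 <= (1 / 8)^-1 :> R by rewrite invr_ge0; lra.
  lra.
have := hM d _ d0 e8 hMd.
(* [lnE] keeps [+oo], so the bound on the logarithm rules out infinite complexity. *)
have lnE_le (y : \bar R) : (`|lnE y| < +oo -> 0 <= y -> y < +oo)%E.
  case: y => [r _ _|/= lyy _|_ _]; first exact: ltry.
    by rewrite ltxx in lyy.
  by [].

move=> hl.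
have nst0 : (0 <= nstar om a b cl cr (1 / 8) d)%E.
  by apply: le_ereal_inf_tmp => _ [m _ <-]; rewrite lee_fin.
have lt : (nstar om a b cl cr (1 / 8) d < +oo)%E.
  by apply: lnE_le => //; apply: le_lt_trans hl (ltry _).
have [|n [nE sn]] := @nstar_lty (1 / 8) d (fine (nstar om a b cl cr (1 / 8) d)).
  by rewrite fineK// ge0_fin_numE.
exists n; split => //; move: hl; rewrite nE lnE_nstar lee_fin => /le_trans; apply.
have := hD _ Dd; nra.
Qed.

End Nstar.

(** * Strong polynomial and polynomial tractability *)

Section Parts.
Variables (R : realType) (om : R) (a b : nat -> R).
Hypothesis hom : 0 < om < 1.
Hypothesis ha1 : 0 < a 1%N.
Hypothesis hamono : forall j : nat, (0 < j)%N -> a j <= a j.+1.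
Variable b0 : R.
Hypothesis b0_gt0 : 0 < b0.
Hypothesis hb0 : forall j : nat, (0 < j)%N -> b0 <= b j.
Variable cl : info_class.

Local Notation Lom := (ln om^-1).
Local Notation nst := (nstar om a b cl).
Local Notation suff_n cr := (suffices om a b cl cr).
Let a0 j : (0 < j)%N -> 0 < a j. Proof. exact: a_gt0. Qed.
Let pow_ge0 x : 0 <= om `^ x. Proof. by rewrite ltW// powom_gt0. Qed.
Let L0 : 0 < Lom. Proof. exact: Lom_gt0. Qed.

Lemma ln_large (T : R) : exists D : nat, forall d, (D <= d)%N -> (1 < d)%N /\ T < ln d%:R.
Proof.
exists (Num.trunc (expR T)).+2 => d Td.
have d1 : (1 < d)%N by apply: leq_trans Td.
split => //; have : expR T < d%:R.
  by apply: lt_le_trans (truncnS_gt _) _; rewrite ler_nat ltnW.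
by rewrite -[X in _ < X]lnK ?posrE ?ltr0n ?(ltnW d1)// ltr_expR.
Qed.

Lemma nat_le_expR (n : nat) (y : R) : ln n%:R <= y -> n%:R <= expR y.
Proof.
case: n => [|n] h; first exact: expR_ge0.
by rewrite -[leLHS]lnK ?posrE ?ltr0n// ler_expR.
Qed.

Lemma ln_div_le (c : R) k : (0 < k)%N -> c <= a k / ln k%:R -> c * ln k%:R <= a k.
Proof.
move=> k0 h; have := ln_nat_ge0 R k; rewrite le_eqVlt => /orP[/eqP <-|l0].
  by rewrite mulr0 ltW// a0.
by rewrite -ler_pdivlMr.
Qed.

Lemma SPT_of_liminf cr (c : R) : 1 / Lom < c ->
  (exists N : nat, forall j, (N <= j)%N -> c <= a j / ln j%:R) ->
  ALG_SPT (nst cr).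
Proof.
move=> hc [N hN].
pose p := c * Lom; have p1 : 1 < p by move: hc; rewrite ltr_pdivrMr.
(* The bound [sg <= (p - 1) / (2 p)] gives [(1 - sg) p >= (p + 1) / 2 = 1 + q], so
   [om^((1-sg) a_k) <= k^(-(1+q))] from index [N] on, a summable majorant. *)
pose sg := Num.min (1 / 2) ((p - 1) / (2 * p)).
have p0 : 0 < 2 * p by lra.
have sg0 : 0 < sg by rewrite lt_min divr_gt0//= divr_gt0//; lra.
have sg1 : sg <= 1 / 2 by rewrite ge_min lexx.
have sgp : sg * (2 * p) <= p - 1 by rewrite -ler_pdivlMr// ge_min lexx orbT.
pose q := (p - 1) / 2; have q0 : 0 < q by rewrite /q; lra.
have hq : 1 + q <= (1 - sg) * p by rewrite /q; lra.
have [C C0 hC] := nstar_upper hom ha1 hamono b0_gt0 hb0 cl cr.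
pose B := N%:R + (1 + q^-1).
have hB (d : nat) : \sum_(1 <= k < d.+1) om `^ ((1 - sg) * a k) <= B.
  apply: (@le_trans _ _ (\sum_(1 <= k < d.+1) ((k < N)%N%:R + k%:R `^ (- (1 + q))))).
    rewrite big_nat_cond [leRHS]big_nat_cond; apply: ler_sum => k /andP[/andP[k1 _] _].
    have [kN|Nk] := ltnP k N.
      rewrite -[leLHS]addr0 lerD ?powR_ge0// powom_le1// mulr_ge0 ?(ltW (a0 _))//; lra.
    rewrite /= add0r (powomE hom) /powR gt_eqF ?ltr0n// ler_expR mulNr lerN2.
    have hk := ln_div_le k1 (hN k Nk); have lk := ln_nat_ge0 R k.
    apply: (@le_trans _ _ ((1 - sg) * p * ln k%:R)); first by rewrite ler_wpM2r.
    rewrite /p; have -> : (1 - sg) * (c * Lom) * ln k%:R = Lom * ((1 - sg) * (c * ln k%:R)) by ring.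
    by rewrite ler_pM2l// ler_pM2l//; lra.
  by rewrite big_split lerD ?sum_lt_le ?sum_powRN_le.
exists (expR (C / sg * (1 + B))), (C / sg) => d eps d0 heps.
have hsg : 0 < sg <= 1 / 2 by rewrite sg0.
have [n [-> hn]] := hC sg d eps hsg heps.
have e0 : 0 < eps by case/andP: heps.
rewrite lee_fin -expR_ln_eps// -expRD; apply: nat_le_expR; apply: (le_trans hn).
rewrite -mulrDr ler_wpM2l; [by [] | by rewrite divr_ge0// ltW |].
have := hB d; lra.
Qed.

Lemma PT_of_SPT cr : ALG_SPT (nst cr) -> ALG_PT (nst cr).
Proof.
move=> [C [p h]]; exists C, p, 0 => d eps d0 heps.
by rewrite powRr0 mulr1; exact: h.
Qed.

(** Each of the [r] factors of the falling factorial is at least [d / 2]. *)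
Lemma ffact_lower (d r : nat) : (r.*2 <= d)%N -> (d ^ r <= 2 ^ r * d ^_ r)%N.
Proof.
elim: r => [|r IH] rd; first by rewrite !expn0 ffactn0.
have /IH h : (r.*2 <= d)%N by lia.
rewrite !expnSr ffactnSr mulnACA leq_mul//; lia.
Qed.

Lemma ln_bin_lower (d r : nat) : (r.*2 <= d)%N -> (0 < d)%N ->
  (0 < 'C(d, r))%N /\ r%:R * ln d%:R - ln (2 ^ r * r`!)%:R <= ln 'C(d, r)%:R :> R.
Proof.
move=> rd d0; have b1 : (0 < 'C(d, r))%N by rewrite bin_gt0; lia.
split => //; have := ffact_lower rd; rewrite -bin_ffact mulnCA => hle.
have r1 : (0 < 2 ^ r * r`!)%N by rewrite muln_gt0 expn_gt0 fact_gt0.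
have : ln (d ^ r)%:R <= ln ('C(d, r) * (2 ^ r * r`!))%:R :> R.
  by rewrite ler_ln ?posrE ?ler_nat ?ltr0n ?expn_gt0 ?d0// muln_gt0 b1.
rewrite natrX lnXn ?ltr0n// -[X in X <= _]mulr_natl.
rewrite (natrM R 'C(d, r)) lnM ?posrE ?(ltr0n R)//.
by move: (ln (2 ^ r * r`!)%:R) (ln 'C(d, r)%:R) => x y; lra.
Qed.

Lemma subset_freqs (d r : nat) : exists2 s : seq (freq d), uniq s & size s = 'C(d, r) /\
  {in s, forall h, om `^ (r%:R * a d) <= weight om a b h}.
Proof.
pose F (A : {set 'I_d}) : freq d := [ffun k => (k \in A)%:Z].
have Finj : injective F.
  move=> A B /ffunP e; apply/finset.setP => k; have := e k; rewrite !ffunE.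
  by case: (k \in A); case: (k \in B).
exists [seq F A | A <- enum [set A : {set 'I_d} | #|A| == r]%SET].
  by rewrite map_inj_uniq ?enum_uniq.
split; first by rewrite size_map -cardE card_draws card_ord.
apply/allP; rewrite all_map; apply/allP => A; rewrite mem_enum inE => /eqP cA /=.
apply: (le_powom hom).
rewrite -cA mulr_natl -sumr_const [leRHS]big_mkcond; apply: ler_sum => k _.
rewrite /F ffunE; case: (k \in A) => /=.
  by rewrite powR1 mulr1; apply: (a_mono hamono).
by rewrite powR0 ?mulr0// gt_eqF// (b_gt0 b0_gt0 hb0).
Qed.

(** With [m = 'C(d, r)] frequencies of weight at least [lam = om^(r a_d)] and [n <= m / 2], the
    trace bound gives [m lam / 2 <= (eps I)^2]. Polynomial tractability makes [eps^2] of the order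
    [(d^q / m)^(2/p)] and [I^2] at most a constant times [d^q]. Since [ln m] is [r ln d] up to a
    constant, [Lom a_d >= (1 + 2/p) ln d] up to losses that become relatively small for large [r];
    half of the gain [2/p] survives. *)
Lemma liminf_of_PT cr : ALG_PT (nst cr) -> exists2 c, 1 / Lom < c &
  exists N : nat, forall j, (N <= j)%N -> c <= a j / ln j%:R.
Proof.
move=> [C0 [p0 [q0 hPT0]]].
pose C : R := Num.max C0 1; pose p : R := Num.max p0 1; pose q : R := Num.max q0 1.
have C1 : 1 <= C by rewrite le_max lexx orbT.
have p1 : 1 <= p by rewrite le_max lexx orbT.
have q1 : 1 <= q by rewrite le_max lexx orbT.
have hPT d eps : (0 < d)%N -> 0 < eps < 1 -> exists n : nat, suff_n cr eps n d /\
    n%:R <= C * d%:R `^ q * eps `^ (- p).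
  move=> d0 heps; have := hPT0 d eps d0 heps; move/andP: heps => [e0 e1] h.
  have [n [nE hn]] := nstar_lty h; exists n; split => //.
  move: h; rewrite nE lee_fin => /le_trans; apply.
  have d1 : 1 <= d%:R :> R by rewrite ler1n.
  apply: (@le_trans _ _ (C * d%:R `^ q0 * eps `^ (- p0))).
    by rewrite ler_wpM2r ?powR_ge0// ler_wpM2r ?powR_ge0// le_max lexx.
  apply: ler_pM; rewrite ?mulr_ge0 ?powR_ge0//; first lra.
    by rewrite ler_pM2l ?ler_powR// ?le_max ?lexx//; lra.
  by apply: ger_powR; [rewrite e0 ltW|rewrite lerN2 le_max lexx].
pose K1 : R := 2 / p.
have K10 : 0 < K1 by rewrite divr_gt0//; lra.
(* For this [r] the total polynomial loss [q (1 + K1) ln d] is at most [r ln d / (2 p)]. *)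
pose r : nat := (Num.trunc (2 * q * (1 + K1) * p)).+1.
have hr : q * (1 + K1) * (2 * p) < r%:R.
  by have := truncnS_gt (2 * q * (1 + K1) * p); rewrite -/r; lra.
have qr : q < r%:R.
  apply: le_lt_trans hr; have : 1 <= (1 + K1) * (2 * p) by nra.
  by move=> h; rewrite -mulrA ler_peMr//; lra.
have rpos : 0 < r%:R :> R by rewrite ltr0n.
pose kap : R := ln (2 ^ r * r`!)%:R.
have hbin d : (r.*2 <= d)%N -> (0 < d)%N ->
    (0 < 'C(d, r))%N /\ r%:R * ln d%:R - kap <= ln 'C(d, r)%:R.
  by move=> rd d0; exact: ln_bin_lower.
have [I0 I0_ hI] := init_errorP hom ha1 hamono b0_gt0 hb0.
pose C2 : R := ln (10 * (C * 8 `^ p)).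
(* Tractability at accuracy 1/8 also bounds the initial error:
   [I^2 <= 8 boxprod <= (64/7) n <= 10 n]. *)
have initb d (I : R) : (0 < d)%N -> init_error om a b d = I%:E -> 1 <= I ->
    ln (I ^+ 2) <= C2 + q * ln d%:R.
  move=> d0 IE I1; have e8 : 0 < (1 / 8 : R) < 1 by apply/andP; split; lra.
  have [n [sn hn]] := hPT d (1 / 8) d0 e8.
  have [m m0 [low [_ [I' [I'E I'1] hI']]]] := complexity_lower_init hom ha1 hamono b0_gt0 hb0 sn.
  have II' : I = I' by move: I'E; rewrite IE => -[].
  have I2 : 0 < I ^+ 2 by rewrite exprn_gt0//; lra.
  have e8p : (1 / 8) `^ (- p) = 8 `^ p :> R.
    by rewrite div1r -[8^-1]powR_inv1// -powRrM mulN1r opprK.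
  have hle : I ^+ 2 <= 10 * (C * 8 `^ p) * d%:R `^ q.
    rewrite -e8p.
    have n0 : 0 <= n%:R :> R by [].
    have -> : 10 * (C * (1 / 8) `^ (- p)) * d%:R `^ q = 10 * (C * d%:R `^ q * (1 / 8) `^ (- p)) by ring.
    rewrite II'; lra.
  have c0 : 0 < 10 * (C * 8 `^ p) by rewrite mulr_gt0// mulr_gt0 ?powR_gt0//; lra.
  have dq : 0 < d%:R `^ q :> R by rewrite powR_gt0// ltr0n.
  have : ln (I ^+ 2) <= ln (10 * (C * 8 `^ p) * d%:R `^ q) by rewrite ler_ln ?posrE// mulr_gt0.
  by rewrite lnM ?posrE// ln_powR.
have key d : (r.*2 <= d)%N -> (0 < d)%N ->
    ln (2 * C) + q * ln d%:R < ln 'C(d, r)%:R ->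
    ln 'C(d, r)%:R - r%:R * (Lom * a d) <=
    ln 2 + K1 * (ln (2 * C) + q * ln d%:R - ln 'C(d, r)%:R) + (C2 + q * ln d%:R).
  move=> rd d0 hlt; have [m0 _] := hbin d rd d0; set m := 'C(d, r) in m0 hlt *.
  have mp : 0 < m%:R :> R by rewrite ltr0n.
  (* The solution of [C d^q eps^(-p) = m / 2]. *)
  pose eps : R := expR ((ln (2 * C) + q * ln d%:R - ln m%:R) / p).
  have pp : 0 < p by lra.
  have heps : 0 < eps < 1.
    by rewrite expR_gt0 expR_lt1 pmulr_llt0 ?invr_gt0//; lra.
  have [n [sn hn]] := hPT d eps d0 heps.
  have [I [I1 IE _ _ _]] := hI d.
  have [s us [sz hs]] := subset_freqs d r.
  have e0 : 0 <= eps by apply: expR_ge0.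
  have lowB := complexity_lower hom ha1 hamono b0_gt0 hb0 e0 (pow_ge0 (r%:R * a d)) us I1 IE sn.
  set lam := om `^ (r%:R * a d) in hs lowB.
  have nm : (n%:R : R) <= m%:R / 2.
    apply: (le_trans hn).
    have -> : eps `^ (- p) = m%:R / (2 * C * d%:R `^ q).
      rewrite /eps -expRM mulrN divfK ?gt_eqF// opprB opprD.
      rewrite addrA expRD expRD expRN expRN lnK ?posrE// lnK ?posrE; last by lra.
      by rewrite expR_lnM// (invfM (2 * C)) mulrA.
    have dq : 0 < d%:R `^ q :> R by rewrite powR_gt0// ltr0n.
    rewrite le_eqVlt; apply/orP; left; apply/eqP; field.
    by rewrite !gt_eqF//; lra.
  have hsum : m%:R * lam <= \sum_(h <- s) Num.min (weight om a b h) lam.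
    rewrite /m -sz mulr_natl.
    have -> : lam *+ size s = \sum_(h <- s) lam by rewrite big_const_seq count_predT iter_addr_0.
    rewrite big_seq [leRHS]big_seq; apply: ler_sum => h hh.
    by rewrite le_min lexx andbT; exact: hs.
  have lam0 : 0 < lam by exact: powom_gt0.
  have h1 : m%:R * lam <= 2 * (eps ^+ 2 * I ^+ 2).
    have : n%:R * lam <= m%:R / 2 * lam by rewrite ler_pM2r.
    by rewrite exprMn in lowB; lra.
  have I2 : 0 < I ^+ 2 by rewrite exprn_gt0//; lra.
  have ep : 0 < eps ^+ 2 by rewrite exprn_gt0// expR_gt0.
  have ml0 : 0 < m%:R * lam by exact: mulr_gt0.
  have eI0 : 0 < eps ^+ 2 * I ^+ 2 by exact: mulr_gt0.
  have eI2 : 0 < 2 * (eps ^+ 2 * I ^+ 2) by exact: mulr_gt0.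
  have h2 : ln (m%:R * lam) <= ln (2 * (eps ^+ 2 * I ^+ 2)) by rewrite ler_ln.
  rewrite (lnM mp lam0) (lnM (ltr0Sn R 1) eI0) (lnM ep I2) (lnXn 2 (expR_gt0 _)) in h2.
  rewrite expRK /lam (powomE hom) expRK in h2.
  have h3 := initb d I d0 IE I1.
  have e1 : (ln (2 * C) + q * ln d%:R - ln m%:R) / p *+ 2 =
      K1 * (ln (2 * C) + q * ln d%:R - ln m%:R).
    by rewrite -mulr_natl /K1; field; rewrite gt_eqF.
  have e2 : Lom * (r%:R * a d) = r%:R * (Lom * a d) by ring.
  rewrite e1 e2 in h2; lra.
pose c : R := (1 + p^-1) / Lom.
exists c; first by rewrite /c ltr_pM2r ?invr_gt0// ltrDl invr_gt0; lra.
pose K2 : R := ln 2 + K1 * ln (2 * C) + C2 + (1 + K1) * kap.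
have pinv : 0 < p^-1 by rewrite invr_gt0; lra.
have K1E : K1 = 2 * p^-1 by [].
(* Beyond [T] the chosen accuracy is below 1 and the constant losses [K2] are at most
   [r ln d / (2 p)]. *)
pose T : R := Num.max (`|K2| * p / r%:R * 2) (Num.max ((ln (2 * C) + kap) / (r%:R - q)) 0).
have [D hD] := ln_large T.
exists (maxn (r.*2) D) => d; rewrite geq_max => /andP[rd /hD[d1 lT]].
have d0 : (0 < d)%N by exact: ltnW.
set l := ln d%:R.
rewrite -/l in lT.
have l0 : 0 < l by rewrite ln_gt0// ltr1n.
have [m0 hm] := hbin d rd d0; rewrite -/l in hm.
have T1 : (ln (2 * C) + kap) / (r%:R - q) < l.
  by apply: le_lt_trans lT; rewrite /T !le_max lexx orbT.
have T2 : `|K2| * p / r%:R * 2 < l.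
  by apply: le_lt_trans lT; rewrite /T !le_max lexx.
have hlt : ln (2 * C) + q * l < ln 'C(d, r)%:R.
  by move: T1; rewrite ltr_pdivrMr ?subr_gt0//; lra.
have := key d rd d0 hlt; rewrite -/l => hk.
rewrite ler_pdivlMr// /c mulrAC ler_pdivrMr//.
rewrite -(ler_pM2l rpos).
have hK2 : K2 <= r%:R * l / (2 * p).
  apply: (le_trans (ler_norm _)); rewrite ler_pdivlMr ?mulr_gt0//; last lra.
  by move: T2; rewrite mulrAC ltr_pdivrMr//; lra.
have hq2 : q * (1 + K1) * l <= r%:R * l / (2 * p).
  by rewrite ler_pdivlMr ?mulr_gt0//; [nra|lra].
have h5 : (1 + K1) * (r%:R * l - kap) <= (1 + K1) * ln 'C(d, r)%:R by rewrite ler_pM2l//; lra.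
have e3 : r%:R * l / (2 * p) = r%:R * l * p^-1 / 2 by field; rewrite gt_eqF//; lra.
rewrite e3 in hK2 hq2; rewrite K1E in h5 hk hq2; rewrite /K2 K1E in hK2.
have -> : r%:R * (a d * Lom) = r%:R * (Lom * a d) by ring.
move: h5 hk hq2 hK2; set v := p^-1; set y := r%:R * (Lom * a d); set z := ln 'C(d, r)%:R.
lra.
Qed.

End Parts.

(** * Quasi-polynomial and weak tractability *)

Section Sequences.
Variable R : realType.

Lemma cvgn0P (u : nat -> R) : u @ \oo --> (0 : R) <->
  forall e, 0 < e -> exists N : nat, forall j, (N <= j)%N -> `|u j| < e.
Proof.
split=> [h e e0|h].
  move: h => /cvgr0Pnorm_lt /(_ e e0)[N _ hN].
  by exists N.
by apply/cvgr0Pnorm_lt => e /h[N hN]; exists N.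
Qed.

Lemma ln_plus_ge1 (x : R) : 1 <= ln_plus x.
Proof. by rewrite le_max lexx. Qed.

Lemma ln_le_ln_plus (x : R) : ln x <= ln_plus x.
Proof. by rewrite le_max lexx orbT. Qed.

Lemma ln_plus_le (d : nat) : ln_plus d%:R <= 1 + ln d%:R :> R.
Proof. by have l0 := ln_nat_ge0 R d; rewrite ge_max; apply/andP; split; lra. Qed.

End Sequences.

Section Parts.
Variables (R : realType) (om : R) (a b : nat -> R).
Hypothesis hom : 0 < om < 1.
Hypothesis ha1 : 0 < a 1%N.
Hypothesis hamono : forall j : nat, (0 < j)%N -> a j <= a j.+1.
Variable b0 : R.
Hypothesis b0_gt0 : 0 < b0.
Hypothesis hb0 : forall j : nat, (0 < j)%N -> b0 <= b j.
Variable cl : info_class.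

Local Notation Lom := (ln om^-1).
Local Notation nst := (nstar om a b cl).
Local Notation suff_n cr := (suffices om a b cl cr).
Let a0 j : (0 < j)%N -> 0 < a j. Proof. exact: a_gt0. Qed.
Let pow_ge0 x : 0 <= om `^ x. Proof. by rewrite ltW// powom_gt0. Qed.
Let L0 : 0 < Lom. Proof. exact: Lom_gt0. Qed.

(** * Changing the exponent on the scale 1 / ln d *)

Section Split.
Variables (l x : R) (d : nat).
Hypotheses (x0 : 0 <= x) (l1 : 1 <= l) (d0 : (0 < d)%N) (ld : ln d%:R <= l).
Let sg : R := 1 / (2 * l).

Let l0 : 0 < l. Proof. exact: lt_le_trans ltr01 l1. Qed.
Let sg0 : 0 < sg. Proof. by rewrite divr_gt0// mulr_gt0//. Qed.
Let sg_half : sg <= 1 / 2.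
Proof.
rewrite /sg ler_pdivrMr ?mulr_gt0//; have := l1; lra.
Qed.
Let invd : expR (- l) <= d%:R^-1.
Proof.
by rewrite expRN lef_pV2 ?posrE ?expR_gt0 ?ltr0n// -[leLHS]lnK ?posrE ?ltr0n// ler_expR.
Qed.

Let small : x * Lom <= 8 * l -> om `^ ((1 - sg) * x) <= expR 4 * om `^ x.
Proof.
move=> h; rewrite !(powomE hom) -expRD ler_expR.
suff : Lom * (sg * x) <= 4 by lra.
have -> : Lom * (sg * x) = x * Lom / (2 * l) by rewrite /sg; field; rewrite gt_eqF.
by rewrite ler_pdivrMr ?mulr_gt0//; lra.
Qed.

Let large : 8 * l < x * Lom -> om `^ ((1 - sg) * x) <= expR (- (Lom * x / 4)) * expR (- (Lom * x / 4)).
Proof.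
move=> h; rewrite (powomE hom) -expRD ler_expR.
have : sg * (Lom * x) <= 1 / 2 * (Lom * x) by rewrite ler_wpM2r// mulr_ge0// ltW.
lra.
Qed.

Let expQ : 8 * l < x * Lom -> expR (- (Lom * x / 4)) <= d%:R^-1.
Proof. by move=> h; apply: le_trans invd; rewrite ler_expR; have := l0; lra. Qed.

Let xexp : x * expR (- (Lom * x / 4)) <= 4 / Lom.
Proof.
rewrite expRN ler_pdivrMr ?expR_gt0//.
have h := expR_ge1Dx (Lom * x / 4).
have {1}-> : x = 4 / Lom * (Lom * x / 4) by field; rewrite gt_eqF.
by rewrite ler_pM2l ?divr_gt0//; lra.
Qed.

(** If [Lom x <= 8 l], the shift by [sg = 1/(2 l)] costs at most [exp 4]. Otherwise
    [om^((1-sg) x) <= exp(-Lom x / 2) <= 1/d]. *)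
Lemma powom_split : om `^ ((1 - sg) * x) <= expR 4 * om `^ x + d%:R^-1.
Proof.
have [h|h] := leP (x * Lom) (8 * l).
  by apply: (le_trans (small h)); rewrite lerDl invr_ge0.
apply: (le_trans (large h)); rewrite -[leLHS]add0r lerD ?mulr_ge0 ?expR_ge0//.
apply: le_trans (expQ h); rewrite ler_piMl ?expR_ge0// expR_le1 oppr_le0.
by rewrite divr_ge0// mulr_ge0// ltW.
Qed.

(** Above the threshold [exp(-Lom x / 2)] is split into two equal factors: one absorbs [x], the
    other is at most [1/d]. *)
Lemma mul_powom_split :
  x * om `^ ((1 - sg) * x) <= expR 4 * (x * om `^ x) + 4 / Lom / d%:R.
Proof.
have c0 : 0 <= 4 / Lom / d%:R by rewrite !divr_ge0 ?(ltW L0).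
have [h|h] := leP (x * Lom) (8 * l).
  rewrite mulrCA -[leLHS]addr0 lerD// ler_wpM2l//; exact: small.
rewrite -[leLHS]add0r lerD ?mulr_ge0 ?expR_ge0//.
apply: (@le_trans _ _ (x * expR (- (Lom * x / 4)) * expR (- (Lom * x / 4)))).
  by rewrite -mulrA ler_wpM2l//; exact: large.
by apply: ler_pM; rewrite ?mulr_ge0 ?expR_ge0//; exact: expQ.
Qed.

(** Below the threshold [y = Lom x / l] is at most 8, so [1 - exp(-y) >= y / (1 + y) >= y / 9]. This
    converts the drop in the lower bound into the factor [x]. *)
Lemma mul_powom_le_drop :
  x * om `^ x <= 9 * l / Lom * (om `^ x * (1 - om `^ (l^-1 * x))) + 4 / Lom / d%:R.
Proof.
have c0 : 0 <= 4 / Lom / d%:R by rewrite !divr_ge0 ?(ltW L0).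
have drop0 : 0 <= 1 - om `^ (l^-1 * x).
  by rewrite subr_ge0 powom_le1// mulr_ge0// invr_ge0 ltW.
have [h|h] := leP (x * Lom) (8 * l).
  rewrite -[leLHS]addr0 lerD// [leRHS]mulrCA [leLHS]mulrC ler_wpM2l//.
  rewrite (powomE hom); pose y := x * Lom / l.
  have y0 : 0 <= y by rewrite divr_ge0 ?mulr_ge0 ?(ltW L0)// ltW.
  have y8 : y <= 8 by rewrite ler_pdivrMr.
  have -> : Lom * (l^-1 * x) = y by rewrite /y; ring.
  have -> : 9 * l / Lom * (1 - expR (- y)) = l / Lom * (9 * (1 - expR (- y))) by ring.
  have {1}-> : x = l / Lom * y by rewrite /y; field; rewrite !gt_eqF.
  rewrite ler_wpM2l ?divr_ge0 ?(ltW L0) ?(ltW l0)//.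
  have h1 := expR_ge1Dx y; have h2 := expRxMexpNx_1 y; have h3 := expR_gt0 (- y).
  have h4 : expR (- y) * (1 + y) <= expR (- y) * expR y by rewrite ler_pM2l.
  rewrite [X in _ <= X]mulrC h2 in h4.
  set E := expR (- y) in h2 h3 h4 *; nra.
rewrite -[leLHS]add0r lerD ?mulr_ge0 ?invr_ge0 ?(ltW L0) ?(ltW l0)//.
have hl : om `^ x <= om `^ ((1 - sg) * x).
  by apply: (le_powom hom); rewrite ler_piMl// gerBl ltW.
apply: (@le_trans _ _ (x * expR (- (Lom * x / 4)) * expR (- (Lom * x / 4)))).
  by rewrite -mulrA ler_wpM2l//; apply: (le_trans hl); exact: large.
by apply: ler_pM; rewrite ?mulr_ge0 ?expR_ge0//; exact: expQ.
Qed.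

End Split.

Lemma sum_invn (d : nat) (c : R) : (0 < d)%N -> \sum_(1 <= k < d.+1) c / d%:R = c.
Proof.
move=> d0; rewrite sumr_const_nat subSS subn0 -[LHS]mulr_natr divfK//.
by rewrite pnatr_eq0 -lt0n.
Qed.

Lemma ln_size_le (n N : nat) : (n <= N)%N -> ln n%:R <= ln N%:R :> R.
Proof.
case: n => [|n] nN; first by rewrite ln0// ln_nat_ge0.
by rewrite ler_ln ?posrE ?ltr0n// ?ler_nat// (leq_trans _ nN).
Qed.

Lemma nstar_upper_nor : exists2 C : R, 0 < C & forall sg d eps,
  0 < sg <= 1 / 2 -> 0 < eps < 1 -> exists n : nat, nst NOR eps d = (n%:R)%:E /\
  ln n%:R <= C / sg * (1 + ln eps^-1) +
    C * \sum_(1 <= k < d.+1) a k * om `^ ((1 - sg) * a k).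
Proof.
have [C C0 hC] := complexity_upper_nor hom ha1 hamono b0_gt0 hb0.
exists C => // sg d eps hsg heps; have [N [N0 hN lnN]] := hC cl sg d eps hsg heps.
have [n [nN nE _]] := @nstar_attained _ _ _ _ cl NOR eps d N hN.
exists n; split => //; rewrite big_add1 big_mkord; apply: le_trans lnN.
exact: ln_size_le.
Qed.

Lemma QPT_upper (M : R) :
  (forall d : nat, (0 < d)%N ->
     (ln_plus d%:R)^-1 * \sum_(1 <= j < d.+1) a j * om `^ (a j) <= M) ->
  ALG_QPT (nst NOR).
Proof.
move=> hM; have [C C0 hC] := nstar_upper_nor.
pose K : R := expR 4 * `|M| + 4 / Lom.
(* With [sg = 1/(2 l)] the accuracy term is [2 C l (1 + ln eps^-1)] and the sum is at most [K l],
   where [l <= 1 + ln d]. *)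
exists 1, (2 * C + C * K) => d eps d0 heps.
set l := ln_plus d%:R : R; have l1 : 1 <= l by exact: ln_plus_ge1.
have ld : ln d%:R <= l by exact: ln_le_ln_plus.
have hsg : 0 < 1 / (2 * l) <= 1 / 2.
  by rewrite divr_gt0 ?mulr_gt0//=; [rewrite ler_pdivrMr ?mulr_gt0//; lra | lra].
have [n [-> hn]] := hC _ d eps hsg heps; have [e0 e1] := andP heps.
rewrite mul1r lee_fin; apply: nat_le_expR; apply: (le_trans hn).
set S := \sum_(1 <= k < d.+1) a k * om `^ a k.
have hS : S <= `|M| * l.
  have := hM d d0; rewrite -/l -/S => h.
  rewrite -ler_pdivrMr ?(lt_le_trans ltr01)// mulrC; apply: (le_trans h); exact: ler_norm.
have hsum : \sum_(1 <= k < d.+1) a k * om `^ ((1 - 1 / (2 * l)) * a k) <= K * l.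
  apply: (@le_trans _ _ (\sum_(1 <= k < d.+1) (expR 4 * (a k * om `^ a k) + 4 / Lom / d%:R))).
    rewrite big_nat_cond [leRHS]big_nat_cond; apply: ler_sum => k /andP[/andP[k0 _] _].
    by apply: mul_powom_split => //; exact: ltW (a0 k0).
  rewrite big_split/= sum_invn// -mulr_sumr -/S /K [leRHS]mulrDl lerD//.
    by rewrite -mulrA ler_pM2l ?expR_gt0.
  by rewrite ler_peMr// divr_ge0// ltW.
have l2 : C / (1 / (2 * l)) = 2 * C * l by field; rewrite gt_eqF//; lra.
rewrite l2; have le0 : 0 <= ln eps^-1 by rewrite ln_ge0// invf_ge1// ltW.
have lp : l <= 1 + ln d%:R by exact: ln_plus_le.
set e := ln eps^-1 in le0 *.
have K0 : 0 <= K by rewrite addr_ge0 ?mulr_ge0 ?expR_ge0 ?invr_ge0 ?(ltW L0).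
apply: (@le_trans _ _ ((2 * C + C * K) * l * (1 + e))).
  have : C * \sum_(1 <= k < d.+1) a k * om `^ ((1 - 1 / (2 * l)) * a k) <= C * (K * l) by rewrite ler_pM2l.
  have : 0 <= C * (K * l) * e by rewrite !mulr_ge0 ?(ltW C0)//; lra.
  lra.
rewrite ler_wpM2r; [by []|lra|].
by rewrite ler_wpM2l// addr_ge0 ?mulr_ge0 ?(ltW C0).
Qed.

(** Taken at [th = 1 / ln_+ d]: the factor [ln_+ d] lost in recovering [a_k] from the drop
    multiplies [1 + th (1 + ln N)]. *)
Lemma moment_lower : exists2 C : R, 0 < C & forall cr n d (N : R), (0 < d)%N -> 1 <= N ->
  n%:R <= N -> suff_n cr (1 / 8) n d ->
  \sum_(1 <= k < d.+1) a k * om `^ a k <= C * (ln_plus d%:R + ln N).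
Proof.
have [C C0 hC] := complexity_lower_exp hom ha1 hamono b0_gt0 hb0.
pose C1 : R := 9 / Lom * C; have C10 : 0 < C1 by rewrite mulr_gt0// divr_gt0.
have C2 : 0 < 4 / Lom by rewrite divr_gt0.
exists (2 * C1 + 4 / Lom); first by lra.
move=> cr n d N d0 N1 nN hs.
set l := ln_plus d%:R : R; have l1 : 1 <= l by exact: ln_plus_ge1.
have ld : ln d%:R <= l by exact: ln_le_ln_plus.
have l0 : 0 < l by lra.
have th0 : 0 <= l^-1 by rewrite invr_ge0 ltW.
have low := hC cl cr n d l^-1 N th0 N1 nN hs.
have lN : 0 <= ln N by rewrite ln_ge0.
apply: (@le_trans _ _ (\sum_(1 <= k < d.+1)
   (9 * l / Lom * (om `^ a k * (1 - om `^ (l^-1 * a k))) + 4 / Lom / d%:R))).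
  rewrite big_nat_cond [leRHS]big_nat_cond; apply: ler_sum => k /andP[/andP[k0 _] _].
  by apply: mul_powom_le_drop => //; exact: ltW (a0 k0).
rewrite big_split/= sum_invn// -mulr_sumr big_add1 big_mkord.
set S := \sum_(k < d) _ in low *.
have : 9 * l / Lom * S <= 9 * l / Lom * (C * (1 + l^-1 * (1 + ln N))).
  by rewrite ler_wpM2l// divr_ge0 ?mulr_ge0 ?(ltW l0) ?(ltW L0).
have -> : 9 * l / Lom * (C * (1 + l^-1 * (1 + ln N))) = C1 * (l + 1 + ln N).
  by rewrite /C1; field; rewrite !gt_eqF.
have : 0 <= C1 * ln N by rewrite mulr_ge0// ltW.
have : 0 <= 4 / Lom * ln N by rewrite mulr_ge0// ltW.
have : C1 * 1 <= C1 * l by rewrite ler_pM2l.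
have : 4 / Lom * 1 <= 4 / Lom * l by rewrite ler_pM2l.
move: (4 / Lom) (9 * l / Lom * S) => u v /=; lra.
Qed.

Lemma QPT_lower cr : ALG_QPT (nst cr) -> exists M : R, forall d : nat, (0 < d)%N ->
  (ln_plus d%:R)^-1 * \sum_(1 <= j < d.+1) a j * om `^ (a j) <= M.
Proof.
move=> [C [t hQ]]; have [C' C'0 hC'] := moment_lower.
have l8 : 0 <= ln (1 / 8)^-1 :> R by rewrite ln_ge0//; lra.
pose C2 : R := Num.max C 1; have C21 : 1 <= C2 by rewrite le_max lexx orbT.
have lC2 : 0 <= ln C2 by rewrite ln_ge0.
pose K : R := ln C2 + 2 * `|t| * (1 + ln (1 / 8)^-1).
exists (C' * (1 + K)) => d d0.
have e8 : 0 < (1 / 8 : R) < 1 by apply/andP; split; lra.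
have hq := hQ d _ d0 e8; have [n [nE hn]] := nstar_lty hq.
set l := ln_plus d%:R : R; have l1 : 1 <= l by exact: ln_plus_ge1.
have ld : ln d%:R <= l by exact: ln_le_ln_plus.
have d1 := ln_nat_ge0 R d.
set X := t * (1 + ln d%:R) * (1 + ln (1 / 8)^-1) in hq.
have XK : X <= 2 * `|t| * (1 + ln (1 / 8)^-1) * l.
  have -> : 2 * `|t| * (1 + ln (1 / 8)^-1) * l = `|t| * (2 * l) * (1 + ln (1 / 8)^-1) by ring.
  rewrite /X; apply: ler_wpM2r; first lra.
  apply: (@le_trans _ _ (`|t| * (1 + ln d%:R))); first by apply: ler_wpM2r; [lra | exact: ler_norm].
  by apply: ler_wpM2l => //; lra.
have tl0 : 0 <= 2 * `|t| * (1 + ln (1 / 8)^-1) * l.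
  by apply: mulr_ge0; [apply: mulr_ge0; [apply: mulr_ge0|lra]|lra].
pose N := C2 * expR (2 * `|t| * (1 + ln (1 / 8)^-1) * l).
have N1 : 1 <= N.
  by apply: mulr_ege1 => //; apply: le_trans (expR_ge1Dx _); rewrite lerDl.
have nN : n%:R <= N.
  move: hq; rewrite nE lee_fin => /le_trans; apply.
  apply: (@le_trans _ _ (C2 * expR X)); first by rewrite ler_wpM2r ?expR_ge0// le_max lexx.
  by rewrite ler_wpM2l ?ler_expR//; lra.
have := hC' cr n d N d0 N1 nN hn; rewrite -/l => h.
rewrite mulrC ler_pdivrMr; last lra.
apply: (le_trans h); rewrite -mulrA ler_pM2l//.
have -> : ln N = ln C2 + 2 * `|t| * (1 + ln (1 / 8)^-1) * l.
  by rewrite /N lnM ?posrE ?expR_gt0 ?expRK//; lra.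
have : ln C2 * 1 <= ln C2 * l by apply: ler_wpM2l.
rewrite /K; move: (2 * `|t| * (1 + ln (1 / 8)^-1)) (ln C2) => u v; lra.
Qed.

(** A constant [sg] suffices here, since [C / sg] is then absorbed into the choice of [e]. *)
Lemma stWT_of_sum cr (s t sg : R) : 0 < s -> 0 < t -> 0 < sg <= 1 / 2 ->
  (forall e, 0 < e -> exists2 K, 0 <= K & forall d : nat, (0 < d)%N ->
     \sum_(1 <= k < d.+1) om `^ ((1 - sg) * a k) <= K + e * d%:R `^ t) ->
  ALG_stWT s t (nst cr).
Proof.
move=> s0 t0 hsg hsum; have [C C0 hC] := nstar_upper hom ha1 hamono b0_gt0 hb0 cl cr.
have [sg0 sg1] := andP hsg; pose c := C / sg; have c0 : 0 < c by rewrite divr_gt0.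
apply: (stWT_intro s0 t0) => e e0.
have [K1 K10 hK1] := sqr_le_expR c0 s0 e0.
have [K2 K20 hK2] := hsum (e / c) (divr_gt0 e0 c0).
exists (c + K1 + c * K2) => d eps d0 heps.
have [n [nE hn]] := hC sg d eps hsg heps; exists n; split => //.
have [e0' e1] := andP heps.
apply: (le_trans hn); rewrite -/c.
have le0 : 0 <= ln eps^-1 by rewrite ln_ge0// invf_ge1// ltW.
have h1 := hK1 _ le0; rewrite expR_ln_eps// in h1.
have h2 : c * \sum_(1 <= k < d.+1) om `^ ((1 - sg) * a k) <= c * (K2 + e / c * d%:R `^ t).
  by rewrite ler_pM2l// hK2.
have e2 : c * (K2 + e / c * d%:R `^ t) = c * K2 + e * d%:R `^ t.
  by field; rewrite gt_eqF.
rewrite e2 in h2; have := sqr_ge0 (ln eps^-1) => h3.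
have : 0 <= c * ln eps^-1 ^+ 2 by rewrite mulr_ge0// ltW.
lra.
Qed.

Lemma stWT_large_t cr (s t : R) : 0 < s -> 1 < t -> ALG_stWT s t (nst cr).
Proof.
move=> s0 t1; have t0 : 0 < t by lra.
have hsg : 0 < (1 / 2 : R) <= 1 / 2 by apply/andP; split; lra.
apply: (stWT_of_sum cr s0 t0 hsg) => e e0.
have [K K0 hK] := linear_le_powR t1 ltr01 e0.
exists K => // d d0; apply: le_trans (hK d d0).
apply: (@le_trans _ _ (\sum_(1 <= k < d.+1) 1)).
  rewrite big_nat_cond [leRHS]big_nat_cond; apply: ler_sum => k /andP[/andP[k0 _] _].
  by rewrite powom_le1// mulr_ge0 ?(ltW (a0 k0))//; lra.
by rewrite sumr_const_nat subSS subn0 mul1r.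
Qed.

Lemma stWT_of_eventually cr (s t sg : R) : 0 < s -> 0 < t -> 0 < sg <= 1 / 2 ->
  (forall e, 0 < e -> exists N : nat, forall k, (N <= k)%N -> (0 < k)%N ->
    om `^ ((1 - sg) * a k) <= e * k%:R `^ (Num.min t 1 - 1)) ->
  ALG_stWT s t (nst cr).
Proof.
move=> s0 t0 hsg h; have [sg0 sg1] := andP hsg; apply: (stWT_of_sum cr s0 t0 hsg) => e e0.
(* The averaging lemma needs an exponent at most 1; replacing [t] by [min(t, 1)] only lowers
   [d^t]. *)
have ht : 0 < Num.min t 1 <= 1 by rewrite lt_min t0 ltr01 ge_min lexx orbT.
have hx k : (0 < k)%N -> om `^ ((1 - sg) * a k) <= 1.
  by move=> k0; rewrite powom_le1// mulr_ge0 ?(ltW (a0 k0))//; lra.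
have [K K0 hK] := cesaro_powR ht hx h e0.
exists K => // d d0; apply: (le_trans (hK d)); rewrite lerD2l ler_pM2l//.
by rewrite ler_powR ?ler1n// ge_min lexx.
Qed.

Lemma stWT_of_divergence cr (s t : R) : 0 < s -> 1 <= t ->
  (forall M : R, exists N : nat, forall j : nat, (N <= j)%N -> M <= a j) ->
  ALG_stWT s t (nst cr).
Proof.
move=> s0 t1 h; have t0 : 0 < t by lra.
have hsg : 0 < (1 / 2 : R) <= 1 / 2 by apply/andP; split; lra.
apply: (stWT_of_eventually cr s0 t0 hsg) => e e0.
have [N hN] := h (2 * (- ln e) / Lom); exists N => k Nk k0.
rewrite (min_idPr t1) subrr powRr0 mulr1 (powomE hom) -[leRHS]lnK ?posrE// ler_expR.
have := hN k Nk; rewrite ler_pdivrMr//; lra.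
Qed.

Lemma UWT_of_liminf cr :
  (forall c', c' < 1 / Lom -> exists N : nat, forall j, (N <= j)%N -> c' <= a j / ln j%:R) ->
  ALG_UWT (nst cr).
Proof.
move=> h al be al0 be0; pose t := Num.min be 1.
have t0 : 0 < t by rewrite lt_min be0 ltr01.
have t1 : t <= 1 by rewrite ge_min lexx orbT.
(* Both the shift of the exponent and the slack in the liminf are [t / 4]. As
   [(1 - t/4)^2 >= 1 - t/2], the terms are at most [k^(t-1) k^(-t/2)], and [k^(-t/2)] is eventually
   below [e]. *)
have hsg : 0 < t / 4 <= 1 / 2 by apply/andP; split; lra.
apply: (stWT_of_eventually cr al0 be0 hsg) => e e0; rewrite -/t.
have hc : (1 - t / 4) / Lom < 1 / Lom by rewrite ltr_pM2r ?invr_gt0//; lra.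
have [N hN] := h _ hc; have [D hD] := ln_large (2 / t * - ln e).
exists (maxn N D) => k; rewrite geq_max => /andP[Nk /hD[k1 lk]] k0.
have ha := ln_div_le ha1 hamono k0 (hN k Nk).
rewrite -expR_lnM// (powomE hom) -[X in _ <= X * _]lnK ?posrE// -expRD ler_expR.
set l := ln k%:R in ha lk *.
have l0 : 0 < l by rewrite ln_gt0// ltr1n.
have h1 : (1 - t / 4) * l <= Lom * a k.
  have -> : (1 - t / 4) * l = Lom * ((1 - t / 4) / Lom * l) by field; rewrite gt_eqF.
  by rewrite ler_pM2l.
have h2 : (1 - t / 4) * ((1 - t / 4) * l) <= (1 - t / 4) * (Lom * a k).
  by apply: ler_wpM2l => //; lra.
have h3 : - ln e < t / 2 * l.
  move: lk; rewrite -(ltr_pM2l (_ : 0 < t / 2)); last by rewrite divr_gt0.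
  by have -> : t / 2 * (2 / t * - ln e) = - ln e by field; rewrite gt_eqF.
have -> : Lom * ((1 - t / 4) * a k) = (1 - t / 4) * (Lom * a k) by ring.
have : 0 <= t * t * l by rewrite !mulr_ge0// ltW.
lra.
Qed.

Lemma weight_lower cr n d : (0 < d)%N -> suff_n cr (1 / 8) n d ->
  d%:R * om `^ a d <= 2 * (1 + ln n%:R).
Proof.
move=> d0 /(complexity_lower_sum hom ha1 hamono b0_gt0 hb0)[_]; apply: le_trans.
rewrite mulr_natl -[X in _ *+ X]card_ord -sumr_const; apply: ler_sum => k _.
by apply: (le_powom hom); apply: (a_mono hamono).
Qed.

Lemma liminf_of_UWT cr : ALG_UWT (nst cr) ->
  forall c', c' < 1 / Lom -> exists N : nat, forall j, (N <= j)%N -> c' <= a j / ln j%:R.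
Proof.
move=> hU c' hc'; pose be := (1 - c' * Lom) / 2.
have cL : c' * Lom < 1 by move: hc'; rewrite ltr_pdivlMr.
have be0 : 0 < be by rewrite divr_gt0//; lra.
have [D hD] := stWT_elim be0 (hU 1 be ltr01 be0) ltr01.
have [D1 hD1] := powR_large 1 be0; have [D2 hD2] := ln_large (ln 4 / be).
exists (maxn D (maxn D1 D2)) => j; rewrite !geq_max => /and3P[Dj D1j /hD2[j1 lj]].
have j0 : (0 < j)%N by exact: ltnW.
have [n [hn lnn]] := hD j Dj j0; have := weight_lower j0 hn => hw.
have jb := hD1 j D1j; rewrite mul1r in lnn.
have l0 : 0 < ln j%:R :> R by rewrite ln_gt0// ltr1n.
have j0R : 0 < j%:R :> R by rewrite ltr0n.
have h4 : j%:R * om `^ a j <= 4 * j%:R `^ be by lra.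
have hln : ln (j%:R * om `^ a j) <= ln (4 * j%:R `^ be).
  by rewrite ler_ln ?posrE// mulr_gt0 ?powR_gt0// om_gt0.
have p4 : 0 < 4 :> R by [].
have pj : 0 < j%:R `^ be :> R by rewrite powR_gt0.
rewrite (lnM j0R (powom_gt0 hom _)) (lnM p4 pj) !ln_powR in hln.
have oE : ln om = - Lom by rewrite lnV ?opprK// posrE om_gt0.
rewrite oE in hln; rewrite ler_pdivlMr// -(ler_pM2r L0).
have h5 : ln 4 < be * ln j%:R by move: lj; rewrite ltr_pdivrMr// mulrC.
have -> : c' * ln j%:R * Lom = (1 - 2 * be) * ln j%:R by rewrite /be; field.
lra.
Qed.

Lemma divergence_of_stWT cr (s : R) : 0 < s -> ALG_stWT s 1 (nst cr) ->
  forall M : R, exists N : nat, forall j : nat, (N <= j)%N -> M <= a j.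
Proof.
(* For large [j], each of the two parts of [2 (1 + ln n)] is at most half of [j om^M]. *)
move=> s0 h M; pose e := om `^ M / 4; have e0 : 0 < e by rewrite divr_gt0// powom_gt0.
have [D hD] := stWT_elim ltr01 h e0; have [D1 hD1] := powR_large (4 / om `^ M) ltr01.
have oM : 0 < om `^ M by exact: powom_gt0.
exists (maxn (maxn D D1) 2) => j; rewrite !geq_max => /andP[/andP[Dj D1j] j1].
have j0 : (0 < j)%N by exact: ltnW.
have j0R : 0 < j%:R :> R by rewrite ltr0n.
have [n [hn lnn]] := hD j Dj j0; have := weight_lower j0 hn => hw.
have jb := hD1 j D1j; rewrite powRr1 ?ler0n// in jb lnn.
have h1 : j%:R * om `^ a j <= j%:R * om `^ M.
  rewrite ler_pdivrMr// in jb; apply: (le_trans hw).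
  by rewrite /e in lnn; lra.
rewrite ler_pM2l// !(powomE hom) ler_expR lerN2 ler_pM2l// in h1.
Qed.

Lemma ln_le_powR (p y : R) : 0 < p -> 0 < y -> ln y <= y `^ p / p.
Proof.
move=> p0 y0; rewrite ler_pdivlMr// mulrC -ln_powR.
by apply: (le_trans (ln_le_sub1 (powR_gt0 _ y0))); lra.
Qed.

(** * Sufficiency of the decay condition for 0 < t < 1 *)

Section CvgToZero.
Variable t : R.
Hypotheses (t0 : 0 < t) (t1 : t < 1).
Hypothesis cvg0 : forall e, 0 < e -> exists N : nat, forall j : nat, (N <= j)%N ->
  `|j%:R `^ (1 - t) * a j * om `^ a j| < e.

Let mul_powom_small e : 0 < e -> exists N : nat, forall k, (N <= k)%N -> (0 < k)%N ->
  a k * om `^ a k <= e * k%:R `^ (t - 1).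
Proof.
move=> /cvg0[N hN]; exists N => k Nk k0; have := hN k Nk.
rewrite ger0_norm; last by rewrite !mulr_ge0 ?powR_ge0// ltW// a0.
have kp : 0 < k%:R `^ (1 - t) :> R by rewrite powR_gt0// ltr0n.
rewrite -mulrA mulrC -ltr_pdivlMr// -powRN opprB => /ltW; exact.
Qed.

Let powom_small e : 0 < e -> exists N : nat, forall k, (N <= k)%N -> (0 < k)%N ->
  om `^ a k <= e * k%:R `^ (t - 1).
Proof.
move=> e0; have [N hN] := mul_powom_small (mulr_gt0 ha1 e0); exists N => k Nk k0.
rewrite -(ler_pM2l ha1) mulrA; apply: le_trans (hN k Nk k0).
by rewrite ler_wpM2r// a_ge.
Qed.

(** Eventually [om^(a_k) <= k^(t-1)], hence [a_k >= (1 - t) / Lom * ln k]; the factor [a_k] in the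
    hypothesis therefore dominates [ln k]. *)
Let ln_mul_powom_small e : 0 < e -> exists N : nat, forall k, (N <= k)%N -> (0 < k)%N ->
  ln k%:R * om `^ a k <= e * k%:R `^ (t - 1).
Proof.
move=> e0; have t1' : 0 < 1 - t by have := t1; lra.
have c0 : 0 < (1 - t) / Lom by rewrite divr_gt0.
have [N hN] := mul_powom_small (mulr_gt0 c0 e0); have [N1 hN1] := powom_small ltr01.
exists (maxn N N1) => k; rewrite geq_max => /andP[Nk N1k] k0.
have h1 := hN1 k N1k k0; rewrite mul1r in h1.
have k0R : 0 < k%:R :> R by rewrite ltr0n.
have h2 : (1 - t) / Lom * ln k%:R <= a k.
  have : ln (om `^ a k) <= ln (k%:R `^ (t - 1)).
    by rewrite ler_ln ?posrE ?powR_gt0// om_gt0.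
  rewrite (powomE hom) expRK ln_powR => h.
  by rewrite mulrAC ler_pdivrMr//; lra.
rewrite -(ler_pM2l c0) mulrA; apply: (@le_trans _ _ (a k * om `^ a k)).
  by rewrite ler_wpM2r.
by apply: (le_trans (hN k Nk k0)); rewrite mulrA.
Qed.

(** The decay of [om^(a_k)] gains [ln k], whereas [ln d] is needed. The difference [ln(d/k)] is at
    most a multiple of [(d/k)^(t/2)], and summing [d^(t/2) k^(t/2-1)] still gives order [d^t]. *)
Lemma ln_sum_small e : 0 < e -> exists2 K, 0 <= K & forall d : nat, (0 < d)%N ->
  ln_plus d%:R * \sum_(1 <= k < d.+1) om `^ a k <= K + e * d%:R `^ t.
Proof.
move=> e0; have t2 : 0 < t / 2 by rewrite divr_gt0.
have ht : 0 < t <= 1 by rewrite t0 ltW.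
have ht2 : 0 < t / 2 <= 1 by rewrite t2 /=; have := t1; lra.
(* With this [e1] each of the two power sums contributes [e/8 * d^t]. *)
pose e1 : R := e * t / 16; have e10 : 0 < e1 by rewrite divr_gt0// mulr_gt0.
have e12 : 0 <= 2 * e1 := mulr_ge0 (ler0n R 2) (ltW e10).
have e20 : 0 < e1 * (t / 2) by rewrite mulr_gt0.
have [N1 h1] := powom_small e10; have [N2 h2] := ln_mul_powom_small e10.
have [N3 h3] := powom_small e20.
pose N := maxn N1 (maxn N2 N3).
have [K K0 hK] := sqr_le_expR (ltr_wpDl (ler0n R N) ltr01) t0 (divr_gt0 e0 (ltr0Sn R 1)).
exists (N%:R + K) => [|d d0]; first by rewrite addr_ge0.
have d0R : 0 < d%:R :> R by rewrite ltr0n.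
have lp : ln_plus d%:R <= 1 + ln d%:R :> R by exact: ln_plus_le.
have ld := ln_nat_ge0 R d.
apply: (@le_trans _ _ (\sum_(1 <= k < d.+1) ((k < N)%N%:R * (1 + ln d%:R) +
   2 * e1 * (k%:R `^ (t - 1)) + e1 * (d%:R `^ (t / 2) * k%:R `^ (t / 2 - 1))))).
  rewrite mulr_sumr big_nat_cond [leRHS]big_nat_cond; apply: ler_sum => k /andP[/andP[k0 _] _].
  have k0R : 0 < k%:R :> R by rewrite ltr0n.
  apply: (@le_trans _ _ ((1 + ln d%:R) * om `^ a k)); first by rewrite ler_wpM2r.
  have [kN|] := ltnP k N.
    rewrite /= mul1r -addrA -[leLHS]addr0 lerD//.
      by rewrite ler_piMr ?addr_ge0// powom_le1// ltW// a0.
    by apply: addr_ge0; [exact: mulr_ge0 e12 (powR_ge0 _ _) | exact: mulr_ge0 (ltW e10) (mulr_ge0 (powR_ge0 _ _) (powR_ge0 _ _))].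
  rewrite !geq_max => /and3P[N1k N2k N3k]; rewrite mul0r add0r.
  have g1 := h1 k N1k k0; have g2 := h2 k N2k k0; have g3 := h3 k N3k k0.
  have hdk : ln d%:R <= ln k%:R + (d%:R / k%:R) `^ (t / 2) / (t / 2).
    have := ln_le_powR t2 (divr_gt0 d0R k0R); rewrite ln_div ?posrE//.
    by move: (ln _) (ln _) => u v; lra.
  have E1 : (d%:R / k%:R) `^ (t / 2) = d%:R `^ (t / 2) * k%:R `^ (- (t / 2)).
    by rewrite powRM ?invr_ge0// -[k%:R^-1]powR_inv1// -powRrM mulN1r.
  have E2 : k%:R `^ (t / 2 - 1) = k%:R `^ (- (t / 2)) * k%:R `^ (t - 1).
    rewrite -powRD; first by congr powR; field.
    by apply/implyP => _; rewrite gt_eqF.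
  apply: (@le_trans _ _ (om `^ a k + ln k%:R * om `^ a k +
      d%:R `^ (t / 2) * k%:R `^ (- (t / 2)) / (t / 2) * om `^ a k)).
    by rewrite -E1 -[X in _ <= X + _ + _]mul1r -!mulrDl ler_wpM2r// -addrA lerD2l.
  apply: lerD; first by lra.
  have c0 : 0 <= d%:R `^ (t / 2) * k%:R `^ (- (t / 2)) / (t / 2).
    by rewrite divr_ge0 ?mulr_ge0 ?powR_ge0// ltW.
  apply: (le_trans (ler_wpM2l c0 g3)); rewrite E2 le_eqVlt; apply/orP; left.
  by apply/eqP; field; rewrite gt_eqF.
rewrite 2!big_split/= -mulr_suml -!mulr_sumr.
have S1 : (\sum_(1 <= k < d.+1) (k < N)%N%:R) * (1 + ln d%:R) <= N%:R * (1 + ln d%:R) :> R.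
  by rewrite ler_wpM2r ?sum_lt_le ?addr_ge0//.
have S2 : 2 * e1 * (\sum_(1 <= k < d.+1) k%:R `^ (t - 1)) <= 2 * e1 * (d%:R `^ t / t).
  by apply: ler_wpM2l e12 _ _ _; exact: sum_powR_le.
have S3 : e1 * (d%:R `^ (t / 2) * \sum_(1 <= k < d.+1) k%:R `^ (t / 2 - 1)) <=
    e1 * (d%:R `^ (t / 2) * (d%:R `^ (t / 2) / (t / 2))).
  by rewrite ler_wpM2l ?(ltW e10)// ler_wpM2l ?powR_ge0// sum_powR_le.
have dt : d%:R `^ (t / 2) * d%:R `^ (t / 2) = d%:R `^ t.
  rewrite -powRD; first by congr powR; field.
  by apply/implyP => _; rewrite gt_eqF.
have S4 := hK _ ld; rewrite expR_lnM// in S4.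
have e3 : 2 * e1 * (d%:R `^ t / t) = e / 8 * d%:R `^ t by rewrite /e1; field; rewrite gt_eqF.
have e4 : e1 * (d%:R `^ (t / 2) * (d%:R `^ (t / 2) / (t / 2))) = e / 8 * d%:R `^ t.
  rewrite (mulrA (d%:R `^ (t / 2))) dt /e1; field; exact: lt0r_neq0.
rewrite e3 in S2; rewrite e4 in S3.
have dp : 0 <= e * d%:R `^ t by rewrite mulr_ge0 ?powR_ge0 ?(ltW e0).
have h0 : 0 <= (N%:R + 1 : R) * ln d%:R ^+ 2 by rewrite mulr_ge0 ?sqr_ge0// addr_ge0.
move: S1 S2 S3 S4 h0; move: (d%:R `^ t) dp (ln d%:R) ld => D dp y ld.
lra.
Qed.

(** The hypothesis is at the critical exponent, so a fixed [sg] would lose too much. With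
    [sg = 1/(2 ln_+ d)] the exponent returns to [a_k] at the price of a factor [ln_+ d], which
    [ln_sum_small] absorbs. *)
Lemma stWT_of_cvg cr (s : R) : 0 < s -> ALG_stWT s t (nst cr).
Proof.
move=> s0; have [C C0 hC] := nstar_upper hom ha1 hamono b0_gt0 hb0 cl cr.
have t0' := t0; apply: (stWT_intro s0 t0') => e e0.
have C2 : 0 < 2 * C by rewrite mulr_gt0.
have [K1 K10 hK1] := sqr_le_expR C2 s0 e0.
have C12 : 0 < 12 * C by rewrite mulr_gt0.
have e2 : 0 < e / 2 by rewrite divr_gt0.
have [K2 K20 hK2] := sqr_le_expR C12 t0' e2.
pose c := 2 * C * expR 4; have c0 : 0 < c by rewrite mulr_gt0 ?expR_gt0.
have [K3 K30 hK3] := ln_sum_small (divr_gt0 e2 c0).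
exists (12 * C + K1 + K2 + c * K3) => d eps d0 heps; have [e0' e1] := andP heps.
set l := ln_plus d%:R : R; have l1 : 1 <= l by exact: ln_plus_ge1.
have ld : ln d%:R <= l by exact: ln_le_ln_plus.
have lp : l <= 1 + ln d%:R by exact: ln_plus_le.
have hsg : 0 < 1 / (2 * l) <= 1 / 2.
  by rewrite divr_gt0 ?mulr_gt0//=; [rewrite ler_pdivrMr ?mulr_gt0//; lra | lra].
have [n [nE hn]] := hC _ d eps hsg heps; exists n; split => //.
apply: (le_trans hn).
have -> : C / (1 / (2 * l)) = 2 * C * l by field; rewrite gt_eqF//; lra.
set S := \sum_(1 <= k < d.+1) om `^ a k.
have hsum : \sum_(1 <= k < d.+1) om `^ ((1 - 1 / (2 * l)) * a k) <= expR 4 * S + 1.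
  apply: (@le_trans _ _ (\sum_(1 <= k < d.+1) (expR 4 * om `^ a k + 1 / d%:R))).
    rewrite big_nat_cond [leRHS]big_nat_cond; apply: ler_sum => k /andP[/andP[k0 _] _].
    by rewrite [1 / d%:R]div1r; apply: powom_split => //; exact: ltW (a0 k0).
  by rewrite big_split/= sum_invn// -mulr_sumr.
have x0 : 0 <= ln eps^-1 by rewrite ln_ge0// invf_ge1// ltW.
have hx := hK1 _ x0; rewrite expR_ln_eps// in hx.
have y0 := ln_nat_ge0 R d.
have hy := hK2 _ y0; rewrite expR_lnM// in hy.
have hS := hK3 d d0; rewrite -/l -/S in hS.
have cE : c * (K3 + e / 2 / c * d%:R `^ t) = c * K3 + e / 2 * d%:R `^ t.
  by field; rewrite gt_eqF.
have hcS : c * (l * S) <= c * K3 + e / 2 * d%:R `^ t by rewrite -cE ler_pM2l.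
apply: (@le_trans _ _ (2 * C * l * (1 + ln eps^-1 + (expR 4 * S + 1)))).
  by rewrite ler_wpM2l ?lerD2l// mulr_ge0 ?(ltW C2)//; lra.
have -> : 2 * C * l * (1 + ln eps^-1 + (expR 4 * S + 1)) =
    2 * C * (2 * l + l * ln eps^-1) + c * (l * S) by rewrite /c; ring.
set x := ln eps^-1 in x0 hx *; set y := ln d%:R in y0 hy lp ld *.
have q1 : 2 * l + l * x <= 6 + 6 * y ^+ 2 + x ^+ 2.
  have := sqr_ge0 (l - x); have := sqr_ge0 (l - 1); have := sqr_ge0 (y - 1); nra.
have q2 : 2 * C * (2 * l + l * x) <= 2 * C * (6 + 6 * y ^+ 2 + x ^+ 2) by rewrite ler_pM2l.
have : 0 <= C * x by rewrite mulr_ge0// ltW.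
have : 0 <= C * y by rewrite mulr_ge0// ltW.
lra.
Qed.

End CvgToZero.

(** The function [x om^x] increases for small [x], so monotonicity holds only up to a constant: for
    [de = a_d - a_k], [de exp(-Lom de) <= 1 / Lom], which is at most a multiple of [a_k]. *)
Lemma mul_powom_quasi_mono k d : (0 < k)%N -> (k <= d)%N ->
  a d * om `^ a d <= (1 + (Lom * a 1%N)^-1) * (a k * om `^ a k).
Proof.
move=> k0 kd; have ak := a_mono hamono k0 kd; have a1k := a_ge hamono k0.
pose de := a d - a k; have de0 : 0 <= de by rewrite subr_ge0.
have La : 0 < Lom * a 1%N by rewrite mulr_gt0.
have -> : a d * om `^ a d = (a k + de) * expR (- (Lom * de)) * om `^ a k.
  rewrite (addrC (a k)) subrK -mulrA !(powomE hom) -expRD; congr (_ * expR _).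
  by rewrite /de; ring.
rewrite mulrA ler_wpM2r//.
have E1 : expR (- (Lom * de)) <= 1 by rewrite expR_le1 oppr_le0 mulr_ge0// ltW.
have E0 := expR_gt0 (- (Lom * de)).
have E2 : Lom * de * expR (- (Lom * de)) <= 1.
  rewrite -[leRHS](expRxMexpNx_1 (Lom * de)) ler_pM2r//.
  by have := expR_ge1Dx (Lom * de); lra.
have E3 : de * expR (- (Lom * de)) <= Lom^-1.
  by rewrite -(ler_pM2l L0) mulrA divff ?gt_eqF.
have E4 : Lom^-1 <= (Lom * a 1%N)^-1 * a k.
  rewrite invfM -mulrA ler_peMr ?invr_ge0 ?(ltW L0)//.
  by rewrite mulrC ler_pdivlMr// mul1r.
have : a k * expR (- (Lom * de)) <= a k by rewrite ler_piMr// ltW// a0.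
move: E3 E4; rewrite !mulrDl mul1r; lra.
Qed.

Lemma cvg_of_stWT cr (s t : R) : 0 < t < 1 -> ALG_stWT s t (nst cr) ->
  forall e, 0 < e -> exists N : nat, forall j : nat, (N <= j)%N ->
  `|j%:R `^ (1 - t) * a j * om `^ a j| < e.
Proof.
move=> /andP[t0 t1] h e e0; have [C C0 hC] := moment_lower.
pose Q := 1 + (Lom * a 1%N)^-1.
have Q0 : 0 < Q by rewrite addr_gt0 ?invr_gt0 ?mulr_gt0.
have QC : 0 < Q * C by rewrite mulr_gt0.
pose eta := e / (8 * (Q * C)); have eta0 : 0 < eta by rewrite divr_gt0// mulr_gt0.
have [D hD] := stWT_elim t0 h eta0.
have [K K0 hK] := sqr_le_expR ltr01 t0 eta0.
have [D1 hD1] := powR_large ((1 + K) / eta) t0.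
exists (maxn (maxn D D1) 1) => d; rewrite !geq_max => /andP[/andP[Dd D1d] d0].
have [n [hn lnn]] := hD d Dd d0.
have [n0 _] := complexity_lower_sum hom ha1 hamono b0_gt0 hb0 hn.
have n1 : 1 <= n%:R :> R by rewrite ler1n.
have hm := hC cr n d n%:R d0 n1 (lexx _) hn.
have lp : ln_plus d%:R <= 1 + ln d%:R :> R by exact: ln_plus_le.
have ld := ln_nat_ge0 R d; have hy := hK _ ld; rewrite expR_lnM// in hy.
have hd1 := hD1 d D1d; rewrite ler_pdivrMr// in hd1.
have d0R : 0 < d%:R :> R by rewrite ltr0n.
have dt : 0 < d%:R `^ t :> R by rewrite powR_gt0.
rewrite ger0_norm; last by rewrite !mulr_ge0 ?powR_ge0// ltW// a0.
(* Quasi-monotonicity bounds the last term by the average, and the moment lower bound controls the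
   sum by [ln_+ d + ln n]. *)
have hsum : d%:R * (a d * om `^ a d) <= Q * \sum_(1 <= k < d.+1) a k * om `^ a k.
  rewrite mulr_sumr.
  have -> : d%:R * (a d * om `^ a d) = \sum_(1 <= k < d.+1) a d * om `^ a d.
    by rewrite sumr_const_nat subSS subn0 -[RHS]mulr_natl.
  rewrite big_nat_cond [leRHS]big_nat_cond; apply: ler_sum => k /andP[/andP[k0 kd] _].
  exact: mul_powom_quasi_mono.
have h1 : ln_plus d%:R + ln n%:R <= 3 * eta * d%:R `^ t.
  have : 0 <= ln d%:R ^+ 2 :> R by exact: sqr_ge0.
  rewrite mul1r in hy; lra.
have h2 : d%:R * (a d * om `^ a d) <= Q * C * (3 * eta * d%:R `^ t).
  apply: (le_trans hsum); rewrite -mulrA ler_pM2l//; apply: (le_trans hm).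
  by rewrite ler_pM2l.
have h3 : Q * C * (3 * eta * d%:R `^ t) = 3 / 8 * e * d%:R `^ t.
  by rewrite /eta; field; rewrite !gt_eqF.
have dE : d%:R `^ (1 - t) * d%:R `^ t = d%:R :> R.
  rewrite -powRD ?subrK ?powRr1 ?ler0n//.
  by apply/implyP => _; rewrite gt_eqF.
rewrite h3 -[X in X * (a d * _)]dE in h2.
have h4 : d%:R `^ (1 - t) * a d * om `^ a d <= 3 / 8 * e.
  by rewrite -(ler_pM2r dt); move: h2; congr (_ <= _); ring.
by apply: (le_lt_trans h4); lra.
Qed.

End Parts.

Unset Implicit Arguments.
Set Strict Implicit.
Set Printing Implicit Defensive.

Theorem theorem5p7 (R : realType) (om : R) (a b : nat -> R)
  (hom : 0 < om < 1)
  (ha1 : 0 < a 1%N)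
  (hamono : forall j : nat, (0 < j)%N -> a j <= a j.+1)
  (hb : exists b0 : R, 0 < b0 /\ forall j : nat, (0 < j)%N -> b0 <= b j)
  (cl : info_class) :
  (* 1 *)
  (forall cr : criterion,
     (ALG_SPT (nstar om a b cl cr) <-> ALG_PT (nstar om a b cl cr)) /\
     (ALG_PT (nstar om a b cl cr) <->
       ((1 / ln om^-1)%:E < limn_einf (fun j : nat => (a j / ln j%:R)%:E))%E)) /\
  (* 2 *)
  (ALG_QPT (nstar om a b cl NOR) <->
     exists M : R, forall d : nat, (0 < d)%N ->
       (ln_plus d%:R)^-1 * \sum_(1 <= j < d.+1) a j * om `^ (a j) <= M) /\
  (* 3 *)
  (forall cr : criterion,
     ALG_UWT (nstar om a b cl cr) <->
       ((1 / ln om^-1)%:E <= limn_einf (fun j : nat => (a j / ln j%:R)%:E))%E) /\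
  (* 4 *)
  (forall cr : criterion, forall s t : R, 0 < s -> 1 < t ->
     ALG_stWT s t (nstar om a b cl cr)) /\
  (* 5 *)
  (forall cr : criterion, forall s : R, 0 < s ->
     (ALG_stWT s 1 (nstar om a b cl cr) <-> ALG_WT (nstar om a b cl cr)) /\
     (ALG_WT (nstar om a b cl cr) <->
        forall M : R, exists N : nat, forall j : nat, (N <= j)%N -> M <= a j)) /\
  (* 6 *)
  (forall cr : criterion, forall s t : R, 0 < s -> 0 < t < 1 ->
     (ALG_stWT s t (nstar om a b cl cr) <->
       (fun j : nat => j%:R `^ (1 - t) * a j * om `^ (a j)) @ \oo --> (0 : R))).
Proof.
have [b0 [b0_gt0 hb0]] := hb.
have PT_liminf cr : ALG_PT (nstar om a b cl cr) ->
    ((1 / ln om^-1)%:E < limn_einf (fun j : nat => (a j / ln j%:R)%:E))%E.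
  by move=> /(liminf_of_PT hom ha1 hamono b0_gt0 hb0) h; apply/limn_einf_gt.
have liminf_SPT cr : ((1 / ln om^-1)%:E < limn_einf (fun j : nat => (a j / ln j%:R)%:E))%E ->
    ALG_SPT (nstar om a b cl cr).
  by move=> /limn_einf_gt[c hc hN]; exact: (SPT_of_liminf hom ha1 hamono b0_gt0 hb0 cl cr hc).
have WT_div cr s : 0 < s -> ALG_stWT s 1 (nstar om a b cl cr) ->
    forall M : R, exists N : nat, forall j : nat, (N <= j)%N -> M <= a j.
  exact: (divergence_of_stWT hom ha1 hamono b0_gt0 hb0).
have div_WT cr s : 0 < s ->
    (forall M : R, exists N : nat, forall j : nat, (N <= j)%N -> M <= a j) ->
    ALG_stWT s 1 (nstar om a b cl cr).
  by move=> s0; apply: (stWT_of_divergence hom ha1 hamono b0_gt0 hb0) => //.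
split=> [cr|]; first split; [split | split |].
- exact: PT_of_SPT.
- by move=> /PT_liminf /liminf_SPT.
- exact: PT_liminf.
- by move=> /liminf_SPT /PT_of_SPT.
split.
  split; first exact: (QPT_lower hom ha1 hamono b0_gt0 hb0).
  by move=> [M]; exact: (QPT_upper hom ha1 hamono b0_gt0 hb0).
split=> [cr|].
  split=> [hU|/limn_einf_ge]; last exact: (UWT_of_liminf hom ha1 hamono b0_gt0 hb0).
  by apply/limn_einf_ge; exact: (liminf_of_UWT hom ha1 hamono b0_gt0 hb0 hU).
split=> [cr s t|]; first exact: (stWT_large_t hom ha1 hamono b0_gt0 hb0).
split=> [cr s s0|cr s t s0 ht].
  split; split.
  - by move=> /(WT_div _ _ s0); exact: div_WT.
  - by move=> /(WT_div _ _ ltr01); exact: div_WT.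
  - exact: WT_div.
  - exact: div_WT.
split=> [h|/cvgn0P h].
  by apply/cvgn0P; exact: (cvg_of_stWT hom ha1 hamono b0_gt0 hb0 ht h).
by have [t0 t1] := andP ht; exact: (stWT_of_cvg hom ha1 hamono b0_gt0 hb0 cl t0 t1 h).
Qed.
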